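(* Let $A\neq0$, let $M_A\subset\mathbb{R}^6$ be the $5$-dimensional submanifold of triples of points $(x_i,y_i)$, $i=1,2,3$, in the plane spanning a triangle of signed area $A$, let $$Z_i=(x_{i+1}-x_{i+2})\,\partial_{x_i}+(y_{i+1}-y_{i+2})\,\partial_{y_i},\qquad i=1,2,3\ (\text{indices mod }3),$$ and let $\mathcal{D}=\{\sum_{i=1}^3u_iZ_i \mid \sum_{i=1}^3u_i=0\}$, a $(2,3,5)$ distribution on $M_A$. Then the Cartan quartic of $\mathcal{D}$ is equal to the form $$\sum_{i=1}^3u_iZ_i\ \longmapsto\ c\,(u_1^2+u_2^2+u_3^2)^2,\qquad \sum_{i=1}^3u_i=0,$$ where $c$ is a constant.
   Context: Setting: a point of $\mathbb{R}^6$ with coordinates $(x_1,y_1,x_2,y_2,x_3,y_3)$ encodes three points in the plane; the signed area is $A=\tfrac12\sum_{i=1}^3(y_ix_{i+1}-x_iy_{i+1})$. The $Z_i$ are tangent to every $M_A$. For a distribution put $\mathcal{D}^0=\mathcal D$, $\mathcal{D}^{I+1}=[\mathcal{D}^I,\mathcal{D}^I]+\mathcal{D}^I$; a rank $2$ distribution on a $5$-manifold is a $(2,3,5)$ distribution if $\mathcal{D},\mathcal{D}^1,\mathcal{D}^2$ have ranks $2,3,5$ at every point. Cartan quartic. Let $\mathcal{D}$ be a $(2,3,5)$ distribution on a $5$-manifold. Locally there exist coframes $(\theta^1,\dots,\theta^5)$ with $\mathcal{D}=\ker\theta^1\cap\ker\theta^2\cap\ker\theta^3$, and $1$-forms $\Omega_1,\dots,\Omega_7$,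 such that $$\begin{aligned} d\theta^1&=\theta^1\wedge(2\Omega_1+\Omega_4)+\theta^2\wedge\Omega_2+\theta^3\wedge\theta^4,\\ d\theta^2&=\theta^1\wedge\Omega_3+\theta^2\wedge(\Omega_1+2\Omega_4)+\theta^3\wedge\theta^5,\\ d\theta^3&=\theta^1\wedge\Omega_5+\theta^2\wedge\Omega_6+\theta^3\wedge(\Omega_1+\Omega_4)+\theta^4\wedge\theta^5,\\ d\theta^4&=\theta^1\wedge\Omega_7+\tfrac43\theta^3\wedge\Omega_6+\theta^4\wedge\Omega_1+\theta^5\wedge\Omega_2,\\ d\theta^5&=\theta^2\wedge\Omega_7-\tfrac43\theta^3\wedge\Omega_5+\theta^4\wedge\Omega_3+\theta^5\wedge\Omega_4 . \end{aligned}$$ The conformal class of the signature $(2,3)$ metric $g=2\theta^1\theta^5-2\theta^2\theta^4+\tfrac43(\theta^3)^2$ (with $\lambda\mu=\tfrac12(\lambda\otimes\mu+\mu\otimes\lambda)$) depends only on $\mathcal{D}$. Let $W$ be the Weyl tensor of $g$, with all indices lowered by $g$, and let $(e_1,\dots,e_5)$ be the frame dual to $(\theta^i)$, so $\mathcal{D}=\mathrm{Span}(e_4,e_5)$. The Cartan quartic is the homogeneous quartic form on $\mathcal{D}$ $$\mathcal{D}\ni s\,e_4+z\,e_5\ \longmapsto\ W(s e_4+z e_5,\ s e_1+z e_2,\ s e_1+z e_2,\ s e_4+z e_5),$$ which depends only on $\mathcal{D}$ (up to the choice of an overall universal normalization constant). *)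

(* Defs.v *)
From HB Require Import structures.
From mathcomp Require Export all_boot all_order all_algebra.
From mathcomp Require Export boolp classical_sets functions reals topology.
From mathcomp Require Export normedtype derive.
Set Implicit Arguments.
Unset Strict Implicit.
Unset Printing Implicit Defensive.
Import Order.TTheory GRing.Theory Num.Theory.
Import numFieldNormedType.Exports.
Local Open Scope classical_set_scope.
Local Open Scope ring_scope.

(* The manifolds below are hypersurfaces M = {F = a} of the space of row
   vectors 'rV[R]_6.  Functions, vector fields and 1-forms on an open subset of
   M are given by smooth extensions to an open subset U of 'rV[R]_6; conditions
   are imposed at the points of M and on vectors tangent to M only, so that
   they do not depend on the extensions. *)

Definition partials (R : realType) (s : seq 'I_6) (f : 'rV[R]_6 -> R) :
    'rV[R]_6 -> R :=
  foldr (fun i g p => 'D_(delta_mx 0 i) g p) f s.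

Definition smooth_on (R : realType) (U : set 'rV[R]_6) (f : 'rV[R]_6 -> R) :=
  forall (s : seq 'I_6) p, U p -> differentiable (partials s f) p.

(* Used both for vector fields and for 1-forms (a covector is the row of its
   coefficients on dx_1, dy_1, ..., dx_3, dy_3). *)
Definition smooth_field (R : realType) (U : set 'rV[R]_6)
    (X : 'rV[R]_6 -> 'rV[R]_6) :=
  forall i : 'I_6, smooth_on U (fun p => X p 0 i).

Definition pairing (R : realType) (al v : 'rV[R]_6) : R :=
  \sum_(i < 6) al 0 i * v 0 i.

Definition lie_bracket (R : realType) (X Y : 'rV[R]_6 -> 'rV[R]_6)
    (p : 'rV[R]_6) : 'rV[R]_6 :=
  'D_(X p) Y p - 'D_(Y p) X p.

Definition wedge (R : realType) (al be u v : 'rV[R]_6) : R :=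
  pairing al u * pairing be v - pairing al v * pairing be u.

(* Exterior derivative of a 1-form, evaluated on two (constant) vectors; same
   normalization as [wedge]. *)
Definition ext_d (R : realType) (al : 'rV[R]_6 -> 'rV[R]_6)
    (p u v : 'rV[R]_6) : R :=
  'D_u (fun q => pairing (al q) v) p - 'D_v (fun q => pairing (al q) u) p.

Definition level (R : realType) (F : 'rV[R]_6 -> R) (a : R) : set 'rV[R]_6 :=
  [set p | F p = a].

(* Tangent space of the regular level set of F through p. *)
Definition tangent (R : realType) (F : 'rV[R]_6 -> R) (p : 'rV[R]_6) :
    set 'rV[R]_6 :=
  [set v | 'D_v F p = 0].

Definition has_rank (R : realType) (V : set 'rV[R]_6) (r : nat) :=
  exists B : 'M[R]_(r, 6), row_free B /\ V = [set v | (v <= B)%MS].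

Definition is_section (R : realType) (M : set 'rV[R]_6)
    (D : 'rV[R]_6 -> set 'rV[R]_6) (U : set 'rV[R]_6)
    (X : 'rV[R]_6 -> 'rV[R]_6) :=
  smooth_field U X /\ (forall q, U q -> M q -> D q (X q)).

(* [D, D] + D *)
Definition derived (R : realType) (M : set 'rV[R]_6)
    (D : 'rV[R]_6 -> set 'rV[R]_6) (p : 'rV[R]_6) : set 'rV[R]_6 :=
  [set v | exists (U : set 'rV[R]_6) (n : nat)
             (X Y : 'I_n -> 'rV[R]_6 -> 'rV[R]_6) (w : 'rV[R]_6),
     [/\ open U /\ U p,
         forall i, is_section M D U (X i) /\ is_section M D U (Y i),
         D p w &
         v = w + \sum_(i < n) lie_bracket (X i) (Y i) p]].

Definition is_235_distribution (R : realType) (F : 'rV[R]_6 -> R) (a : R)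
    (D : 'rV[R]_6 -> set 'rV[R]_6) :=
  let M := level F a in
  forall p, M p ->
  [/\ has_rank (tangent F p) 5 /\ D p `<=` tangent F p,
      forall v, D p v -> exists U X,
        [/\ open U, U p, is_section M D U X & X p = v],
      has_rank (D p) 2,
      has_rank (derived M D p) 3 &
      has_rank (derived M (derived M D) p) 5].

Definition i1 : 'I_5 := @Ordinal 5 0 isT.
Definition i2 : 'I_5 := @Ordinal 5 1 isT.
Definition i3 : 'I_5 := @Ordinal 5 2 isT.
Definition i4 : 'I_5 := @Ordinal 5 3 isT.
Definition i5 : 'I_5 := @Ordinal 5 4 isT.

Definition structure_equations (R : realType)
    (th : 'I_5 -> 'rV[R]_6 -> 'rV[R]_6)
    (O1 O2 O3 O4 O5 O6 O7 : 'rV[R]_6 -> 'rV[R]_6) (q u v : 'rV[R]_6) :=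
  let w al be := wedge al be u v in
  let t1 := th i1 q in let t2 := th i2 q in let t3 := th i3 q in
  let t4 := th i4 q in let t5 := th i5 q in
  [/\ ext_d (th i1) q u v =
        w t1 (2 *: O1 q + O4 q) + w t2 (O2 q) + w t3 t4,
      ext_d (th i2) q u v =
        w t1 (O3 q) + w t2 (O1 q + 2 *: O4 q) + w t3 t5,
      ext_d (th i3) q u v =
        w t1 (O5 q) + w t2 (O6 q) + w t3 (O1 q + O4 q) + w t4 t5,
      ext_d (th i4) q u v =
        w t1 (O7 q) + 4 / 3 * w t3 (O6 q) + w t4 (O1 q) + w t5 (O2 q) &
      ext_d (th i5) q u v =
        w t2 (O7 q) - 4 / 3 * w t3 (O5 q) + w t4 (O3 q) + w t5 (O4 q)].

(* th is a coframe on U `&` M, with dual frame e (tangent to M), adapted to D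
   and satisfying Cartan's structure equations for some 1-forms O1, ..., O7. *)
Definition adapted_coframe (R : realType) (F : 'rV[R]_6 -> R) (a : R)
    (D : 'rV[R]_6 -> set 'rV[R]_6) (U : set 'rV[R]_6)
    (th e : 'I_5 -> 'rV[R]_6 -> 'rV[R]_6) :=
  (forall i, smooth_field U (th i) /\ smooth_field U (e i)) /\
  exists O1 O2 O3 O4 O5 O6 O7 : 'rV[R]_6 -> 'rV[R]_6,
    ([/\ smooth_field U O1, smooth_field U O2, smooth_field U O3 &
         smooth_field U O4] /\
     [/\ smooth_field U O5, smooth_field U O6 & smooth_field U O7]) /\
    forall q, U q -> level F a q ->
    [/\ forall i, tangent F q (e i q),
        forall i j, pairing (th i q) (e j q) = (i == j)%:R,
        D q = [set v | tangent F q v /\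
                 [/\ pairing (th i1 q) v = 0, pairing (th i2 q) v = 0 &
                     pairing (th i3 q) v = 0]] &
        forall u v, tangent F q u -> tangent F q v ->
          structure_equations th O1 O2 O3 O4 O5 O6 O7 q u v].

(* Gram matrix g(e_i, e_j) of
     g = 2 th^1 th^5 - 2 th^2 th^4 + 4/3 (th^3)^2,
   where th^i th^j = 1/2 (th^i (x) th^j + th^j (x) th^i). *)
Definition gram (R : realType) : 'M[R]_5 :=
  delta_mx i1 i5 + delta_mx i5 i1 - delta_mx i2 i4 - delta_mx i4 i2
  + (4 / 3) *: delta_mx i3 i3.

(* Coefficient of e_k in [e_i, e_j]. *)
Definition bracket_coef (R : realType) (th e : 'I_5 -> 'rV[R]_6 -> 'rV[R]_6)
    (i j k : 'I_5) (q : 'rV[R]_6) : R :=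
  pairing (th k q) (lie_bracket (e i) (e j) q).

(* g([e_i, e_j], e_k). *)
Definition bracket_low (R : realType) (th e : 'I_5 -> 'rV[R]_6 -> 'rV[R]_6)
    (i j k : 'I_5) (q : 'rV[R]_6) : R :=
  \sum_(m < 5) bracket_coef th e i j m q * gram R m k.

(* Coefficient of e_k in nabla_{e_i} e_j for the Levi-Civita connection of g:
   Koszul's formula, whose terms X g(Y, Z) vanish since the g(e_i, e_j) are
   constant. *)
Definition levi_civita (R : realType) (th e : 'I_5 -> 'rV[R]_6 -> 'rV[R]_6)
    (i j k : 'I_5) (q : 'rV[R]_6) : R :=
  2^-1 * \sum_(l < 5)
    (bracket_low th e i j l q - bracket_low th e i l j q
     - bracket_low th e j l i q) * invmx (gram R) l k.

(* Coefficient of e_l in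
   R(e_i, e_j) e_k = nabla_{e_i} nabla_{e_j} e_k - nabla_{e_j} nabla_{e_i} e_k
                     - nabla_{[e_i, e_j]} e_k. *)
Definition curvature (R : realType) (th e : 'I_5 -> 'rV[R]_6 -> 'rV[R]_6)
    (i j k l : 'I_5) (q : 'rV[R]_6) : R :=
  let G := levi_civita th e in
  'D_(e i q) (G j k l) q - 'D_(e j q) (G i k l) q
  + \sum_(m < 5) (G j k m q * G i m l q - G i k m q * G j m l q
                  - bracket_coef th e i j m q * G m k l q).

(* g(R(e_i, e_j) e_k, e_l). *)
Definition riemann (R : realType) (th e : 'I_5 -> 'rV[R]_6 -> 'rV[R]_6)
    (i j k l : 'I_5) (q : 'rV[R]_6) : R :=
  \sum_(m < 5) curvature th e i j k m q * gram R m l.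

Definition ricci (R : realType) (th e : 'I_5 -> 'rV[R]_6 -> 'rV[R]_6)
    (j k : 'I_5) (q : 'rV[R]_6) : R :=
  \sum_(i < 5) curvature th e i j k i q.

Definition scalar_curvature (R : realType)
    (th e : 'I_5 -> 'rV[R]_6 -> 'rV[R]_6) (q : 'rV[R]_6) : R :=
  \sum_(j < 5) \sum_(k < 5) invmx (gram R) j k * ricci th e j k q.

(* Components W(e_i, e_j, e_k, e_l) of the Weyl tensor in dimension n = 5;
   3 = n - 2 and 12 = (n - 1)(n - 2). *)
Definition weyl (R : realType) (th e : 'I_5 -> 'rV[R]_6 -> 'rV[R]_6)
    (i j k l : 'I_5) (q : 'rV[R]_6) : R :=
  let g := gram R in let Ric j k := ricci th e j k q in
  riemann th e i j k l q
  - 3^-1 * (Ric j k * g i l + Ric i l * g j k - Ric i k * g j l - Ric j l * g i k)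
  + scalar_curvature th e q / 12 * (g j k * g i l - g i k * g j l).

(* W on four vectors given by their components in the frame e. *)
Definition weyl_form (R : realType) (th e : 'I_5 -> 'rV[R]_6 -> 'rV[R]_6)
    (q : 'rV[R]_6) (a b c d : 'rV[R]_5) : R :=
  \sum_(i < 5) \sum_(j < 5) \sum_(k < 5) \sum_(l < 5)
    weyl th e i j k l q * a 0 i * b 0 j * c 0 k * d 0 l.

Definition quartic_of_coframe (R : realType)
    (th e : 'I_5 -> 'rV[R]_6 -> 'rV[R]_6) (q v : 'rV[R]_6) : R :=
  let s := pairing (th i4 q) v in let z := pairing (th i5 q) v in
  let a := s *: delta_mx 0 i4 + z *: delta_mx 0 i5 in
  let b := s *: delta_mx 0 i1 + z *: delta_mx 0 i2 in
  weyl_form th e q a b b a.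

(* Q p restricted to D p is the Cartan quartic of D at p: adapted coframes
   exist around p, and Q p is the quartic computed from any of them. *)
Definition is_cartan_quartic (R : realType) (F : 'rV[R]_6 -> R) (a : R)
    (D : 'rV[R]_6 -> set 'rV[R]_6) (Q : 'rV[R]_6 -> 'rV[R]_6 -> R) :=
  forall p, level F a p ->
  (exists U th e, [/\ open U, U p & adapted_coframe F a D U th e]) /\
  (forall U th e, open U -> U p -> adapted_coframe F a D U th e ->
     forall v, D p v -> Q p v = quartic_of_coframe th e p v).

(* Positions of x_i and y_i in (x_1, y_1, x_2, y_2, x_3, y_3); points are
   numbered by 'I_3, and [ordS] is the successor modulo 3. *)
Definition ix (i : 'I_3) : 'I_6 := inord i.*2.
Definition iy (i : 'I_3) : 'I_6 := inord i.*2.+1.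

Definition area (R : realType) (p : 'rV[R]_6) : R :=
  2^-1 * \sum_(i < 3)
    (p 0 (iy i) * p 0 (ix (ordS i)) - p 0 (ix i) * p 0 (iy (ordS i))).

Definition Zfield (R : realType) (i : 'I_3) (p : 'rV[R]_6) : 'rV[R]_6 :=
  (p 0 (ix (ordS i)) - p 0 (ix (ordS (ordS i)))) *: delta_mx 0 (ix i)
  + (p 0 (iy (ordS i)) - p 0 (iy (ordS (ordS i)))) *: delta_mx 0 (iy i).

Definition Ddist (R : realType) (p : 'rV[R]_6) : set 'rV[R]_6 :=
  [set v | exists u : 'I_3 -> R,
     \sum_(i < 3) u i = 0 /\ v = \sum_(i < 3) u i *: Zfield i p].

(* Main.v *)
(** The area preserving affine maps of the plane act simply transitively on M_A
    and preserve the distribution D, so D is spanned by members E_4, E_5 of a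
    frame E_1, ..., E_5 of invariant fields, linear in the coordinates; E_1, E_2,
    E_3 are chosen such that the dual coframe satisfies Cartan's equations with
    constant coefficients.  The quartic of that coframe is read off from the
    structure constants.

    That any other adapted coframe gives the same value at a vector v of D is
    seen as follows.  The vectors s e_4 + z e_5 and s e_1 + z e_2 span a totally
    null plane, so W is the Riemann curvature there, and on totally null planes
    a conformal change multiplies the curvature by the conformal factor.  Cartan's
    equations are covariant under GL_2-valued functions, hence one can assume
    e_4 = E_4 and e_5 = E_5; the equations then determine the coframe up to three
    unipotent parameters, and the metric is that of the reference coframe.  The
    unipotent parameters drop out of the curvature.

    The calculus takes place in the ring of functions on an open subset of M_A
    that extend smoothly to the ambient space, with the five derivations E_i. *)
From HB Require Import structures.
Require Import Defs.
From mathcomp Require Import landau ring lra.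
Import Order.TTheory GRing.Theory Num.Theory.
Import numFieldNormedType.Exports.
Local Open Scope classical_set_scope.
Local Open Scope ring_scope.
Set Implicit Arguments.
Unset Strict Implicit.
Unset Printing Implicit Defensive.

(** * Connections and curvature over a Lie-Rinehart algebra *)

(** The forms and fields of an adapted coframe are constrained only at points of M, so nothing may
    depend on derivatives transverse to M. This forces the use of functions restricted to M. That
    ring has zero divisors and may even be zero, which rules out division: a determinant comes with
    an explicit inverse, and halving is replaced by cancelling x + x = y + y. Where elimination is
    unavoidable, the structure equations are evaluated at a point and become real equations;
    derivatives of unknown coefficients are then just further unknowns, and they have to cancel.

    The invariant fields come from the two commuting actions on a triangle seen as a 3 by 2 matrix q
    of vertices. Affine maps act on the right up to translation, and q -> N q acts on the left.
    Translation invariance means that N kills (1, 1, 1), tangency to M means trace N = 0, and such N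
    form a Lie algebra of dimension 5. Brackets are therefore matrix commutators, and the structure
    constants depend neither on the point nor on the area. *)

Section LieRinehart.

Variables (B : comPzRingType) (n : nat).
Local Notation V := 'rV[B]_n.
Implicit Types (X Y Z a b : V) (k : B).
Variables (act : V -> B -> B) (brk : V -> V -> V).

(** [B] stands for the functions and rows over [B] for the vector fields, written in a fixed global
    frame. *)
Record lie_rinehart := LieRinehart {
  actDr : forall X f g, act X (f + g) = act X f + act X g;
  actM : forall X f g, act X (f * g) = act X f * g + f * act X g;
  actDl : forall X Y f, act (X + Y) f = act X f + act Y f;
  actZl : forall k X f, act (k *: X) f = k * act X f;
  brkDr : forall X Y Z, brk X (Y + Z) = brk X Y + brk X Z;
  brkC : forall X Y, brk X Y = - brk Y X;
  brkZr : forall k X Y, brk X (k *: Y) = k *: brk X Y + act X k *: Y;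
  act_brk : forall X Y f, act (brk X Y) f = act X (act Y f) - act Y (act X f)
}.

Record connection (nab : V -> V -> V) := Connection {
  nabDl : forall X Y Z, nab (X + Y) Z = nab X Z + nab Y Z;
  nabZl : forall k X Z, nab (k *: X) Z = k *: nab X Z;
  nabDr : forall X Y Z, nab X (Y + Z) = nab X Y + nab X Z;
  nabZr : forall k X Y, nab X (k *: Y) = k *: nab X Y + act X k *: Y
}.

Record metric (g : V -> V -> B) := Metric {
  metC : forall X Y, g X Y = g Y X;
  metDl : forall X Y Z, g (X + Y) Z = g X Z + g Y Z;
  metZl : forall k X Y, g (k *: X) Y = k * g X Y
}.

Definition torsion_free nab := forall X Y, nab X Y - nab Y X = brk X Y.

Definition metric_compatible nab (g : V -> V -> B) :=
  forall X Y Z, act X (g Y Z) = g (nab X Y) Z + g Y (nab X Z).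

Definition curv (nab : V -> V -> V) X Y Z :=
  nab X (nab Y Z) - nab Y (nab X Z) - nab (brk X Y) Z.

Section Theory.

Hypothesis LR : lie_rinehart.

Lemma actr0 X : act X 0 = 0.
Proof. by apply: (addrI (act X 0)); rewrite -(actDr LR) !addr0. Qed.

Lemma actr1 X : act X 1 = 0.
Proof.
apply: (addrI (act X 1)); rewrite addr0.
by rewrite -{3}(mulr1 1) (actM LR) mulr1 mul1r.
Qed.

Lemma act_natr X m : act X m%:R = 0.
Proof.
elim: m => [|m IH]; first exact: actr0.
by rewrite -natr1 (actDr LR) IH actr1 addr0.
Qed.

Lemma act_sum (I : Type) (r : seq I) (P : pred I) X (F : I -> B) :
  act X (\sum_(i <- r | P i) F i) = \sum_(i <- r | P i) act X (F i).
Proof.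
by apply: (big_morph (act X)); [exact: (actDr LR)|exact: actr0].
Qed.

Lemma actl_sum (I : Type) (r : seq I) (P : pred I) (F : I -> V) f :
  act (\sum_(i <- r | P i) F i) f = \sum_(i <- r | P i) act (F i) f.
Proof.
apply: (big_morph (fun X => act X f)) => [X Y|]; first exact: (actDl LR).
by have := actZl LR 0 0 f; rewrite scale0r mul0r.
Qed.

Lemma brkDl X Y Z : brk (X + Y) Z = brk X Z + brk Y Z.
Proof. by rewrite (brkC LR) (brkDr LR) opprD -!(brkC LR). Qed.

Lemma brkZl k X Y : brk (k *: X) Y = k *: brk X Y - act Y k *: X.
Proof. by rewrite (brkC LR) (brkZr LR) opprD -scalerN -(brkC LR). Qed.

Lemma brkr0 X : brk X 0 = 0.
Proof. by apply: (addrI (brk X 0)); rewrite -(brkDr LR) !addr0. Qed.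

Lemma brk0l X : brk 0 X = 0.
Proof. by rewrite (brkC LR) brkr0 oppr0. Qed.

Lemma brk_sumr (I : Type) (r : seq I) (P : pred I) X (F : I -> V) :
  brk X (\sum_(i <- r | P i) F i) = \sum_(i <- r | P i) brk X (F i).
Proof. by apply: (big_morph (brk X)); [exact: (brkDr LR)|exact: brkr0]. Qed.

Lemma brk_suml (I : Type) (r : seq I) (P : pred I) (F : I -> V) X :
  brk (\sum_(i <- r | P i) F i) X = \sum_(i <- r | P i) brk (F i) X.
Proof.
by apply: (big_morph (fun Y => brk Y X)) => [Y Z|]; [exact: brkDl|exact: brk0l].
Qed.

Section Connections.

Variables (nab : V -> V -> V) (HN : connection nab).

Lemma nabBl X Y Z : nab (X - Y) Z = nab X Z - nab Y Z.
Proof. by rewrite (nabDl HN) -(scaleN1r Y) (nabZl HN) scaleN1r. Qed.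

Lemma curvDl X X' Y Z : curv nab (X + X') Y Z = curv nab X Y Z + curv nab X' Y Z.
Proof.
rewrite /curv brkDl !(nabDl HN) !(nabDr HN).
by apply/rowP => k; rewrite !mxE; ring.
Qed.

Lemma curvZl k X Y Z : curv nab (k *: X) Y Z = k *: curv nab X Y Z.
Proof.
rewrite /curv brkZl nabBl !(nabZl HN) (nabZr HN).
by apply/rowP => l; rewrite !mxE; ring.
Qed.

Lemma curvC X Y Z : curv nab X Y Z = - curv nab Y X Z.
Proof.
rewrite /curv (brkC LR X) -[- brk Y X]scaleN1r (nabZl HN).
by apply/rowP => l; rewrite !mxE; ring.
Qed.

Lemma curvDm X Y Y' Z : curv nab X (Y + Y') Z = curv nab X Y Z + curv nab X Y' Z.
Proof. by rewrite curvC curvDl opprD -!(curvC X). Qed.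

Lemma curvZm k X Y Z : curv nab X (k *: Y) Z = k *: curv nab X Y Z.
Proof. by rewrite curvC curvZl -scalerN -(curvC X). Qed.

Lemma curvDr X Y Z Z' : curv nab X Y (Z + Z') = curv nab X Y Z + curv nab X Y Z'.
Proof.
rewrite /curv !(nabDr HN).
by apply/rowP => l; rewrite !mxE; ring.
Qed.

Lemma curvZr k X Y Z : curv nab X Y (k *: Z) = k *: curv nab X Y Z.
Proof.
rewrite /curv !(nabZr HN) !(nabDr HN) !(nabZr HN) (act_brk LR).
by apply/rowP => l; rewrite !mxE; ring.
Qed.

Lemma curv_suml (I : Type) (r : seq I) (F : I -> V) Y Z :
  curv nab (\sum_(i <- r) F i) Y Z = \sum_(i <- r) curv nab (F i) Y Z.
Proof.
apply: (big_morph (fun X => curv nab X Y Z)) => [X X'|]; first exact: curvDl.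
by have := curvZl 0 0 Y Z; rewrite !scale0r.
Qed.

Lemma curv_summ (I : Type) (r : seq I) (F : I -> V) X Z :
  curv nab X (\sum_(i <- r) F i) Z = \sum_(i <- r) curv nab X (F i) Z.
Proof.
apply: (big_morph (fun Y => curv nab X Y Z)) => [Y Y'|]; first exact: curvDm.
by have := curvZm 0 X 0 Z; rewrite !scale0r.
Qed.

Lemma curv_sumr (I : Type) (r : seq I) (F : I -> V) X Y :
  curv nab X Y (\sum_(i <- r) F i) = \sum_(i <- r) curv nab X Y (F i).
Proof.
apply: (big_morph (fun Z => curv nab X Y Z)) => [Z Z'|]; first exact: curvDr.
by have := curvZr 0 X Y 0; rewrite !scale0r.
Qed.

End Connections.

Section Conformal.

Hypothesis double_inj : forall x y : B, x + x = y + y -> x = y.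

Section Koszul.

Variables (nab : V -> V -> V) (g : V -> V -> B).
Hypotheses (HN : connection nab) (HG : metric g).
Hypotheses (HT : torsion_free nab) (HM : metric_compatible nab g).

Lemma metBl X Y Z : g (X - Y) Z = g X Z - g Y Z.
Proof. by rewrite (metDl HG) -scaleN1r (metZl HG) mulN1r. Qed.

Lemma met0l X : g 0 X = 0.
Proof. by have := metZl HG 0 0 X; rewrite scale0r mul0r. Qed.

Lemma metNl X Y : g (- X) Y = - g X Y.
Proof. by rewrite -scaleN1r (metZl HG) mulN1r. Qed.

(** Both sides are twice the usual ones: 2 is only assumed to be cancellable, through
    [double_inj]. *)
Lemma koszul X Y Z :
  g (nab X Y) Z + g (nab X Y) Z =
  act X (g Y Z) + act Y (g X Z) - act Z (g X Y)
  + g (brk X Y) Z - g (brk X Z) Y - g (brk Y Z) X.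
Proof.
rewrite -!HT !metBl !HM.
by rewrite !(metC HG Y) !(metC HG X); ring.
Qed.

(** Metric compatibility moves the outer derivative off both second covariant derivatives, and on a
    totally null plane Koszul's formula reduces the resulting products to brackets. Only first
    covariant derivatives remain, so the effect of a conformal change can be computed from that on
    the connection. *)
Lemma null_curvature a b : g a a = 0 -> g a b = 0 -> g b b = 0 ->
  let c := brk a b in
  g (curv nab a b b) a =
  act a (g c b) - act b (g c a) - g (nab b b) (nab a a)
  + g (nab a b) (nab b a) - g (nab c b) a.
Proof.
move=> aa ab bb c.
have E1 : g (nab b b) a = g c b.
  apply: double_inj; rewrite koszul bb (metC HG b a) ab !actr0 // /c.
  by rewrite (brkC LR b a) metNl -(HT b b) subrr met0l; ring.
have E2 : g (nab a b) a = g c a.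
  have: g (nab a a) b + g a (nab a b) = 0 by rewrite -HM ab actr0.
  have E3 : g (nab a a) b = - g c a.
    apply: double_inj; rewrite koszul aa ab !actr0 // /c -(HT a a) subrr.
    by rewrite met0l; ring.
  by rewrite E3 (metC HG a) => /eqP; rewrite addrC subr_eq0 => /eqP.
rewrite /curv !metBl -/c.
have -> : g (nab a (nab b b)) a = act a (g c b) - g (nab b b) (nab a a).
  by rewrite -E1 HM; ring.
have -> : g (nab b (nab a b)) a = act b (g c a) - g (nab a b) (nab b a).
  by rewrite -E2 HM; ring.
ring.
Qed.

End Koszul.

Section Change.

Variables (nab nab' : V -> V -> V) (g g' : V -> V -> B) (f f1 : B).
Hypotheses (HN : connection nab) (HG : metric g).
Hypotheses (HT : torsion_free nab) (HM : metric_compatible nab g).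
Hypotheses (HN' : connection nab') (HG' : metric g').
Hypotheses (HT' : torsion_free nab') (HM' : metric_compatible nab' g').
Hypotheses (Hf : f * f1 = 1) (Hg : forall X Y, g' X Y = f * g X Y).

(** In Koszul's formula for [f * g] the bracket terms merely scale, and the Leibniz rule produces
    the three gradient terms. *)
Lemma conformal_connection X Y Z :
  f * g (nab' X Y) Z + f * g (nab' X Y) Z =
  f * g (nab X Y) Z + f * g (nab X Y) Z
  + act X f * g Y Z + act Y f * g X Z - act Z f * g X Y.
Proof.
have := koszul HG' HT' HM' X Y Z; rewrite !Hg !(actM LR) => ->.
by rewrite -(mulrDr f (g (nab X Y) Z)) (koszul HG HT HM); ring.
Qed.

(* The gradient terms of a conformal change drop out on a totally null plane,
   so no second derivative of the conformal factor is involved. *)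
Lemma conformal_null_curvature a b : g a a = 0 -> g a b = 0 -> g b b = 0 ->
  g' (curv nab' a b b) a = f * g (curv nab a b b) a.
Proof.
move=> aa ab bb; have ba : g b a = 0 by rewrite (metC HG).
rewrite (null_curvature HG' HT' HM') ?Hg ?aa ?ab ?bb ?mulr0 //.
rewrite (null_curvature HG HT HM) //.
set c := brk a b.
have fI x y : f * x = f * y -> x = y.
  by move=> E; rewrite -(mul1r x) -(mul1r y) -Hf mulrAC E; ring.
have Kab Z : f * g (nab' a b) Z + f * g (nab' a b) Z =
    f * g (nab a b) Z + f * g (nab a b) Z + act a f * g b Z + act b f * g a Z.
  by rewrite conformal_connection ab mulr0 subr0.
have Kba Z : f * g (nab' b a) Z + f * g (nab' b a) Z =
    f * g (nab b a) Z + f * g (nab b a) Z + act b f * g a Z + act a f * g b Z.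
  by rewrite conformal_connection ba mulr0 subr0.
have Kaa Z : f * g (nab' a a) Z = f * g (nab a a) Z + act a f * g a Z.
  by apply: double_inj; rewrite conformal_connection aa; ring.
have Kbb Z : f * g (nab' b b) Z = f * g (nab b b) Z + act b f * g b Z.
  by apply: double_inj; rewrite conformal_connection bb; ring.
have n_b : g (nab b b) a = g c b.
  apply: double_inj; rewrite (koszul HG HT HM) bb ba !actr0 // -(HT b b) subrr.
  by rewrite (brkC LR b a) -/c (metNl HG) (met0l HG); ring.
have n_a : g (nab a a) b = - g c a.
  apply: double_inj; rewrite (koszul HG HT HM) aa ab !actr0 // -(HT a a) subrr.
  by rewrite -/c (met0l HG); ring.
have ab_b : g (nab a b) b = 0.
  apply: double_inj; rewrite addr0 -{2}(metC HG b) -HM bb; exact: actr0.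
have ba_a : g (nab b a) a = 0.
  apply: double_inj; rewrite addr0 -{2}(metC HG a) -HM aa; exact: actr0.
have ab_a : g (nab a b) a = g c a.
  have: g (nab a a) b + g a (nab a b) = 0 by rewrite -HM ab actr0.
  by rewrite n_a (metC HG a) addrC => /eqP; rewrite subr_eq0 => /eqP.
have ba_b : g (nab b a) b = - g c b.
  have: g (nab b b) a + g b (nab b a) = 0 by rewrite -HM ba actr0.
  by rewrite n_b (metC HG b) addrC => /eqP; rewrite addr_eq0 => /eqP.
have Ebb : f * g (nab' b b) (nab' a a) =
    f * g (nab b b) (nab a a) + act a f * g c b - act b f * g c a.
  rewrite Kbb (metC HG (nab b b)) Kaa (metC HG a) n_b.
  have -> : g b (nab' a a) = - g c a.
    by rewrite (metC HG); apply: fI; rewrite Kaa ab n_a; ring.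
  by rewrite (metC HG (nab a a)); ring.
have Eab : f * g (nab' a b) (nab' b a) + f * g (nab' a b) (nab' b a) =
    f * g (nab a b) (nab b a) + f * g (nab a b) (nab b a)
    + act b f * g c a - act a f * g c b.
  rewrite Kab; have -> : g b (nab' b a) = - g c b.
    rewrite (metC HG); apply: fI; apply: double_inj.
    by rewrite Kba ab bb ba_b; ring.
  have -> : g a (nab' b a) = 0.
    rewrite (metC HG); apply: fI; apply: double_inj.
    by rewrite Kba aa ba ba_a; ring.
  rewrite (metC HG (nab a b)) Kba (metC HG a) (metC HG b) ab_a ab_b.
  by rewrite (metC HG (nab b a)); ring.
have En : f * g (nab' c b) a + f * g (nab' c b) a =
    f * g (nab c b) a + f * g (nab c b) a + act b f * g c a - act a f * g c b.
  by rewrite conformal_connection ba; ring.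
(* [Eab] and [En] are available in doubled form only, so the goal is doubled before they are
   substituted. *)
apply: double_inj; rewrite !(actM LR).
transitivity ((act a f * g c b + f * act a (g c b)
  - (act b f * g c a + f * act b (g c a)) - f * g (nab' b b) (nab' a a)) *+ 2
  + (f * g (nab' a b) (nab' b a) + f * g (nab' a b) (nab' b a))
  - (f * g (nab' c b) a + f * g (nab' c b) a)); first by ring.
rewrite Ebb Eab En; ring.
Qed.

End Change.
End Conformal.

End Theory.
End LieRinehart.

(** * Levi-Civita connections of frames *)

Lemma sum_deltal (B : pzRingType) (n : nat) (a : 'I_n) (F : 'I_n -> B) :
  \sum_i (i == a)%:R * F i = F a.
Proof.
rewrite (bigD1 a) //= eqxx mul1r big1 ?addr0 // => i /negbTE ->.
by rewrite mul0r.
Qed.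

Section Frames.

Variables (B : comPzRingType) (n : nat).
Local Notation V := 'rV[B]_n.
Implicit Types (X Y Z W : V).
Variables (act : V -> B -> B) (brk : V -> V -> V).
Hypothesis LR : lie_rinehart act brk.

Record coframe (e : 'I_n -> V) (th : 'I_n -> V -> B) := Coframe {
  cofD : forall i X Y, th i (X + Y) = th i X + th i Y;
  cofZ : forall i (k : B) X, th i (k *: X) = k * th i X;
  cofE : forall i j, th i (e j) = (i == j)%:R;
  cof_dec : forall X, X = \sum_i th i X *: e i
}.

Variables (e : 'I_n -> V) (th : 'I_n -> V -> B) (gm gmi : 'M[B]_n) (h : B).
Hypothesis HC : coframe e th.
Hypothesis gmC : forall i j, gm i j = gm j i.
Hypothesis gmK : gm *m gmi = 1%:M.
Hypothesis act_gm : forall X i j, act X (gm i j) = 0.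
Hypothesis hK : h * 2 = 1.

Definition fcoef i j k := th k (brk (e i) (e j)).
Definition flow i j k := \sum_m fcoef i j m * gm m k.
(** Koszul's formula for a frame with constant Gram matrix, arranged as in [levi_civita], with [h]
    for one half. *)
Definition fchris i j k :=
  h * \sum_l (flow i j l - flow i l j - flow j l i) * gmi l k.
Definition fcurv i j k l :=
  act (e i) (fchris j k l) - act (e j) (fchris i k l)
  + \sum_m (fchris j k m * fchris i m l - fchris i k m * fchris j m l
            - fcoef i j m * fchris m k l).
Definition friem i j k l := \sum_m fcurv i j k m * gm m l.

Definition fmet X Y := \sum_i \sum_j gm i j * (th i X * th j Y).
Definition fnab X Y : V :=
  \sum_k (act X (th k Y) + \sum_i \sum_j th i X * th j Y * fchris i j k) *: e k.

Lemma cof0 i : th i 0 = 0.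
Proof. by have := cofZ HC i 0 0; rewrite scale0r mul0r. Qed.

Lemma cofB i X Y : th i (X - Y) = th i X - th i Y.
Proof. by rewrite (cofD HC) -scaleN1r (cofZ HC) mulN1r. Qed.

Lemma cof_sum (I : Type) (r : seq I) i (F : I -> V) :
  th i (\sum_(a <- r) F a) = \sum_(a <- r) th i (F a).
Proof. by apply: (big_morph (th i)); [exact: (cofD HC)|exact: cof0]. Qed.

Lemma cof_comb i (c : 'I_n -> B) : th i (\sum_a c a *: e a) = c i.
Proof.
rewrite cof_sum (eq_bigr (fun a => (a == i)%:R * c a)) ?sum_deltal //.
by move=> a _; rewrite (cofZ HC) (cofE HC) eq_sym mulrC.
Qed.

Lemma cof_inj X Y : (forall i, th i X = th i Y) -> X = Y.
Proof.
move=> E; rewrite (cof_dec HC X) (cof_dec HC Y).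
by apply: eq_bigr => i _; rewrite E.
Qed.

Lemma cof_brk k X Y : th k (brk X Y) =
  act X (th k Y) - act Y (th k X)
  + \sum_i \sum_j th i X * th j Y * fcoef i j k.
Proof.
rewrite {1}(cof_dec HC X) {1}(cof_dec HC Y) (brk_suml LR) cof_sum.
under eq_bigr => i _ do rewrite (brk_sumr LR) cof_sum.
under eq_bigr => i _ do under eq_bigr => j _ do
  rewrite (brkZr LR) (cofD HC) !(cofZ HC) (brkZl LR) cofB !(cofZ HC) !(cofE HC)
    (actZl LR) mulrBr.
have -> : act X (th k Y) =
   \sum_i \sum_j th i X * act (e i) (th j Y) * (k == j)%:R.
  rewrite {1}(cof_dec HC X) (actl_sum LR); apply: eq_bigr => i _.
  rewrite (actZl LR) (eq_bigr (fun j => (j == k)%:R * (th i X * act (e i) (th j Y)))).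
    by rewrite sum_deltal.
  by move=> j _; rewrite eq_sym mulrC.
have -> : act Y (th k X) =
   \sum_i \sum_j th j Y * (act (e j) (th i X) * (k == i)%:R).
  rewrite exchange_big {1}(cof_dec HC Y) (actl_sum LR); apply: eq_bigr => j _.
  rewrite (actZl LR) (eq_bigr (fun i => (i == k)%:R * (th j Y * act (e j) (th i X)))).
    by rewrite sum_deltal.
  by move=> i _ /=; rewrite eq_sym; ring.
rewrite -sumrB -big_split; apply: eq_bigr => i _ /=.
rewrite -sumrB -big_split; apply: eq_bigr => j _ /=.
by rewrite /fcoef; ring.
Qed.

Lemma cof_fnab k X Y : th k (fnab X Y) =
  act X (th k Y) + \sum_i \sum_j th i X * th j Y * fchris i j k.
Proof. exact: cof_comb. Qed.

Lemma fcoefC i j k : fcoef i j k = - fcoef j i k.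
Proof. by rewrite /fcoef (brkC LR) -scaleN1r (cofZ HC) mulN1r. Qed.

Lemma flowC i j k : flow i j k = - flow j i k.
Proof.
by rewrite /flow -sumrN; apply: eq_bigr => m _; rewrite fcoefC mulNr.
Qed.

(** The last two terms of Koszul's formula have a sum symmetric in i and j, so only the bracket term
    survives, twice. *)
Lemma fchris_torsion i j k : fchris i j k - fchris j i k = fcoef i j k.
Proof.
rewrite /fchris -mulrBr -sumrB.
transitivity (\sum_l flow i j l * gmi l k).
  rewrite [RHS](eq_bigr (fun l => h * (2 * (flow i j l * gmi l k)))); last first.
    by move=> l _; rewrite mulrA hK mul1r.
  rewrite -mulr_sumr; congr (_ * _); apply: eq_bigr => l _.
  by rewrite (flowC j i); ring.
rewrite /flow; under eq_bigr => l _ do rewrite mulr_suml.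
rewrite exchange_big /=.
transitivity (\sum_m fcoef i j m * (gm *m gmi) m k).
  apply: eq_bigr => m _; rewrite mxE mulr_sumr; apply: eq_bigr => l _; ring.
rewrite gmK -[RHS](sum_deltal k (fun m => fcoef i j m)).
by apply: eq_bigr => m _; rewrite mxE mulrC.
Qed.

Lemma fchris_low i j k : \sum_m fchris i j m * gm m k =
  h * (flow i j k - flow i k j - flow j k i).
Proof.
have gmiK : gmi *m gm = 1%:M by exact: mulmx1C.
rewrite /fchris; under eq_bigr => m _ do rewrite -mulrA mulr_suml.
rewrite -mulr_sumr exchange_big /=; congr (_ * _).
transitivity (\sum_l (flow i j l - flow i l j - flow j l i) * (gmi *m gm) l k).
  apply: eq_bigr => l _; rewrite mxE mulr_sumr.
  by apply: eq_bigr => m _; rewrite mulrA.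
rewrite gmiK -[RHS](sum_deltal k (fun l => flow i j l - flow i l j - flow j l i)).
by apply: eq_bigr => m _; rewrite mxE mulrC.
Qed.

Lemma fchris_skew i j k :
  \sum_m fchris i j m * gm m k + \sum_m fchris i k m * gm m j = 0.
Proof. by rewrite !fchris_low (flowC k j); ring. Qed.

Lemma fmet_metric : metric fmet.
Proof.
split=> [X Y|X Y Z|k X Y]; rewrite /fmet.
- rewrite exchange_big; apply: eq_bigr => i _; apply: eq_bigr => j _ /=.
  by rewrite gmC; ring.
- rewrite -big_split; apply: eq_bigr => i _ /=; rewrite -big_split.
  by apply: eq_bigr => j _ /=; rewrite (cofD HC); ring.
- rewrite mulr_sumr; apply: eq_bigr => i _; rewrite mulr_sumr.
  by apply: eq_bigr => j _; rewrite (cofZ HC); ring.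
Qed.

Lemma fnab_connection : connection act fnab.
Proof.
split=> [X Y Z|k X Z|X Y Z|k X Y]; apply: cof_inj => l;
  rewrite ?(cofD HC) ?(cofZ HC) !cof_fnab ?(cofD HC) ?(cofZ HC).
- rewrite (actDl LR) [RHS]addrACA; congr (_ + _); rewrite -big_split.
  apply: eq_bigr => i _ /=; rewrite -big_split.
  by apply: eq_bigr => j _ /=; rewrite (cofD HC); ring.
- rewrite (actZl LR) mulrDr; congr (_ + _); rewrite mulr_sumr.
  apply: eq_bigr => i _; rewrite mulr_sumr.
  by apply: eq_bigr => j _; rewrite (cofZ HC); ring.
- rewrite (actDr LR) [RHS]addrACA; congr (_ + _); rewrite -big_split.
  apply: eq_bigr => i _ /=; rewrite -big_split.
  by apply: eq_bigr => j _ /=; rewrite (cofD HC); ring.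
- have -> : \sum_i \sum_j th i X * th j (k *: Y) * fchris i j l =
      k * \sum_i \sum_j th i X * th j Y * fchris i j l.
    rewrite mulr_sumr; apply: eq_bigr => i _; rewrite mulr_sumr.
    by apply: eq_bigr => j _; rewrite (cofZ HC); ring.
  by rewrite (actM LR); ring.
Qed.

Lemma fnab_torsion_free : torsion_free brk fnab.
Proof.
move=> X Y; apply: cof_inj => k; rewrite cofB !cof_fnab cof_brk.
rewrite [X in _ - (_ + X)]exchange_big /= opprD addrACA; congr (_ + _).
rewrite -sumrB; apply: eq_bigr => i _; rewrite -sumrB.
by apply: eq_bigr => j _; rewrite -fchris_torsion; ring.
Qed.

(** Once the derivatives of the components are matched by the Leibniz rule, a trilinear expression
    is left whose coefficients are the sums in [fchris_skew]. *)
Lemma fnab_metric_compatible : metric_compatible act fnab fmet.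
Proof.
move=> X Y Z; rewrite /fmet (act_sum LR).
under eq_bigr => i _ do rewrite (act_sum LR).
under eq_bigr => i _ do under eq_bigr => j _ do
  rewrite (actM LR) act_gm mul0r add0r (actM LR).
under [X in _ = X + _]eq_bigr => i _ do under eq_bigr => j _ do rewrite cof_fnab.
under [X in _ = _ + X]eq_bigr => i _ do under eq_bigr => j _ do rewrite cof_fnab.
set S1 := fun i => \sum_a \sum_b th a X * th b Y * fchris a b i.
set S2 := fun j => \sum_a \sum_b th a X * th b Z * fchris a b j.
suff E : \sum_i \sum_j gm i j * (S1 i * th j Z)
       + \sum_i \sum_j gm i j * (th i Y * S2 j) = 0.
  move/(congr1 (fun z => \sum_i \sum_j
      gm i j * (act X (th i Y) * th j Z + th i Y * act X (th j Z)) + z)): E.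
  rewrite addr0 => <-; rewrite -!big_split /=; apply: eq_bigr => i _.
  by rewrite -!big_split /=; apply: eq_bigr => j _; rewrite /S1 /S2; ring.
transitivity (\sum_a \sum_b \sum_c th a X * th b Y * th c Z *
   (\sum_m fchris a b m * gm m c + \sum_m fchris a c m * gm m b)); last first.
  rewrite big1 // => a _; rewrite big1 // => b _; rewrite big1 // => c _.
  by rewrite fchris_skew mulr0.
have -> : \sum_i \sum_j gm i j * (S1 i * th j Z) =
    \sum_a \sum_b \sum_c th a X * th b Y * th c Z * \sum_m fchris a b m * gm m c.
  rewrite exchange_big /=; under eq_bigr => c _.
    under eq_bigr => m _.
      rewrite /S1 mulrCA mulr_suml; under eq_bigr => a _ do rewrite mulr_suml.
      over.
    rewrite exchange_big /=; under eq_bigr => a _ do rewrite exchange_big /=.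
    over.
  rewrite exchange_big /=; apply: eq_bigr => a _.
  rewrite exchange_big /=; apply: eq_bigr => b _; apply: eq_bigr => c _.
  by rewrite mulr_sumr; apply: eq_bigr => m _; ring.
have -> : \sum_i \sum_j gm i j * (th i Y * S2 j) =
    \sum_a \sum_b \sum_c th a X * th b Y * th c Z * \sum_m fchris a c m * gm m b.
  under eq_bigr => b _.
    under eq_bigr => m _.
      rewrite mulrA /S2 mulr_sumr; under eq_bigr => a _ do rewrite mulr_sumr.
      over.
    rewrite exchange_big /=; under eq_bigr => a _ do rewrite exchange_big /=.
    over.
  rewrite exchange_big /=; apply: eq_bigr => a _.
  apply: eq_bigr => b _; apply: eq_bigr => c _.
  by rewrite mulr_sumr; apply: eq_bigr => m _; rewrite (gmC m b); ring.
rewrite -big_split; apply: eq_bigr => a _ /=; rewrite -big_split.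
apply: eq_bigr => b _ /=; rewrite -big_split; apply: eq_bigr => c _ /=.
by rewrite mulrDr.
Qed.

Lemma cof_fnab_frame i j k : th k (fnab (e i) (e j)) = fchris i j k.
Proof.
rewrite cof_fnab (cofE HC) (act_natr LR) add0r.
under eq_bigr => a _ do under eq_bigr => b _ do
  rewrite !(cofE HC) -mulrA.
under eq_bigr => a _ do rewrite -mulr_sumr sum_deltal.
by rewrite sum_deltal.
Qed.

Lemma cof_curv_frame i j k l :
  th l (curv brk fnab (e i) (e j) (e k)) = fcurv i j k l.
Proof.
have T i' j' : th l (fnab (e i') (fnab (e j') (e k))) =
    act (e i') (fchris j' k l) + \sum_m fchris j' k m * fchris i' m l.
  rewrite cof_fnab cof_fnab_frame; congr (_ + _).
  under eq_bigr => a _ do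
    under eq_bigr => b _ do rewrite (cofE HC) cof_fnab_frame -mulrA.
  by under eq_bigr => a _ do rewrite -mulr_sumr; rewrite sum_deltal.
rewrite /curv !cofB !T cof_fnab (cofE HC) (act_natr LR) add0r.
have -> : \sum_a \sum_b th a (brk (e i) (e j)) * th b (e k) * fchris a b l =
    \sum_m fcoef i j m * fchris m k l.
  apply: eq_bigr => a _.
  under eq_bigr => b _ do rewrite (cofE HC) -mulrA mulrCA.
  by rewrite sum_deltal.
rewrite /fcurv !sumrB; ring.
Qed.

(** The curvature is tensorial: no derivative of the components of the arguments occurs, so its
    values on the frame determine it. *)
Lemma fmet_curv X Y Z W : fmet (curv brk fnab X Y Z) W =
  \sum_i \sum_j \sum_k \sum_l
    friem i j k l * th i X * th j Y * th k Z * th l W.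
Proof.
have HN := fnab_connection.
have HK m : th m (curv brk fnab X Y Z) =
    \sum_i \sum_j \sum_k th i X * th j Y * th k Z * fcurv i j k m.
  rewrite {1}(cof_dec HC X) (curv_suml LR HN) cof_sum; apply: eq_bigr => i _.
  rewrite (curvZl LR HN) (cofZ HC) {1}(cof_dec HC Y) (curv_summ LR HN) cof_sum.
  rewrite mulr_sumr; apply: eq_bigr => j _.
  rewrite (curvZm LR HN) (cofZ HC) {1}(cof_dec HC Z) (curv_sumr LR HN) cof_sum.
  rewrite !mulr_sumr; apply: eq_bigr => k _.
  by rewrite (curvZr LR HN) (cofZ HC) cof_curv_frame; ring.
rewrite /fmet exchange_big /=.
under eq_bigr => l _.
  under eq_bigr => m _.
    rewrite HK mulrCA mulr_suml; under eq_bigr => i _.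
      rewrite mulr_suml; under eq_bigr => j _ do rewrite mulr_suml.
      over.
    over.
  rewrite exchange_big /=; under eq_bigr => i _.
    rewrite exchange_big /=; under eq_bigr => j _ do rewrite exchange_big /=.
    over.
  over.
rewrite exchange_big /=; apply: eq_bigr => i _.
rewrite exchange_big /=; apply: eq_bigr => j _.
rewrite exchange_big /=; apply: eq_bigr => k _.
apply: eq_bigr => l _; rewrite /friem !mulr_suml; apply: eq_bigr => m _.
ring.
Qed.

End Frames.

(** * Rings with derivations *)

Section Derivations.

Variables (B : comPzRingType) (n : nat).
Local Notation V := 'rV[B]_n.
Implicit Types (X Y Z W : V).
Variables (D : 'I_n -> B -> B) (c : 'I_n -> 'I_n -> 'I_n -> B).

(** A frame of vector fields, given by its derivations [D i] and its structure functions [c]. *)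
Record derivations := Derivations {
  derD : forall i f g, D i (f + g) = D i f + D i g;
  derM : forall i f g, D i (f * g) = D i f * g + f * D i g;
  der_comm : forall i j f, D i (D j f) - D j (D i f) = \sum_k c i j k * D k f;
  strC : forall i j k, c i j k = - c j i k
}.

Definition dact X f := \sum_j X 0 j * D j f.
Definition dbrk X Y : V := \row_k
  (dact X (Y 0 k) - dact Y (X 0 k) + \sum_i \sum_j X 0 i * Y 0 j * c i j k).

Hypothesis HD : derivations.

Lemma der0 i : D i 0 = 0.
Proof. by apply: (addrI (D i 0)); rewrite -(derD HD) !addr0. Qed.

Lemma der_sum (I : Type) (r : seq I) i (F : I -> B) :
  D i (\sum_(a <- r) F a) = \sum_(a <- r) D i (F a).
Proof. by apply: (big_morph (D i)); [exact: (derD HD)|exact: der0]. Qed.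

Lemma dactDr X f g : dact X (f + g) = dact X f + dact X g.
Proof.
by rewrite /dact -big_split; apply: eq_bigr => j _; rewrite /= (derD HD) mulrDr.
Qed.

Lemma dactM X f g : dact X (f * g) = dact X f * g + f * dact X g.
Proof.
rewrite /dact mulr_suml mulr_sumr -big_split; apply: eq_bigr => j _ /=.
by rewrite (derM HD); ring.
Qed.

Lemma dactDl X Y f : dact (X + Y) f = dact X f + dact Y f.
Proof.
by rewrite /dact -big_split; apply: eq_bigr => j _; rewrite /= !mxE mulrDl.
Qed.

Lemma dactZl k X f : dact (k *: X) f = k * dact X f.
Proof.
by rewrite /dact mulr_sumr; apply: eq_bigr => j _; rewrite /= !mxE mulrA.
Qed.

Lemma dact_comp X Y f : dact X (dact Y f) =
  \sum_k dact X (Y 0 k) * D k f + \sum_i \sum_j X 0 i * Y 0 j * D i (D j f).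
Proof.
rewrite {1}/dact.
under eq_bigr => i _ do rewrite /dact der_sum mulr_sumr.
under eq_bigr => i _ do under eq_bigr => j _ do rewrite (derM HD) mulrDr.
under eq_bigr => i _ do rewrite big_split /=.
rewrite big_split /=; congr (_ + _).
  rewrite exchange_big; apply: eq_bigr => k _ /=; rewrite mulr_suml.
  by apply: eq_bigr => j _; rewrite mulrA.
by apply: eq_bigr => i _; apply: eq_bigr => j _; rewrite mulrA.
Qed.

Lemma derivations_lie_rinehart : lie_rinehart dact dbrk.
Proof.
split.
- exact: dactDr.
- exact: dactM.
- exact: dactDl.
- exact: dactZl.
- move=> X Y Z; apply/rowP => k; rewrite !mxE dactDr dactDl.
  have -> : \sum_i \sum_j X 0 i * (Y + Z) 0 j * c i j k =
      \sum_i \sum_j X 0 i * Y 0 j * c i j k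
      + \sum_i \sum_j X 0 i * Z 0 j * c i j k.
    rewrite -big_split; apply: eq_bigr => i _ /=; rewrite -big_split.
    by apply: eq_bigr => j _ /=; rewrite mxE; ring.
  by ring.
- move=> X Y; apply/rowP => k; rewrite !mxE.
  have -> : \sum_i \sum_j X 0 i * Y 0 j * c i j k =
      - \sum_i \sum_j Y 0 i * X 0 j * c i j k.
    rewrite exchange_big -sumrN; apply: eq_bigr => i _ /=; rewrite -sumrN.
    by apply: eq_bigr => j _ /=; rewrite (strC HD); ring.
  by ring.
- move=> f X Y; apply/rowP => k; rewrite !mxE dactM dactZl.
  have -> : \sum_i \sum_j X 0 i * (f *: Y) 0 j * c i j k =
      f * \sum_i \sum_j X 0 i * Y 0 j * c i j k.
    rewrite mulr_sumr; apply: eq_bigr => i _ /=; rewrite mulr_sumr.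
    by apply: eq_bigr => j _ /=; rewrite mxE; ring.
  by ring.
- move=> X Y f; rewrite !dact_comp [X in _ = _ - (_ + X)]exchange_big /=.
  rewrite [LHS]/dact; under [LHS]eq_bigr => k _ do rewrite /dbrk mxE !mulrDl mulNr.
  rewrite big_split sumrB /= opprD addrACA; congr (_ + _).
  rewrite -sumrB; under eq_bigr => k _ do rewrite mulr_suml.
  rewrite exchange_big /=; apply: eq_bigr => i _.
  under eq_bigr => k _ do rewrite mulr_suml.
  rewrite exchange_big /= -sumrB; apply: eq_bigr => j _.
  transitivity (X 0 i * Y 0 j * (D i (D j f) - D j (D i f))); last by ring.
  rewrite (der_comm HD) mulr_sumr; apply: eq_bigr => k _; ring.
Qed.

Lemma std_coframe :
  coframe (fun j => delta_mx 0 j : V) (fun i (X : V) => X 0 i).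
Proof.
split=> [i X Y|i k X|i j|X]; rewrite ?mxE //.
by rewrite [LHS]row_sum_delta.
Qed.

Lemma dact_delta i f : dact (delta_mx 0 i) f = D i f.
Proof.
rewrite /dact -[RHS](sum_deltal i (fun j => D j f)).
by apply: eq_bigr => j _; rewrite mxE eqxx.
Qed.

Lemma der1 i : D i 1 = 0.
Proof.
by rewrite -dact_delta; exact: (actr1 derivations_lie_rinehart).
Qed.

Lemma std_fcoef i j k :
  fcoef dbrk (fun j => delta_mx 0 j : V) (fun i (X : V) => X 0 i) i j k = c i j k.
Proof.
rewrite /fcoef mxE !mxE !(act_natr derivations_lie_rinehart) subrr add0r.
under eq_bigr => a _ do under eq_bigr => b _ do rewrite !mxE !eqxx /= -mulrA.
by under eq_bigr => a _ do rewrite -mulr_sumr sum_deltal; rewrite sum_deltal.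
Qed.

Section MatrixFrame.

Variables (P T : 'M[B]_n).
Hypothesis PT : P *m T = 1%:M.

(** The rows of [P] are the frame fields; the columns of its inverse [T] are the dual forms. *)
Definition mframe i : V := row i P.
Definition mcof k (X : V) := (X *m T) 0 k.

Lemma mx_coframe : coframe mframe mcof.
Proof.
split=> [i X Y|i k X|i j|X]; rewrite /mcof.
- by rewrite mulmxDl mxE.
- by rewrite -scalemxAl mxE.
- by rewrite /mframe -row_mul PT !mxE eq_sym.
- have TP : T *m P = 1%:M by exact: mulmx1C.
  rewrite -{1}(mulmx1 X) -TP mulmxA; apply/rowP => j; rewrite !mxE summxE.
  by apply: eq_bigr => i _; rewrite !mxE.
Qed.

End MatrixFrame.

(** The exterior derivative of the 1-form with components [al], evaluated on the i-th and j-th frame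
    fields. *)
Definition ext (al : 'I_n -> B) i j :=
  D i (al j) - D j (al i) - \sum_m c i j m * al m.

Lemma extD al be i j :
  ext (fun m => al m + be m) i j = ext al i j + ext be i j.
Proof.
rewrite /ext !(derD HD).
under eq_bigr => m _ do rewrite mulrDr.
by rewrite big_split /=; ring.
Qed.

Lemma extM f al i j : ext (fun m => f * al m) i j =
  D i f * al j - D j f * al i + f * ext al i j.
Proof.
rewrite /ext !(derM HD).
under eq_bigr => m _ do rewrite mulrCA.
by rewrite -mulr_sumr; ring.
Qed.

End Derivations.

(** * Cartan's structure equations *)

Section Gauge.

Variables (B : comPzRingType) (n : nat).
Variables (D : 'I_n -> B -> B) (c : 'I_n -> 'I_n -> 'I_n -> B).
Hypothesis HD : derivations D c.
Implicit Types (al be t : 'I_n -> B).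

Definition wdg al be i j := al i * be j - al j * be i.

Definition cartan_equations (q : B) (t1 t2 t3 t4 t5 O1 O2 O3 O4 O5 O6 O7 : 'I_n -> B) :=
  forall i j,
  [/\ ext D c t1 i j =
        wdg t1 (fun m => 2 * O1 m + O4 m) i j + wdg t2 O2 i j + wdg t3 t4 i j,
      ext D c t2 i j =
        wdg t1 O3 i j + wdg t2 (fun m => O1 m + 2 * O4 m) i j + wdg t3 t5 i j,
      ext D c t3 i j =
        wdg t1 O5 i j + wdg t2 O6 i j + wdg t3 (fun m => O1 m + O4 m) i j
        + wdg t4 t5 i j,
      ext D c t4 i j =
        wdg t1 O7 i j + q * wdg t3 O6 i j + wdg t4 O1 i j + wdg t5 O2 i j &
      ext D c t5 i j =
        wdg t2 O7 i j - q * wdg t3 O5 i j + wdg t4 O3 i j + wdg t5 O4 i j].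

(** If (t4, t5) is transformed by a matrix g, then t4 ^ t5 scales by det g, so t3 must carry that
    factor; the products t3 ^ t4 and t3 ^ t5 then force det g times g on (t1, t2). *)
Lemma cartan_gauge (q a b d e s : B) (t1 t2 t3 t4 t5 O1 O2 O3 O4 O5 O6 O7 : 'I_n -> B) :
  s * (a * e - b * d) = 1 ->
  cartan_equations q t1 t2 t3 t4 t5 O1 O2 O3 O4 O5 O6 O7 ->
  let r := a * e - b * d in
  exists P1 P2 P3 P4 P5 P6 P7 : 'I_n -> B,
  cartan_equations q
    (fun m => r * (a * t1 m + b * t2 m)) (fun m => r * (d * t1 m + e * t2 m))
    (fun m => r * t3 m)
    (fun m => a * t4 m + b * t5 m) (fun m => d * t4 m + e * t5 m)
    P1 P2 P3 P4 P5 P6 P7.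
Proof.
move=> sK HS r.
(* With g = ((a, b), (d, e)) and Omega = ((O1, O2), (O3, O4)), the [f] are the entries of g Omega -
   dg. The new forms are (g Omega - dg) g^-1, (O5, O6) g^-1 and O7 / det g, where [s] is the inverse
   determinant. *)
pose f1 m := a * O1 m + b * O3 m - D m a.
pose f2 m := a * O2 m + b * O4 m - D m b.
pose f3 m := d * O1 m + e * O3 m - D m d.
pose f4 m := d * O2 m + e * O4 m - D m e.
exists (fun m => s * (e * f1 m - d * f2 m)), (fun m => s * (a * f2 m - b * f1 m)),
       (fun m => s * (e * f3 m - d * f4 m)), (fun m => s * (a * f4 m - b * f3 m)),
       (fun m => s * (e * O5 m - d * O6 m)), (fun m => s * (a * O6 m - b * O5 m)),
       (fun m => s * O7 m).
move=> i j; have [E1 E2 E3 E4 E5] := HS i j.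
have Dr m : D m r = D m a * e + a * D m e - (D m b * d + b * D m d).
  rewrite /r (derD HD) (derM HD); congr (_ + _).
  have : D m (b * d) + D m (- (b * d)) = 0 by rewrite -(derD HD) subrr (der0 HD).
  by rewrite (derM HD) => /eqP; rewrite addrC addr_eq0 => /eqP.
(* Every term of the right-hand sides carries the factor [s * r = 1], except
   for the last one of the first three equations. *)
have sP u v w : u = s * (a * e - b * d) * v + w -> u = v + w.
  by rewrite sK mul1r.
have sP0 u v : u = s * (a * e - b * d) * v -> u = v by rewrite sK mul1r.
split; apply/esym.
- rewrite (extM HD) (extD HD (fun m => a * t1 m)) !(extM HD) E1 E2 !Dr.
  transitivity (
    (D i a * e + a * D i e - (D i b * d + b * D i d)) * (a * t1 j + b * t2 j) -
    (D j a * e + a * D j e - (D j b * d + b * D j d)) * (a * t1 i + b * t2 i) +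
    r * (D i a * t1 j - D j a * t1 i + (D i b * t2 j - D j b * t2 i)
     + a * (wdg t1 (fun m => 2 * O1 m + O4 m) i j + wdg t2 O2 i j)
     + b * (wdg t1 O3 i j + wdg t2 (fun m => O1 m + 2 * O4 m) i j))
    + r * (a * wdg t3 t4 i j + b * wdg t3 t5 i j)).
    by apply: sP; rewrite /wdg /f1 /f2 /f3 /f4 /r; ring.
  by rewrite /wdg; ring.
- rewrite (extM HD) (extD HD (fun m => d * t1 m)) !(extM HD) E1 E2 !Dr.
  transitivity (
    (D i a * e + a * D i e - (D i b * d + b * D i d)) * (d * t1 j + e * t2 j) -
    (D j a * e + a * D j e - (D j b * d + b * D j d)) * (d * t1 i + e * t2 i) +
    r * (D i d * t1 j - D j d * t1 i + (D i e * t2 j - D j e * t2 i)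
     + d * (wdg t1 (fun m => 2 * O1 m + O4 m) i j + wdg t2 O2 i j)
     + e * (wdg t1 O3 i j + wdg t2 (fun m => O1 m + 2 * O4 m) i j))
    + r * (d * wdg t3 t4 i j + e * wdg t3 t5 i j)).
    by apply: sP; rewrite /wdg /f1 /f2 /f3 /f4 /r; ring.
  by rewrite /wdg; ring.
- rewrite (extM HD) E3 !Dr.
  transitivity (
    (D i a * e + a * D i e - (D i b * d + b * D i d)) * t3 j -
    (D j a * e + a * D j e - (D j b * d + b * D j d)) * t3 i +
    r * (wdg t1 O5 i j + wdg t2 O6 i j + wdg t3 (fun m => O1 m + O4 m) i j)
    + r * wdg t4 t5 i j).
    by apply: sP; rewrite /wdg /f1 /f2 /f3 /f4 /r; ring.
  by rewrite /wdg; ring.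
- rewrite (extD HD (fun m => a * t4 m)) !(extM HD) E4 E5.
  by apply: sP0; rewrite /wdg /f1 /f2 /f3 /f4 /r; ring.
- rewrite (extD HD (fun m => d * t4 m)) !(extM HD) E4 E5.
  by apply: sP0; rewrite /wdg /f1 /f2 /f3 /f4 /r; ring.
Qed.

End Gauge.

(** * The invariant frame *)

Lemma ord5P (P : 'I_5 -> Prop) :
  P i1 -> P i2 -> P i3 -> P i4 -> P i5 -> forall i, P i.
Proof.
move=> H1 H2 H3 H4 H5 [[|[|[|[|[|m]]]]] Hi] //.
- by rewrite (_ : Ordinal Hi = i1) //; apply: val_inj.
- by rewrite (_ : Ordinal Hi = i2) //; apply: val_inj.
- by rewrite (_ : Ordinal Hi = i3) //; apply: val_inj.
- by rewrite (_ : Ordinal Hi = i4) //; apply: val_inj.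
- by rewrite (_ : Ordinal Hi = i5) //; apply: val_inj.
Qed.

Lemma sum5 (B : nmodType) (F : 'I_5 -> B) :
  \sum_i F i = F i1 + F i2 + F i3 + F i4 + F i5.
Proof.
rewrite !big_ord_recl big_ord0 addr0 !addrA.
by do ![congr (_ + _)]; congr F; apply: val_inj.
Qed.

(* Structure constants [E_i, E_j] = \sum_k str i j k E_k of the invariant
   adapted frame. *)
Definition str (R : realType) (i j k : 'I_5) : R :=
  nth 0 (nth [::] (nth [::] [::
  [:: [:: 0; 0; 0; 0; 0];
      [:: 0; 0; - (243 / 25); 0; 0];
      [:: 0; 1 / 5; 0; - (567 / 25); 0];
      [:: 1; 0; - (9 / 5); 0; 9 / 5];
      [:: 0; - 1; 0; 27 / 5; 0]];
  [:: [:: 0; 0; 243 / 25; 0; 0];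
      [:: 0; 0; 0; 0; 0];
      [:: - (3 / 5); 0; 0; 0; - (567 / 25)];
      [:: 0; - 1; 0; 27 / 5; 0];
      [:: - 3; 0; - (27 / 5); 0; - (27 / 5)]];
  [:: [:: 0; - (1 / 5); 0; 567 / 25; 0];
      [:: 3 / 5; 0; 0; 0; 567 / 25];
      [:: 0; 0; 0; 0; 0];
      [:: - 1; 0; 0; 0; 11 / 5];
      [:: 0; - 1; 0; - (33 / 5); 0]];
  [:: [:: - 1; 0; 9 / 5; 0; - (9 / 5)];
      [:: 0; 1; 0; - (27 / 5); 0];
      [:: 1; 0; 0; 0; - (11 / 5)];
      [:: 0; 0; 0; 0; 0];
      [:: 0; 0; - 1; 0; 0]];
  [:: [:: 0; 1; 0; - (27 / 5); 0];
      [:: 3; 0; 27 / 5; 0; 27 / 5];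
      [:: 0; 1; 0; 33 / 5; 0];
      [:: 0; 0; 1; 0; 0];
      [:: 0; 0; 0; 0; 0]]] i) j) k.

Lemma str_skew (R : realType) i j k : str R i j k = - str R j i k.
Proof.
by move: i j k; do 3 apply: ord5P; rewrite /str /= ?oppr0 ?opprK.
Qed.

(** * Adapted coframes with e_4 = E_4 and e_5 = E_5 *)

Section Nilpotent.

Variables (R : realType) (B : comPzRingType) (kR : {rmorphism R -> B}).
Variables (D : 'I_5 -> B -> B).
Hypothesis HD : derivations D (fun i j k => kR (str R i j k)).
Hypothesis DkR : forall i r, D i (kR r) = 0.
Variables (I : Type) (ev : I -> {rmorphism B -> R}).
Hypothesis evK : forall x r, ev x (kR r) = r.
Hypothesis ev_inj : forall f g, (forall x, ev x f = ev x g) -> f = g.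

Variables (t1 t2 t3 t4 t5 O1 O2 O3 O4 O5 O6 O7 : 'I_5 -> B).
Hypothesis HS : cartan_equations D (fun i j k => kR (str R i j k)) (kR (4 / 3))
  t1 t2 t3 t4 t5 O1 O2 O3 O4 O5 O6 O7.
Hypotheses (t14 : t1 i4 = 0) (t15 : t1 i5 = 0) (t24 : t2 i4 = 0) (t25 : t2 i5 = 0).
Hypotheses (t34 : t3 i4 = 0) (t35 : t3 i5 = 0) (t44 : t4 i4 = 1) (t45 : t4 i5 = 0).
Hypotheses (t54 : t5 i4 = 0) (t55 : t5 i5 = 1).

Lemma ev_ext x al i j : ev x (ext D (fun i j k => kR (str R i j k)) al i j) =
  ev x (D i (al j)) - ev x (D j (al i))
  - (str R i j i1 * ev x (al i1) + str R i j i2 * ev x (al i2)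
     + str R i j i3 * ev x (al i3) + str R i j i4 * ev x (al i4)
     + str R i j i5 * ev x (al i5)).
Proof. by rewrite /ext sum5 !rmorphB !rmorphD !rmorphM !evK. Qed.

(** The structure equations at one point, as equations between real numbers that [lra] can
    combine. *)
Lemma ev_cartan x i j : let v f := ev x f in
  let ex al := v (D i (al j)) - v (D j (al i))
    - (str R i j i1 * v (al i1) + str R i j i2 * v (al i2)
       + str R i j i3 * v (al i3) + str R i j i4 * v (al i4)
       + str R i j i5 * v (al i5)) in
  let w (al be : 'I_5 -> B) := v (al i) * v (be j) - v (al j) * v (be i) in
  [/\ ex t1 = 2 * w t1 O1 + w t1 O4 + w t2 O2 + w t3 t4,
      ex t2 = w t1 O3 + w t2 O1 + 2 * w t2 O4 + w t3 t5,
      ex t3 = w t1 O5 + w t2 O6 + w t3 O1 + w t3 O4 + w t4 t5,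
      ex t4 = w t1 O7 + 4 / 3 * w t3 O6 + w t4 O1 + w t5 O2 &
      ex t5 = w t2 O7 - 4 / 3 * w t3 O5 + w t4 O3 + w t5 O4].
Proof.
move=> v ex w.
have [E1 E2 E3 E4 E5] := HS i j.
split; rewrite /ex -ev_ext ?E1 ?E2 ?E3 ?E4 ?E5.
all: rewrite /wdg /w /v ?(rmorphB, rmorphD, rmorphN, rmorphM, rmorph_nat) /=.
all: by rewrite ?evK; ring.
Qed.

Let Rt := (t14, t15, t24, t25, t34, t35, t44, t45, t54, t55, (der0 HD), (der1 HD)).

Ltac eqs x i j H1 H2 H3 H4 H5 :=
  have := ev_cartan x i j; rewrite /= /str /= !Rt ?rmorph0 ?rmorph1;
  case=> H1 H2 H3 H4 H5.

(** [E_4, E_5] = - E_3, so the first three equations on (E_4, E_5) give the values at E_3; no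
    connection form enters, because t1, t2, t3 vanish on D. *)
Lemma nilpotent3 : [/\ t1 i3 = 0, t2 i3 = 0 & t3 i3 = 1].
Proof.
by split; apply: ev_inj => x; eqs x i4 i5 H1 H2 H3 H4 H5;
   rewrite ?rmorph0 ?rmorph1; lra.
Qed.

(** [E_3, E_4] and [E_3, E_5] are - E_1 and - E_2 modulo D, and t1, t2 vanish on D and on E_3. *)
Lemma nilpotent12 : [/\ t1 i1 = 1, t2 i1 = 0, t1 i2 = 0 & t2 i2 = 1].
Proof.
have [t13 t23 t33] := nilpotent3.
split; apply: ev_inj => x; eqs x i3 i4 H1 H2 H3 H4 H5;
  eqs x i3 i5 H6 H7 H8 H9 H10; move: H1 H2 H6 H7;
  rewrite !(t13, t23, t33, (der0 HD)) ?rmorph0 ?rmorph1;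
  clear H3 H4 H5 H8 H9 H10; lra.
Qed.

Let y := t5 i3.
Let x := t4 i3.

(** The first equation on (E_1, E_4) and the second on (E_2, E_4) give 2 Omega_1 + Omega_4 and
    Omega_1 + 2 Omega_4 at E_4. Their sum is three times the form Omega_1 + Omega_4 that occurs in
    the third equation on (E_3, E_4), which leaves a linear equation for t3(E_1). Replacing E_4 by
    E_5 gives t3(E_2). *)
Lemma nilpotent_grade1 : t3 i1 = kR (- (3 / 4)) * y /\ t3 i2 = kR (3 / 4) * x.
Proof.
have [t13 t23 t33] := nilpotent3; have [t11 t21 t12 t22] := nilpotent12.
split; apply: ev_inj => z; rewrite rmorphM evK /x /y.
- eqs z i3 i4 H1 H2 H3 H4 H5; eqs z i1 i4 H6 H7 H8 H9 H10.
  eqs z i2 i4 H11 H12 H13 H14 H15.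
  move: H3 H6 H12; rewrite !(t13, t23, t33, t11, t12, t21, t22, (der0 HD), (der1 HD)).
  by rewrite ?rmorph0 ?rmorph1; clear H1 H2 H4 H5 H7 H8 H9 H10 H11 H13 H14 H15; lra.
- eqs z i3 i5 H1 H2 H3 H4 H5; eqs z i1 i5 H6 H7 H8 H9 H10.
  eqs z i2 i5 H11 H12 H13 H14 H15.
  move: H3 H6 H12; rewrite !(t13, t23, t33, t11, t12, t21, t22, (der0 HD), (der1 HD)).
  by rewrite ?rmorph0 ?rmorph1; clear H1 H2 H4 H5 H7 H8 H9 H10 H11 H13 H14 H15; lra.
Qed.

Lemma nilpotent_grade2 : [/\ t5 i1 = kR (- (3 / 8)) * y ^+ 2,
  t4 i2 = kR (3 / 8) * x ^+ 2 & t5 i2 = t4 i1 + kR (3 / 4) * x * y].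
Proof.
have [t13 t23 t33] := nilpotent3; have [t11 t21 t12 t22] := nilpotent12.
have [t31 t32] := nilpotent_grade1.
have Dk i r f : D i (kR r * f) = kR r * D i f.
  by rewrite (derM HD) DkR mul0r add0r.
suff H z : [/\ ev z (t5 i1) = - (3 / 8) * ev z y ^+ 2,
  ev z (t4 i2) = 3 / 8 * ev z x ^+ 2 &
  ev z (t5 i2) = ev z (t4 i1) + 3 / 4 * ev z x * ev z y].
  by split; apply: ev_inj => z; have [E1 E2 E3] := H z;
    rewrite ?rmorphD ?rmorphM ?rmorphXn /= ?evK ?E1 ?E2 ?E3.
eqs z i1 i3 A1 A2 A3 A4 A5; eqs z i2 i3 B1 B2 B3 B4 B5.
eqs z i1 i4 C1 C2 C3 C4 C5; eqs z i1 i5 D1 D2 D3 D4 D5.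
eqs z i2 i4 E1 E2 E3 E4 E5; eqs z i2 i5 F1 F2 F3 F4 F5.
eqs z i3 i4 G1 G2 G3 G4 G5; eqs z i3 i5 K1 K2 K3 K4 K5.
eqs z i4 i5 L1 L2 L3 L4 L5.
clear A3 A4 A5 B3 B4 B5 C4 C5 D4 D5 E4 E5 F4 F5 G1 G2 K1 K2 L1 L2 L3.
move: A1 A2 B1 B2 C1 C2 C3 D1 D2 D3 E1 E2 E3 F1 F2 F3 G3 G4 G5 K3 K4 K5 L4 L5.
rewrite !(t31, t32, t13, t23, t33, t11, t12, t21, t22, (der0 HD), (der1 HD), Dk).
rewrite ?rmorph0 ?rmorph1 ?rmorphM /= ?evK -/x -/y.
set vx := ev z x; set vy := ev z y.
move=> A1 A2 B1 B2 C1 C2 C3 D1 D2 D3 E1 E2 E3 F1 F2 F3 G3 G4 G5 K3 K4 K5 L4 L5.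
(* The first two equations on pairs of one of E_1, E_2 with one of E_4, E_5 determine Omega_1, ...,
   Omega_4 on D. Substituting these values removes the products of unknown connection coefficients
   with [vx] and [vy]. *)
have o14 : ev z (O1 i4) = -1 + vy / 2 by clear A1 A2 B1 B2 C2 C3 D1 D2 D3 E1 E3 F1 F2 F3 G3 G4 G5 K3 K4 K5 L4 L5; lra.
have o44 : ev z (O4 i4) = 1 - vy / 4 by clear A1 A2 B1 B2 C2 C3 D1 D2 D3 E1 E3 F1 F2 F3 G3 G4 G5 K3 K4 K5 L4 L5 o14; lra.
have o24 : ev z (O2 i4) = - (3 / 4) * vx by clear A1 A2 B1 B2 C1 C2 C3 D1 D2 D3 E2 E3 F1 F2 F3 G3 G4 G5 K3 K4 K5 L4 L5 o14 o44; lra.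
have o34 : ev z (O3 i4) = 0 by clear A1 A2 B1 B2 C1 C3 D1 D2 D3 E1 E2 E3 F1 F2 F3 G3 G4 G5 K3 K4 K5 L4 L5 o14 o44 o24; lra.
have o15 : ev z (O1 i5) = vx / 4 by clear A1 A2 B1 B2 C1 C2 C3 D2 D3 E1 E2 E3 F1 F3 G3 G4 G5 K3 K4 K5 L4 L5 o14 o44 o24 o34; lra.
have o45 : ev z (O4 i5) = - (vx / 2) by clear A1 A2 B1 B2 C1 C2 C3 D2 D3 E1 E2 E3 F1 F3 G3 G4 G5 K3 K4 K5 L4 L5 o14 o44 o24 o34 o15; lra.
have o25 : ev z (O2 i5) = 3 by clear A1 A2 B1 B2 C1 C2 C3 D1 D2 D3 E1 E2 E3 F2 F3 G3 G4 G5 K3 K4 K5 L4 L5 o14 o44 o24 o34 o15 o45; lra.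
have o35 : ev z (O3 i5) = 1 + 3 / 4 * vy by clear A1 A2 B1 B2 C1 C2 C3 D1 D3 E1 E2 E3 F1 F2 F3 G3 G4 G5 K3 K4 K5 L4 L5 o14 o44 o24 o34 o15 o45 o25; lra.
rewrite ?(o14, o44, o24, o34, o15, o45, o25, o35) in A1 A2 B1 B2 C3 D3 E3 F3 G4 G5 K4 K5.
split.
(* The derivative of [y] along E_4 and the value Omega_5(E_4) enter the third equation on (E_1, E_4)
   and the fifth on (E_3, E_4) in the same ratio, so one combination removes both. *)
- by clear A1 B1 B2 C1 C2 D1 D2 D3 E1 E2 E3 F1 F2 F3 G3 G4 K3 K4 K5 L4 L5 o14 o44 o24 o34 o15 o45 o25 o35; lra.
- by clear A1 A2 B2 C1 C2 C3 D1 D2 D3 E1 E2 E3 F1 F2 G3 G4 G5 K3 K5 L4 L5 o14 o44 o24 o34 o15 o45 o25 o35; lra.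
- by clear A2 B1 C1 C2 C3 D1 D2 E1 E2 F1 F2 F3 G3 G5 K3 K4 L4 L5 o14 o44 o24 o34 o15 o45 o25 o35; lra.
Qed.

End Nilpotent.

(** * The constant Gram matrix and its inverse *)

Section Gram.
Variable R : realType.

Definition gram_inv : 'M[R]_5 :=
  delta_mx i1 i5 + delta_mx i5 i1 - delta_mx i2 i4 - delta_mx i4 i2
  + (3 / 4) *: delta_mx i3 i3.

Lemma gramE i j : gram R i j = nth 0 (nth [::] [::
  [:: 0; 0; 0; 0; 1]; [:: 0; 0; 0; - 1; 0]; [:: 0; 0; 4 / 3; 0; 0];
  [:: 0; - 1; 0; 0; 0]; [:: 1; 0; 0; 0; 0]] i) j.
Proof.
by move: i j; do 2 apply: ord5P; rewrite /gram !mxE /= ?eqxx /=; lra.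
Qed.

Lemma gram_invE i j : gram_inv i j = nth 0 (nth [::] [::
  [:: 0; 0; 0; 0; 1]; [:: 0; 0; 0; - 1; 0]; [:: 0; 0; 3 / 4; 0; 0];
  [:: 0; - 1; 0; 0; 0]; [:: 1; 0; 0; 0; 0]] i) j.
Proof.
by move: i j; do 2 apply: ord5P; rewrite /gram_inv !mxE /= ?eqxx /=; lra.
Qed.

Lemma gramC i j : gram R i j = gram R j i.
Proof. by rewrite !gramE; move: i j; do 2 apply: ord5P. Qed.

Lemma gram_mulV : gram R *m gram_inv = 1%:M.
Proof.
apply/matrixP; do 2 apply: ord5P;
  rewrite mxE sum5 !gramE !gram_invE !mxE /= ?mulr0 ?mul0r ?addr0; lra.
Qed.

Lemma invmx_gram : invmx (gram R) = gram_inv.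
Proof.
have /mulmx1_unit [Hu _] := gram_mulV.
by rewrite -[RHS]mul1mx -(mulVmx Hu) -mulmxA gram_mulV mulmx1.
Qed.

Lemma gram_mulr (f : 'I_5 -> R) k : \sum_m f m * gram R m k =
  nth 0 [:: f i5; - f i4; 4 / 3 * f i3; - f i2; f i1] k.
Proof.
by rewrite sum5 !gramE; move: k; apply: ord5P; rewrite /=; lra.
Qed.

Lemma gram_inv_mulr (f : 'I_5 -> R) k : \sum_m f m * gram_inv m k =
  nth 0 [:: f i5; - f i4; 3 / 4 * f i3; - f i2; f i1] k.
Proof.
by rewrite sum5 !gram_invE; move: k; apply: ord5P; rewrite /=; lra.
Qed.

End Gram.

(** * Curvature of the invariant frame *)

Section ReferenceCurvature.
Variable R : realType.

Let low i j k : R := \sum_m str R i j m * gram R m k.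

Definition chr0 i j k : R :=
  2^-1 * \sum_l (low i j l - low i l j - low j l i) * gram_inv R l k.

Definition riem0 i j k l : R := \sum_p
  (\sum_m (chr0 j k m * chr0 i m p - chr0 i k m * chr0 j m p
            - str R i j m * chr0 m k p)) * gram R p l.

(** A table of literals, so that the sums of Koszul's formula are not unfolded inside those of the
    curvature. *)
Definition chr_val (i j k : nat) : R := nth 0 (nth [::] (nth [::] [::
  [:: [:: 0; 9 / 5; 0; 0; 0];
      [:: 27 / 5; 0; - (243 / 50); 0; 0];
      [:: 0; 0; 0; - (162 / 25); 0];
      [:: 0; 0; 0; 0; 9 / 5];
      [:: 0; 0; 0; 27 / 5; 0]];
  [:: [:: 27 / 5; 0; 243 / 50; 0; 0];
      [:: 0; - (27 / 5); 0; 0; 0];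
      [:: 0; 0; 0; 0; - (162 / 25)];
      [:: 0; 0; 0; 27 / 5; 0];
      [:: 0; 0; 0; 0; - (27 / 5)]];
  [:: [:: 0; - (1 / 5); 0; 81 / 5; 0];
      [:: 3 / 5; 0; 0; 0; 81 / 5];
      [:: 0; 0; 0; 0; 0];
      [:: - (1 / 3); 0; 0; 0; - (1 / 5)];
      [:: 0; - (1 / 3); 0; 3 / 5; 0]];
  [:: [:: - 1; 0; 9 / 5; 0; 0];
      [:: 0; 1; 0; 0; 0];
      [:: 2 / 3; 0; 0; 0; - (12 / 5)];
      [:: 0; 0; 0; - 1; 0];
      [:: 0; 0; - (1 / 2); 0; 1]];
  [:: [:: 0; 1; 0; 0; 0];
      [:: 3; 0; 27 / 5; 0; 0];
      [:: 0; 2 / 3; 0; 36 / 5; 0];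
      [:: 0; 0; 1 / 2; 0; 1];
      [:: 0; 0; 0; 3; 0]]] i) j) k.

Lemma chr0E (i j k : 'I_5) : chr0 i j k = chr_val i j k.
Proof.
rewrite /chr0 gram_inv_mulr; move: k; apply: ord5P; rewrite [LHS]/= /low !gram_mulr;
  move: i j; do 2 apply: ord5P;
  cbn [str chr_val nth nat_of_ord i1 i2 i3 i4 i5]; lra.
Qed.


(** The outer arguments of the quartic lie in D, so their indices are 5 ([true]) or 4 ([false]). The
    inner ones run over all five values, since the unipotent parameters add multiples of E_3, E_4,
    E_5 to e_1 and e_2. *)
Definition riem_val (i l : bool) (j k : nat) : R :=
  nth 0 (nth [::] (nth [::] (nth [::] [::
  [:: [:: [:: - (189 / 25); 0; 0; 0; - (3 / 5)];
          [:: 0; - (54 / 5); 0; 0; 0];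
          [:: 0; 0; - (4 / 5); 0; 0];
          [:: 0; 0; 0; 0; 0];
          [:: - (3 / 5); 0; 0; 0; 0]];
      [:: [:: 0; - (108 / 25); 0; 3 / 5; 0];
          [:: - (189 / 25); 0; 0; 0; 0];
          [:: 0; 0; 0; 0; 0];
          [:: 0; 0; 0; 0; 0];
          [:: 0; - (9 / 5); 0; 0; 0]]];
  [:: [:: [:: 0; - (189 / 25); 0; 0; 0];
          [:: - (108 / 25); 0; 0; 0; - (9 / 5)];
          [:: 0; 0; 0; 0; 0];
          [:: 3 / 5; 0; 0; 0; 0];
          [:: 0; 0; 0; 0; 0]];
      [:: [:: - (54 / 5); 0; 0; 0; 0];
          [:: 0; - (1701 / 25); 0; 9 / 5; 0];
          [:: 0; 0; - (12 / 5); 0; 0];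
          [:: 0; 9 / 5; 0; 0; 0];
          [:: 0; 0; 0; 0; 0]]]] i) l) j) k.

Lemma riem0E (i l : bool) (j k : 'I_5) :
  riem0 (if i then i5 else i4) j k (if l then i5 else i4) = riem_val i l j k.
Proof.
rewrite /riem0 gram_mulr.
case: l; case: i; move: j k; do 2 apply: ord5P;
  rewrite [LHS]/= !sum5 !chr0E;
  cbn [str chr_val riem_val nth nat_of_ord nat_of_bool i1 i2 i3 i4 i5]; lra.
Qed.

(* x, y and w are the parameters of the unipotent part of Cartan's structure
   group. *)
Lemma riem0_quartic (a b : 'I_5 -> R) (r x y w : R) :
  a i1 = 0 -> a i2 = 0 -> a i3 = 0 ->
  b i1 = r * a i4 -> b i2 = r * a i5 ->
  b i3 = 3 / 4 * (y * b i1 - x * b i2) ->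
  b i4 = - (w * b i1 + 3 / 8 * x ^+ 2 * b i2 + x * b i3) ->
  b i5 = 3 / 8 * y ^+ 2 * b i1 - (w + 3 / 4 * x * y) * b i2 - y * b i3 ->
  \sum_i \sum_j \sum_k \sum_l riem0 i j k l * a i * b j * b k * a l =
  r ^+ 2 * (- (189 / 25) * (a i4 ^+ 2 + 3 * a i5 ^+ 2) ^+ 2).
Proof.
move=> a1 a2 a3 b1 b2 b3 b4 b5.
have E i : \sum_j \sum_k \sum_l riem0 i j k l * a i * b j * b k * a l =
    a i * \sum_j \sum_k (riem0 i j k i4 * a i4 + riem0 i j k i5 * a i5) * b j * b k.
  rewrite mulr_sumr; apply: eq_bigr => j _; rewrite mulr_sumr.
  by apply: eq_bigr => k _; rewrite sum5 a1 a2 a3; ring.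
rewrite (eq_bigr _ (fun i _ => E i)) sum5 a1 a2 a3 !mul0r !add0r !sum5.
have e44 := riem0E false false; have e45 := riem0E false true.
have e54 := riem0E true false; have e55 := riem0E true true.
rewrite /= in e44 e45 e54 e55.
rewrite !(e44, e45, e54, e55).
cbn [riem_val nth nat_of_ord nat_of_bool i1 i2 i3 i4 i5].
rewrite !(mul0r, mulr0, addr0, add0r) b5 b4 b3 b1 b2; by field.
Qed.

End ReferenceCurvature.

(** * Comparison of an adapted coframe with the invariant one *)

Section Uniqueness.

Variables (R : realType) (B : comPzRingType) (kR : {rmorphism R -> B}).
Variables (D : 'I_5 -> B -> B).
Local Notation strB := (fun i j k => kR (str R i j k)).
Hypothesis HD : derivations D strB.
Hypothesis DkR : forall i r, D i (kR r) = 0.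
Variables (I : Type) (ev : I -> {rmorphism B -> R}).
Hypothesis evK : forall x r, ev x (kR r) = r.
Hypothesis ev_inj : forall f g, (forall x, ev x f = ev x g) -> f = g.

Local Notation V := 'rV[B]_5.
Local Notation act := (dact D).
Local Notation brk := (dbrk D strB).
Local Notation gm := (map_mx kR (gram R)).
Local Notation gmi := (map_mx kR (gram_inv R)).
Local Notation hB := (kR 2^-1).
Local Notation es := (fun j => delta_mx 0 j : V).
Local Notation ths := (fun i (X : V) => X 0 i).

Let LR := derivations_lie_rinehart HD.

Lemma act_kR (X : V) r : act X (kR r) = 0.
Proof. by rewrite /dact big1 // => j _; rewrite DkR mulr0. Qed.

Lemma double_injB (x y : B) : x + x = y + y -> x = y.
Proof.
have E z : z = kR 2^-1 * (z + z).
  by apply: ev_inj => v; rewrite rmorphM rmorphD evK; field.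
by move=> H; rewrite (E x) (E y) H.
Qed.

Lemma gmCB i j : gm i j = gm j i.
Proof. by rewrite [LHS]mxE [RHS]mxE gramC. Qed.

Lemma gmKB : gm *m gmi = 1%:M.
Proof. by rewrite -map_mxM gram_mulV map_mx1. Qed.

Lemma act_gmB (X : V) i j : act X (gm i j) = 0.
Proof. by rewrite mxE act_kR. Qed.

Lemma hKB : hB * 2 = 1.
Proof.
by rewrite -(rmorph_nat kR) -rmorphM mulVf ?rmorph1 // pnatr_eq0.
Qed.

Lemma std_fchris i j k :
  fchris brk es ths gm gmi hB i j k = kR (chr0 R i j k).
Proof.
have L a b c : flow brk es ths gm a b c = kR (\sum_m str R a b m * gram R m c).
  rewrite /flow rmorph_sum; apply: eq_bigr => m _.
  by rewrite (std_fcoef HD) mxE rmorphM.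
rewrite /fchris /chr0 rmorphM; congr (_ * _); rewrite rmorph_sum.
by apply: eq_bigr => l _; rewrite !L mxE rmorphM !rmorphB.
Qed.

Lemma std_friem i j k l :
  friem act brk es ths gm gmi hB i j k l = kR (riem0 R i j k l).
Proof.
rewrite /friem /riem0 rmorph_sum; apply: eq_bigr => p _.
rewrite mxE rmorphM; congr (_ * _); rewrite /fcurv !std_fchris !act_kR subrr add0r.
rewrite rmorph_sum; apply: eq_bigr => m _.
by rewrite !std_fchris (std_fcoef HD) !rmorphB !rmorphM.
Qed.

Variables (P T : 'M[B]_5) (O1 O2 O3 O4 O5 O6 O7 : 'I_5 -> B).
Hypothesis PT : P *m T = 1%:M.
Hypotheses (T41 : T i4 i1 = 0) (T42 : T i4 i2 = 0) (T43 : T i4 i3 = 0).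
Hypotheses (T51 : T i5 i1 = 0) (T52 : T i5 i2 = 0) (T53 : T i5 i3 = 0).
Hypothesis HS : cartan_equations D strB (kR (4 / 3))
  (T^~ i1) (T^~ i2) (T^~ i3) (T^~ i4) (T^~ i5) O1 O2 O3 O4 O5 O6 O7.

Let e := mframe P.
Let th := mcof T.
Let HC : coframe e th := mx_coframe PT.
Let r := P i4 i4 * P i5 i5 - P i5 i4 * P i4 i5.
Let r' := T i4 i4 * T i5 i5 - T i5 i4 * T i4 i5.

Let TP i j : \sum_m T i m * P m j = (i == j)%:R.
Proof. by have := mulmx1C PT; move/matrixP/(_ i j); rewrite !mxE. Qed.

(** Rows 4 and 5 of [T] vanish outside their last two columns, so the lower right blocks of [T] and
    [P] are mutually inverse. *)
Lemma det_gauge : r' * r = 1.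
Proof.
have := TP i4 i4; have := TP i4 i5; have := TP i5 i4; have := TP i5 i5.
rewrite !sum5 T41 T42 T43 T51 T52 T53 !mul0r !add0r /= => E55 E54 E45 E44.
transitivity ((T i4 i4 * P i4 i4 + T i4 i5 * P i5 i4) *
   (T i5 i4 * P i4 i5 + T i5 i5 * P i5 i5) -
   (T i4 i4 * P i4 i5 + T i4 i5 * P i5 i5) *
   (T i5 i4 * P i4 i4 + T i5 i5 * P i5 i4)); first by rewrite /r /r'; ring.
by rewrite E44 E55 E45 E54; ring.
Qed.

Lemma frame_block : [/\ P i4 i1 = 0, P i4 i2 = 0, P i4 i3 = 0 &
  [/\ P i5 i1 = 0, P i5 i2 = 0 & P i5 i3 = 0]].
Proof.
(* Cramer's rule for the lower right block of [T], with [r] as the inverse of its determinant. *)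
have K4 j : P i4 j = r * (T i5 i5 * (T i4 i4 * P i4 j + T i4 i5 * P i5 j)
    - T i4 i5 * (T i5 i4 * P i4 j + T i5 i5 * P i5 j)).
  by transitivity (r' * r * P i4 j); [rewrite det_gauge mul1r|rewrite /r /r'; ring].
have K5 j : P i5 j = r * (T i4 i4 * (T i5 i4 * P i4 j + T i5 i5 * P i5 j)
    - T i5 i4 * (T i4 i4 * P i4 j + T i4 i5 * P i5 j)).
  by transitivity (r' * r * P i5 j); [rewrite det_gauge mul1r|rewrite /r /r'; ring].
have Z4 j : j != i4 -> T i4 i4 * P i4 j + T i4 i5 * P i5 j = 0.
  move=> /negbTE nj; have := TP i4 j; rewrite eq_sym nj.
  by rewrite sum5 T41 T42 T43 !mul0r !add0r.
have Z5 j : j != i5 -> T i5 i4 * P i4 j + T i5 i5 * P i5 j = 0.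
  move=> /negbTE nj; have := TP i5 j; rewrite eq_sym nj.
  by rewrite sum5 T51 T52 T53 !mul0r !add0r.
have Q4 j : j != i4 -> j != i5 -> P i4 j = 0.
  by move=> n4 n5; rewrite K4 Z4 // Z5 // !mulr0 subrr mulr0.
have Q5 j : j != i4 -> j != i5 -> P i5 j = 0.
  by move=> n4 n5; rewrite K5 Z4 // Z5 // !mulr0 subrr mulr0.
by rewrite !Q4 ?Q5.
Qed.

Let cofE5 k (X : V) : th k X = X 0 i1 * T i1 k + X 0 i2 * T i2 k + X 0 i3 * T i3 k
  + X 0 i4 * T i4 k + X 0 i5 * T i5 k.
Proof. by rewrite /th /mcof mxE sum5. Qed.

(** The left-hand sides are the forms of the gauge-transformed coframe, the [X 0 i] those of the
    invariant one. Here w is the value at E_1 of the transformed fourth form, which the structure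
    equations leave free along with x and y. *)
Lemma normal_form : exists x y w : B, forall X : V,
  let b1 := r * (P i4 i4 * th i1 X + P i5 i4 * th i2 X) in
  let b2 := r * (P i4 i5 * th i1 X + P i5 i5 * th i2 X) in
  [/\ b1 = X 0 i1, b2 = X 0 i2,
   r * th i3 X = kR (3 / 4) * (x * b2 - y * b1) + X 0 i3,
   P i4 i4 * th i4 X + P i5 i4 * th i5 X =
     w * b1 + kR (3 / 8) * x ^+ 2 * b2 + x * X 0 i3 + X 0 i4 &
   P i4 i5 * th i4 X + P i5 i5 * th i5 X =
     - (kR (3 / 8) * y ^+ 2 * b1) + (w + kR (3 / 4) * x * y) * b2
     + y * X 0 i3 + X 0 i5].
Proof.
(* The gauge matrix is the transpose of the lower right block of [P]; it makes the last two
   transformed forms dual to E_4 and E_5. *)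
have sK : r' * (P i4 i4 * P i5 i5 - P i5 i4 * P i4 i5) = 1 := det_gauge.
have [P1 [P2 [P3 [P4 [P5 [P6 [P7 HG]]]]]]] := cartan_gauge HD sK HS.
have T44 : P i4 i4 = r * T i5 i5.
  transitivity (r' * r * P i4 i4); first by rewrite det_gauge mul1r.
  have := TP i4 i4; have := TP i5 i4.
  rewrite !sum5 T41 T42 T43 T51 T52 T53 !mul0r !add0r /= => E1 E2.
  transitivity (r * (T i5 i5 * (T i4 i4 * P i4 i4 + T i4 i5 * P i5 i4) -
     T i4 i5 * (T i5 i4 * P i4 i4 + T i5 i5 * P i5 i4))).
    by rewrite /r'; ring.
  by rewrite E1 E2; ring.
have T54 : P i5 i4 = - (r * T i5 i4).
  transitivity (r' * r * P i5 i4); first by rewrite det_gauge mul1r.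
  have := TP i4 i4; have := TP i5 i4.
  rewrite !sum5 T41 T42 T43 T51 T52 T53 !mul0r !add0r /= => E1 E2.
  transitivity (r * (T i4 i4 * (T i5 i4 * P i4 i4 + T i5 i5 * P i5 i4) -
     T i5 i4 * (T i4 i4 * P i4 i4 + T i4 i5 * P i5 i4))).
    by rewrite /r'; ring.
  by rewrite E1 E2; ring.
have T45 : P i4 i5 = - (r * T i4 i5).
  transitivity (r' * r * P i4 i5); first by rewrite det_gauge mul1r.
  have := TP i4 i5; have := TP i5 i5.
  rewrite !sum5 T41 T42 T43 T51 T52 T53 !mul0r !add0r /= => E1 E2.
  transitivity (r * (T i5 i5 * (T i4 i4 * P i4 i5 + T i4 i5 * P i5 i5) -
     T i4 i5 * (T i5 i4 * P i4 i5 + T i5 i5 * P i5 i5))).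
    by rewrite /r'; ring.
  by rewrite E1 E2; ring.
have T55 : P i5 i5 = r * T i4 i4.
  transitivity (r' * r * P i5 i5); first by rewrite det_gauge mul1r.
  have := TP i4 i5; have := TP i5 i5.
  rewrite !sum5 T41 T42 T43 T51 T52 T53 !mul0r !add0r /= => E1 E2.
  transitivity (r * (T i4 i4 * (T i5 i4 * P i4 i5 + T i5 i5 * P i5 i5) -
     T i5 i4 * (T i4 i4 * P i4 i5 + T i4 i5 * P i5 i5))).
    by rewrite /r'; ring.
  by rewrite E1 E2; ring.
have G44 : P i4 i4 * T i4 i4 + P i5 i4 * T i4 i5 = 1.
  by rewrite T44 T54 -det_gauge /r'; ring.
have G45 : P i4 i4 * T i5 i4 + P i5 i4 * T i5 i5 = 0.
  by rewrite T44 T54; ring.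
have G54 : P i4 i5 * T i4 i4 + P i5 i5 * T i4 i5 = 0.
  by rewrite T45 T55; ring.
have G55 : P i4 i5 * T i5 i4 + P i5 i5 * T i5 i5 = 1.
  by rewrite T45 T55 -det_gauge /r'; ring.
have Z m k : T m k = 0 -> r * T m k = 0 by move=> ->; rewrite mulr0.
have Z2 (a b : B) m k l : T m k = 0 -> T m l = 0 -> r * (a * T m k + b * T m l) = 0.
  by move=> -> ->; rewrite !mulr0 addr0 mulr0.
have N3 := nilpotent3 HD evK ev_inj HG.
have N12 := nilpotent12 HD evK ev_inj HG.
have N1 := nilpotent_grade1 HD evK ev_inj HG.
have N2 := nilpotent_grade2 HD DkR evK ev_inj HG.
have {N3} [| | | | | | | | | |n31 n32 n33] := N3; rewrite ?G44 ?G45 ?G54 ?G55 ?Z ?Z2 //.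
have {N12} [| | | | | | | | | |n11 n12 n21 n22] := N12; rewrite ?G44 ?G45 ?G54 ?G55 ?Z ?Z2 //.
have {N1} [| | | | | | | | | |n13 n23] := N1; rewrite ?G44 ?G45 ?G54 ?G55 ?Z ?Z2 //.
have {N2} [| | | | | | | | | |n15 n24 n25] := N2; rewrite ?G44 ?G45 ?G54 ?G55 ?Z ?Z2 //.
set x := P i4 i4 * T i3 i4 + P i5 i4 * T i3 i5 in n24 n23 n25.
set y := P i4 i5 * T i3 i4 + P i5 i5 * T i3 i5 in n15 n13 n25.
exists x, y, (P i4 i4 * T i1 i4 + P i5 i4 * T i1 i5) => X b1 b2.
have Eb1 : b1 = X 0 i1.
  transitivity (X 0 i1 * (r * (P i4 i4 * T i1 i1 + P i5 i4 * T i1 i2))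
    + X 0 i2 * (r * (P i4 i4 * T i2 i1 + P i5 i4 * T i2 i2))
    + X 0 i3 * (r * (P i4 i4 * T i3 i1 + P i5 i4 * T i3 i2))).
    by rewrite /b1 !cofE5 T41 T42 T51 T52; ring.
  by rewrite n11 n21 n31; ring.
have Eb2 : b2 = X 0 i2.
  transitivity (X 0 i1 * (r * (P i4 i5 * T i1 i1 + P i5 i5 * T i1 i2))
    + X 0 i2 * (r * (P i4 i5 * T i2 i1 + P i5 i5 * T i2 i2))
    + X 0 i3 * (r * (P i4 i5 * T i3 i1 + P i5 i5 * T i3 i2))).
    by rewrite /b2 !cofE5 T41 T42 T51 T52; ring.
  by rewrite n12 n22 n32; ring.
rewrite Eb1 Eb2; split=> //.
- transitivity (X 0 i1 * (r * T i1 i3) + X 0 i2 * (r * T i2 i3) + X 0 i3 * (r * T i3 i3)).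
    by rewrite !cofE5 T43 T53; ring.
  by rewrite n13 n23 n33 rmorphN; ring.
- transitivity (X 0 i1 * (P i4 i4 * T i1 i4 + P i5 i4 * T i1 i5)
    + X 0 i2 * (P i4 i4 * T i2 i4 + P i5 i4 * T i2 i5) + X 0 i3 * x
    + X 0 i4 * (P i4 i4 * T i4 i4 + P i5 i4 * T i4 i5)
    + X 0 i5 * (P i4 i4 * T i5 i4 + P i5 i4 * T i5 i5)).
    by rewrite !cofE5 /x; ring.
  by rewrite n24 G44 G45; ring.
- transitivity (X 0 i1 * (P i4 i5 * T i1 i4 + P i5 i5 * T i1 i5)
    + X 0 i2 * (P i4 i5 * T i2 i4 + P i5 i5 * T i2 i5) + X 0 i3 * y
    + X 0 i4 * (P i4 i5 * T i4 i4 + P i5 i5 * T i4 i5)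
    + X 0 i5 * (P i4 i5 * T i5 i4 + P i5 i5 * T i5 i5)).
    by rewrite !cofE5 /y; ring.
  by rewrite n15 n25 G54 G55 rmorphN; ring.
Qed.

(** The gauge change multiplies both theta^1 theta^5 - theta^2 theta^4 and (theta^3)^2 by the square
    of the determinant, and the unipotent substitution of [normal_form] preserves the metric: x, y
    and w cancel. *)
Lemma fmet_gauge (X Y : V) :
  fmet ths gm X Y = r ^+ 2 * fmet th gm X Y.
Proof.
have [x [y [w N]]] := normal_form.
have [X1 X2 X3 X4 X5] := N X; have [Y1 Y2 Y3 Y4 Y5] := N Y.
have F (u v : 'I_5 -> B) : \sum_i \sum_j gm i j * (u i * v j) =
    u i1 * v i5 + u i5 * v i1 - u i2 * v i4 - u i4 * v i2
    + kR (4 / 3) * (u i3 * v i3).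
  have G i j : gm i j = kR (gram R i j) by rewrite [gm i j]mxE.
  by rewrite !sum5 !G !gramE /= !(rmorph0, rmorph1, rmorphN1); ring.
rewrite /fmet !F.
transitivity
  ((r * (P i4 i4 * th i1 X + P i5 i4 * th i2 X)) *
     (P i4 i5 * th i4 Y + P i5 i5 * th i5 Y) +
   (P i4 i5 * th i4 X + P i5 i5 * th i5 X) *
     (r * (P i4 i4 * th i1 Y + P i5 i4 * th i2 Y)) -
   (r * (P i4 i5 * th i1 X + P i5 i5 * th i2 X)) *
     (P i4 i4 * th i4 Y + P i5 i4 * th i5 Y) -
   (P i4 i4 * th i4 X + P i5 i4 * th i5 X) *
     (r * (P i4 i5 * th i1 Y + P i5 i5 * th i2 Y)) +
   kR (4 / 3) * ((r * th i3 X) * (r * th i3 Y))); last by rewrite /r; ring.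
rewrite X1 X2 X3 X4 X5 Y1 Y2 Y3 Y4 Y5 X1 X2 Y1 Y2.
apply: ev_inj => p.
by rewrite ?(rmorphD, rmorphN, rmorphM, rmorphXn) /= !evK; field.
Qed.

(** [conformal_null_curvature] passes to the reference metric at the cost of [r ^+ 2];
    [riem0_quartic] produces the same factor there, and it is invertible. *)
Lemma quartic_value (p : I) (s z : R) :
  let a : 'rV[R]_5 := s *: delta_mx 0 i4 + z *: delta_mx 0 i5 in
  let b : 'rV[R]_5 := s *: delta_mx 0 i1 + z *: delta_mx 0 i2 in
  \sum_i \sum_j \sum_k \sum_l
    ev p (friem act brk e th gm gmi hB i j k l) * a 0 i * b 0 j * b 0 k * a 0 l =
  - (189 / 25) * ((s * ev p (P i4 i4) + z * ev p (P i5 i4)) ^+ 2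
     + 3 * (s * ev p (P i4 i5) + z * ev p (P i5 i5)) ^+ 2) ^+ 2.
Proof.
move=> a b.
pose aV : V := kR s *: e i4 + kR z *: e i5.
pose bV : V := kR s *: e i1 + kR z *: e i2.
have tha i : th i aV = kR (a 0 i).
  rewrite (cofD HC) !(cofZ HC) !(cofE HC) !mxE /= rmorphD !rmorphM.
  by rewrite !rmorph_nat.
have thb i : th i bV = kR (b 0 i).
  rewrite (cofD HC) !(cofZ HC) !(cofE HC) !mxE /= rmorphD !rmorphM.
  by rewrite !rmorph_nat.
have HG := fmet_metric HC gmCB.
have HT := fnab_torsion_free LR HC gmKB hKB.
have HM := fnab_metric_compatible LR hB HC gmCB gmKB act_gmB.
have HG' := fmet_metric (std_coframe B 5) gmCB.
have HT' := fnab_torsion_free LR (std_coframe B 5) gmKB hKB.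
have HM' := fnab_metric_compatible LR hB (std_coframe B 5) gmCB gmKB act_gmB.
have r2 : r ^+ 2 * r' ^+ 2 = 1 by rewrite -exprMn mulrC det_gauge expr1n.
have gE (u v : 'rV[R]_5) (X Y : V) : (forall i, th i X = kR (u 0 i)) ->
    (forall i, th i Y = kR (v 0 i)) ->
    fmet th gm X Y = kR (u 0 i1 * v 0 i5 + u 0 i5 * v 0 i1 - u 0 i2 * v 0 i4
     - u 0 i4 * v 0 i2 + 4 / 3 * (u 0 i3 * v 0 i3)).
  have G i j : gm i j = kR (gram R i j) by rewrite [gm i j]mxE.
  move=> HX HY; rewrite /fmet !sum5 !G !gramE /= !(rmorph0, rmorph1, rmorphN1).
  rewrite !HX !HY !(rmorphD, rmorphN, rmorphM); ring.
have aa : fmet th gm aV aV = 0.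
  by rewrite (gE a a) // !mxE /= -(rmorph0 kR); congr (kR _); ring.
have ab : fmet th gm aV bV = 0.
  by rewrite (gE a b) // !mxE /= -(rmorph0 kR); congr (kR _); ring.
have bb : fmet th gm bV bV = 0.
  by rewrite (gE b b) // !mxE /= -(rmorph0 kR); congr (kR _); ring.
have := conformal_null_curvature LR double_injB HG HT HM HG' HT' HM' r2 fmet_gauge aa ab bb.
rewrite (fmet_curv LR _ _ _ HC) (fmet_curv LR _ _ _ (std_coframe B 5)).
move/(congr1 (ev p)); rewrite rmorphM.
set S1 := (X in ev p X = _); set S2 := (X in _ = _ * ev p X).
have ES2 : ev p S2 = \sum_i \sum_j \sum_k \sum_l
    ev p (friem act brk e th gm gmi hB i j k l) * a 0 i * b 0 j * b 0 k * a 0 l.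
  rewrite /S2 rmorph_sum; apply: eq_bigr => i _; rewrite rmorph_sum.
  apply: eq_bigr => j _; rewrite rmorph_sum; apply: eq_bigr => k _.
  rewrite rmorph_sum; apply: eq_bigr => l _.
  by rewrite !rmorphM !tha !thb !evK.
have ES1 : ev p S1 = \sum_i \sum_j \sum_k \sum_l
    riem0 R i j k l * ev p (aV 0 i) * ev p (bV 0 j) * ev p (bV 0 k) * ev p (aV 0 l).
  rewrite /S1 rmorph_sum; apply: eq_bigr => i _; rewrite rmorph_sum.
  apply: eq_bigr => j _; rewrite rmorph_sum; apply: eq_bigr => k _.
  rewrite rmorph_sum; apply: eq_bigr => l _.
  by rewrite !rmorphM std_friem evK.
rewrite -ES2 ES1.
have [P41 P42 P43 [P51 P52 P53]] := frame_block.
have [x [y [w /(_ bV) N]]] := normal_form.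
have thb0 : [/\ th i1 bV = kR s, th i2 bV = kR z, th i3 bV = 0 &
             th i4 bV = 0 /\ th i5 bV = 0].
  rewrite !thb !mxE /= !(mulr0, mulr1, addr0, add0r).
  by rewrite !rmorph0.
have [tb1 tb2 tb3 [tb4 tb5]] := thb0.
move: N; rewrite tb1 tb2 tb3 tb4 tb5 !mulr0 !addr0 => -[N1 N2 N3 N4 N5].
rewrite N1 N2 in N3 N4 N5.
have aVE j : aV 0 j = kR s * P i4 j + kR z * P i5 j by rewrite !mxE.
(* The relations among the components of [bV] are the identities of [normal_form] at [bV], on which
   theta^3, theta^4 and theta^5 vanish. *)
rewrite (@riem0_quartic R _ _ (ev p r) (ev p x) (ev p y) (ev p w)).
- move=> E; have rn : ev p r != 0.
    apply/eqP => r0; have := congr1 (ev p) det_gauge.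
    by rewrite rmorphM r0 mulr0 rmorph1 => /eqP; rewrite eq_sym oner_eq0.
  have rn2 : ev p r ^+ 2 != 0 by rewrite expf_neq0.
  apply: (mulfI rn2); rewrite -{1}rmorphXn -E; congr (_ * (_ * _)).
  by rewrite !aVE !rmorphD !rmorphM !evK.
- by rewrite aVE P41 P51 !mulr0 addr0 rmorph0.
- by rewrite aVE P42 P52 !mulr0 addr0 rmorph0.
- by rewrite aVE P43 P53 !mulr0 addr0 rmorph0.
- by rewrite -N1 aVE -rmorphM; congr (ev p _); ring.
- by rewrite -N2 aVE -rmorphM; congr (ev p _); ring.
- have := congr1 (ev p) N3.
  by rewrite rmorph0 !(rmorphD, rmorphM, rmorphN) /= !evK; lra.
- have := congr1 (ev p) N4.
  by rewrite rmorph0 !(rmorphD, rmorphM, rmorphN, rmorphXn) /= !evK; lra.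
- have := congr1 (ev p) N5.
  by rewrite rmorph0 !(rmorphD, rmorphM, rmorphN, rmorphXn) /= !evK; lra.
Qed.

End Uniqueness.

(** * Smooth functions *)

Section Smooth.
Variable R : realType.
Local Notation E := 'rV[R]_6.
Implicit Types (f g : E -> R) (p v : E) (U : set E).

Lemma near_eq_differentiable (f g : E -> R) p :
  (\forall q \near p, f q = g q) -> differentiable f p -> differentiable g p.
Proof.
move=> fg df.
have df0 := df; move/diff_locallyP : df0 => [cf].
move=> /eqaddoP Hf.
suff Hg : g \o shift p = cst (g p) + 'd f p +o_ (0 : E) id.
  have E1 := diff_unique cf Hg.
  by apply/diff_locallyP; rewrite E1.
apply/eqaddoP => eps eps0.
have fgp : f p = g p by exact: nbhs_singleton fg.
near=> h.
have -> : (g \o shift p - (cst (g p) + 'd f p)) h =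
          (f \o shift p - (cst (f p) + 'd f p)) h.
  rewrite /= !fctE /= fgp; congr (_ - _); apply/esym; near: h.
  have := fg; rewrite (near_shift 0) subr0.
  by apply.
near: h; exact: Hf.
Unshelve. all: by end_near. Qed.

Lemma smooth_differentiable U f p : smooth_on U f -> U p -> differentiable f p.
Proof. by move=> sf Up; exact: (sf [::]). Qed.

Lemma partials_rcons s i f :
  partials (rcons s i) f = partials s (fun p => 'D_(delta_mx 0 i) f p).
Proof. by rewrite /partials foldr_rcons. Qed.

Lemma smooth_partial U f i : smooth_on U f ->
  smooth_on U (fun p => 'D_(delta_mx 0 i) f p).
Proof. by move=> sf s p Up; rewrite -partials_rcons; exact: sf. Qed.

Lemma partials_eq U f g : open U -> (forall q, U q -> f q = g q) ->
  forall s q, U q -> partials s f q = partials s g q.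
Proof.
move=> oU fg; elim=> [|i s IH] q Uq /=; first exact: fg.
apply: near_eq_derive; near=> r; apply: IH; near: r.
exact: open_nbhs_nbhs.
Unshelve. all: by end_near. Qed.

Lemma smooth_eq U f g : open U -> (forall q, U q -> f q = g q) ->
  smooth_on U f -> smooth_on U g.
Proof.
move=> oU fg sf s p Up; apply: near_eq_differentiable (sf s p Up).
by near=> q; apply: (partials_eq oU fg); near: q; exact: open_nbhs_nbhs.
Unshelve. all: by end_near. Qed.

(** Coinduction: a class of differentiable functions closed under partial derivatives, up to
    equality on [U], consists of smooth functions. *)
Lemma smooth_coind U (K : (E -> R) -> Prop) : open U ->
  (forall f, K f -> forall p, U p -> differentiable f p) ->
  (forall f, K f -> forall i, exists2 g, K g &
     forall p, U p -> 'D_(delta_mx 0 i) f p = g p) ->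
  forall f, K f -> smooth_on U f.
Proof.
move=> oU Kd Kp f Kf s; elim/last_ind: s f Kf => [|s i IH] f Kf p Up.
  exact: Kd.
rewrite partials_rcons; have [g Kg fg] := Kp f Kf i.
apply: near_eq_differentiable (IH g Kg p Up).
near=> q; apply/esym/(partials_eq oU fg); near: q; exact: open_nbhs_nbhs.
Unshelve. all: by end_near. Qed.

Lemma smooth_cst U (k : R) : open U -> smooth_on U (fun=> k).
Proof.
move=> oU.
apply: (smooth_coind (K := fun f => exists k, f = cst k) oU); last by exists k.
  by move=> _ [c ->] p _; exact: differentiable_cst.
move=> _ [c ->] i; exists (cst 0); first by exists 0.
by move=> p _; rewrite derive_cst.
Qed.

Lemma derive_coord i (v p : E) : 'D_v (fun q : E => q 0 i) p = v 0 i.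
Proof.
have dc := @differentiable_coord R 1 6 p 0 i.
have @f : {linear E -> R}.
  by exists (fun N : E => N 0 i); do 2![eexists]; do ?[constructor];
     rewrite ?mxE// => ? *; rewrite ?mxE//; move=> ?; rewrite !mxE.
rewrite deriveE // (_ : (fun _ => _) = f) // diff_lin //; exact: coord_continuous.
Qed.

Lemma smooth_coord U i : open U -> smooth_on U (fun q : E => q 0 i).
Proof.
move=> oU; apply: (smooth_coind (K := fun f => f = (fun q : E => q 0 i)
  \/ exists k, f = cst k) oU); last by left.
  by move=> f [->|[c ->]] p _; [exact: differentiable_coord|exact: differentiable_cst].
move=> f [->|[c ->]] j.
  exists (cst ((delta_mx 0 j : E) 0 i)); first by right; eexists.
  by move=> p _; rewrite derive_coord.
by exists (cst 0) => [|p _]; [right; exists 0|rewrite derive_cst].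
Qed.

Lemma smoothD U f g : open U -> smooth_on U f -> smooth_on U g ->
  smooth_on U (fun q => f q + g q).
Proof.
move=> oU sf sg.
apply: (smooth_coind (K := fun h => exists f g,
  [/\ smooth_on U f, smooth_on U g & h = f + g]) oU); last first.
  by exists f, g.
  move=> _ [{}f [{}g [{}sf {}sg ->]]] i.
  exists ((fun q => 'D_(delta_mx 0 i) f q) + (fun q => 'D_(delta_mx 0 i) g q)).
    by do 2 eexists; split; [exact: smooth_partial sf|exact: smooth_partial sg|].
  move=> p Up; rewrite deriveD //; apply: diff_derivable.
    exact: smooth_differentiable sf Up.
  exact: smooth_differentiable sg Up.
move=> _ [{}f [{}g [{}sf {}sg ->]]] p Up; apply: differentiableD.
  exact: smooth_differentiable sf Up.
exact: smooth_differentiable sg Up.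
Qed.

Lemma smoothM U f g : open U -> smooth_on U f -> smooth_on U g ->
  smooth_on U (fun q => f q * g q).
Proof.
move=> oU sf sg.
(* Products are not closed under partial derivatives, but finite sums of products are, by the
   Leibniz rule. *)
pose K h := exists (n : nat) (f g : 'I_n -> E -> R),
  [/\ forall i, smooth_on U (f i), forall i, smooth_on U (g i) &
      h = \sum_(i < n) (f i * g i)].
apply: (smooth_coind (K := K) oU); last first.
- exists 1, (fun=> f), (fun=> g); split=> //.
  by rewrite big_ord_recl big_ord0 addr0.
- move=> _ [n [{}f [{}g [{}sf {}sg ->]]]] i.
  pose d (h : E -> R) := fun q => 'D_(delta_mx 0 i) h q.
  exists (\sum_(j < n) (f j * d (g j)) + \sum_(j < n) (d (f j) * g j)).
    exists (n + n)%N, (fun j => match fintype.split j with inl k => f k | inr k => d (f k) end),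
      (fun j => match fintype.split j with inl k => d (g k) | inr k => g k end); split.
    + by move=> j; case: fintype.split => k //; exact: smooth_partial.
    + by move=> j; case: fintype.split => k //; exact: smooth_partial.
    + rewrite big_split_ord /=; congr (_ + _); apply: eq_bigr => k _.
        by rewrite (unsplitK (inl k)).
      by rewrite (unsplitK (inr k)).
  move=> p Up.
  have df j : derivable (f j) p (delta_mx 0 i).
    by apply: diff_derivable; exact: smooth_differentiable (sf j) Up.
  have dg j : derivable (g j) p (delta_mx 0 i).
    by apply: diff_derivable; exact: smooth_differentiable (sg j) Up.
  rewrite derive_sum; last by move=> j; exact: derivableM.
  rewrite -big_split /= fct_sumE; apply: eq_bigr => j _.
  by rewrite deriveM // /d !fctE /= [_ *: _ in X in _ + X]mulrC.
- move=> _ [n [{}f [{}g [{}sf {}sg ->]]]] p Up.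
  apply: differentiable_sum => j; apply: differentiableM.
    exact: smooth_differentiable (sf j) Up.
  exact: smooth_differentiable (sg j) Up.
Qed.

Lemma smoothN U f : open U -> smooth_on U f -> smooth_on U (fun q => - f q).
Proof.
move=> oU sf; apply: (@smooth_eq U (fun q => -1 * f q)) => //.
  by move=> q _; rewrite mulN1r.
by apply: smoothM => //; exact: smooth_cst.
Qed.

Lemma smoothB U f g : open U -> smooth_on U f -> smooth_on U g ->
  smooth_on U (fun q => f q - g q).
Proof. by move=> oU sf sg; apply: smoothD => //; exact: smoothN. Qed.

Lemma smooth_sum U (I : Type) (r : seq I) (F : I -> E -> R) : open U ->
  (forall i, smooth_on U (F i)) -> smooth_on U (fun q => \sum_(i <- r) F i q).
Proof.
move=> oU sF; elim: r => [|i r IH].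
  apply: (@smooth_eq U (fun=> 0)) => //; last exact: smooth_cst.
  by move=> q _; rewrite big_nil.
apply: (@smooth_eq U (fun q => F i q + \sum_(i <- r) F i q)) => //.
  by move=> q _; rewrite big_cons.
exact: smoothD.
Qed.

Lemma derive_partials f p v : differentiable f p ->
  'D_v f p = \sum_i v 0 i * 'D_(delta_mx 0 i) f p.
Proof.
move=> df; rewrite deriveE // {1}(row_sum_delta v) linear_sum.
by apply: eq_bigr => i _; rewrite linearZ deriveE.
Qed.

Lemma smooth_derive U f (X : E -> E) : open U -> smooth_on U f ->
  smooth_field U X -> smooth_on U (fun q => 'D_(X q) f q).
Proof.
move=> oU sf sX.
apply: (@smooth_eq U (fun q => \sum_i X q 0 i * 'D_(delta_mx 0 i) f q)) => //.
  by move=> q Uq; rewrite derive_partials //; exact: smooth_differentiable sf Uq.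
by apply: smooth_sum => // i; apply: smoothM => //; exact: smooth_partial.
Qed.

End Smooth.

(** * Symmetry of second derivatives *)

Section Schwarz.
Variable R : realType.
Local Notation E := 'rV[R]_6.

Lemma is_derive_line (f : E -> R) (v w : E) (t : R) :
  differentiable f (t *: v + w) ->
  is_derive t 1 (fun t : R => f (t *: v + w)) ('D_v f (t *: v + w)).
Proof.
move=> df.
have E1 : (fun h : R => h^-1 *: (f ((h *: 1 + t) *: v + w) - f (t *: v + w))) =
    (fun h : R => h^-1 *: (f (h *: v + (t *: v + w)) - f (t *: v + w))).
  by apply/funext => h; rewrite [h *: 1]mulr1 scalerDl addrA.
have D : derivable f (t *: v + w) v by exact: diff_derivable.
by apply: DeriveDef; [rewrite /derivable /= E1|rewrite /derive /= E1].
Qed.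

Lemma differentiable_estimate (g : E -> R) (p : E) (eps : R) :
  differentiable g p -> 0 < eps ->
  \forall v \near (0 : E), `|g (v + p) - g p - 'D_v g p| <= eps * `|v|.
Proof.
move=> dg e0; have /diff_locally /eqaddoP /(_ _ e0) H := dg.
near=> v; have -> : g (v + p) - g p - 'D_v g p = (g \o shift p - (cst (g p) + 'd g p)) v.
  by rewrite deriveE // !fctE /= opprD addrA.
by near: v; exact: H.
Unshelve. all: by end_near. Qed.

(** The mean value theorem along [u] turns the second difference into an increment of the derivative
    of f along [u], which is then expanded to first order at [p]. *)
Lemma second_difference (U : set E) (f : E -> R) (p u v : E) (eps : R) :
  open U -> U p -> (forall q, U q -> differentiable f q) ->
  differentiable (fun q => 'D_u f q) p -> 0 < eps ->
  exists2 d : R, 0 < d & forall h : R, 0 < h < d ->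
  `|f (h *: u + (h *: v + p)) - f (h *: u + p) - f (h *: v + p) + f p
    - h ^+ 2 * 'D_v (fun q => 'D_u f q) p| <= 2 * (1 + `|u| + `|v|) * eps * h ^+ 2.
Proof.
(* [c * h] bounds the distance from [p] of the two points at which the expansion of [g] is used. *)
move=> oU Up sf dg e0; set g := fun q => 'D_u f q; set c := 1 + `|u| + `|v|.
have c0 : 0 < c by rewrite /c ltr_wpDr // ltr_wpDr.
have /nbhs_ballP [d /= d0 Hd] : \forall w \near (0 : E), U (w + p) /\
    `|g (w + p) - g p - 'D_w g p| <= eps * `|w|.
  near=> w; split; last by near: w; exact: differentiable_estimate.
  near: w; have : \forall q \near p, U q by exact: open_nbhs_nbhs.
  by rewrite (near_shift 0) subr0; apply.
have {}Hd w : `|w| < d -> U (w + p) /\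
    `|g (w + p) - g p - 'D_w g p| <= eps * `|w|.
  by move=> wd; apply: Hd; rewrite -ball_normE /= sub0r normrN.
exists (d / c); first exact: divr_gt0.
move=> h /andP[h0 hd]; have hcd : c * h < d by rewrite mulrC -ltr_pdivlMr.
have N1 (t : R) : 0 <= t <= h -> `|t *: u + h *: v| <= c * h.
  move=> /andP[t0 th]; apply: le_trans (ler_normD _ _) _.
  rewrite !normrZ (ger0_norm t0) (gtr0_norm h0) /c.
  have ? : t * `|u| <= h * `|u| by apply: ler_wpM2r.
  nra.
have N2 (t : R) : 0 <= t <= h -> `|t *: u| <= c * h.
  move=> /andP[t0 th]; rewrite normrZ (ger0_norm t0) /c.
  have ? : t * `|u| <= h * `|u| by apply: ler_wpM2r.
  have ? : 0 <= `|v| by [].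
  nra.
pose phi t := f (t *: u + (h *: v + p)) - f (t *: u + p).
have dphi t : 0 <= t <= h -> is_derive t 1 phi
    (g (t *: u + (h *: v + p)) - g (t *: u + p)).
  move=> th; apply: is_deriveB.
    apply: is_derive_line; apply: sf; rewrite addrA.
    by apply: (Hd _ _).1; apply: le_lt_trans (N1 _ th) _.
  apply: is_derive_line; apply: sf.
  by apply: (Hd _ _).1; apply: le_lt_trans (N2 _ th) _.
have [||xi xih Exi] := @MVT R phi
    (fun t => g (t *: u + (h *: v + p)) - g (t *: u + p)) 0 h h0.
- move=> t /itvP ht; apply: dphi.
  by rewrite !ht.
- apply: derivable_within_continuous => t /itvP ht.
  have [|] // := dphi t _.
  by rewrite !ht.
have {}xih : 0 <= xi <= h by rewrite !(itvP xih).
have [_ B1] := Hd _ (le_lt_trans (N1 _ xih) hcd).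
have [_ B2] := Hd _ (le_lt_trans (N2 _ xih) hcd).
have n1 := N1 _ xih; have n2 := N2 _ xih.
have L : 'D_(xi *: u + h *: v) g p = 'D_(xi *: u) g p + h * 'D_v g p.
  by rewrite !deriveE // linearD [in X in _ + X]linearZ.
have -> : f (h *: u + (h *: v + p)) - f (h *: u + p) - f (h *: v + p) + f p
    = phi h - phi 0.
  rewrite /phi !scale0r !add0r.
  by move: (f _) (f _) (f _) (f _) => a1 a2 a3 a4; ring.
rewrite Exi subr0 addrA.
set e1 := g (xi *: u + h *: v + p) - g p - 'D_(xi *: u + h *: v) g p in B1.
set e2 := g (xi *: u + p) - g p - 'D_(xi *: u) g p in B2.
have -> : (g (xi *: u + h *: v + p) - g (xi *: u + p)) * h - h ^+ 2 * 'D_v g p =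
    (e1 - e2) * h.
  rewrite /e1 /e2 L.
  move: (g (xi *: u + h *: v + p)) (g (xi *: u + p)) (g p) => a1 a2 a3.
  by move: ('D_(xi *: u) g p) ('D_v g p) => a4 a5; ring.
rewrite normrM (gtr0_norm h0) expr2 mulrA ler_pM2r //.
apply: le_trans (ler_normB _ _) _.
apply: le_trans (lerD B1 B2) _.
apply: le_trans (lerD (ler_wpM2l (ltW e0) n1) (ler_wpM2l (ltW e0) n2)) _.
by rewrite le_eqVlt (_ : _ + _ = 2 * c * eps * h) ?eqxx //; ring.
Unshelve. all: by end_near. Qed.

Lemma schwarz (U : set E) (f : E -> R) (p u v : E) :
  open U -> U p -> (forall q, U q -> differentiable f q) ->
  differentiable (fun q => 'D_u f q) p -> differentiable (fun q => 'D_v f q) p ->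
  'D_v (fun q => 'D_u f q) p = 'D_u (fun q => 'D_v f q) p.
Proof.
move=> oU Up sf du dv; apply/eqP; rewrite -subr_eq0 -normr_le0.
apply/ler_addgt0Pl => eps e0; rewrite addr0.
set c := 1 + `|u| + `|v|.
have c0 : 0 < c by rewrite /c ltr_wpDr // ltr_wpDr.
(* The second difference is symmetric in [u] and [v]; with this choice each of its two estimates
   contributes eps / 2 after division by h ^+ 2. *)
have e1 : 0 < eps / (4 * c) by rewrite divr_gt0 // mulr_gt0.
have [d1 d10 H1] := second_difference v oU Up sf du e1.
have [d2 d20 H2] := second_difference u oU Up sf dv e1.
set h := Num.min d1 d2 / 2.
have m0 : 0 < Num.min d1 d2 by rewrite lt_min d10.
have h0 : 0 < h by rewrite divr_gt0.
have hm : h < Num.min d1 d2 by rewrite /h; lra.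
have [h1 h2] : h < d1 /\ h < d2.
  by move: hm; rewrite lt_min => /andP.
have := H1 h; rewrite h0 h1 => /(_ isT) {}H1.
have := H2 h; rewrite h0 h2 => /(_ isT) {}H2.
have h20 : 0 < h ^+ 2 by rewrite exprn_gt0.
rewrite -(ler_pM2l h20).
rewrite -[X in X * `|_|](gtr0_norm h20) -normrM.
rewrite (_ : h *: v + (h *: u + p) = h *: u + (h *: v + p)) in H2; last by rewrite addrCA.
move: H1 H2; set x := f _; set y := f _; set z := f _.
set a := 'D_v _ p; set b := 'D_u _ p => H1 H2.
have -> : h ^+ 2 * (a - b) = (x - z - y + f p - h ^+ 2 * b) - (x - y - z + f p - h ^+ 2 * a).
  by clearbody x y z a b; move: (f p) => t; ring.
apply: le_trans (ler_normB _ _) _; apply: le_trans (lerD H2 H1) _.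
rewrite le_eqVlt; apply/orP; left; apply/eqP.
rewrite (_ : 1 + `|v| + `|u| = c); last by rewrite /c; ring.
by rewrite -/c; clearbody h c; clear -c0; field; rewrite gt_eqF.
Qed.

End Schwarz.

(** * Invariant fields on triangles *)

Definition j0 : 'I_6 := @Ordinal 6 0 isT.
Definition j1 : 'I_6 := @Ordinal 6 1 isT.
Definition j2 : 'I_6 := @Ordinal 6 2 isT.
Definition j3 : 'I_6 := @Ordinal 6 3 isT.
Definition j4 : 'I_6 := @Ordinal 6 4 isT.
Definition j5 : 'I_6 := @Ordinal 6 5 isT.
Definition o0 : 'I_3 := @Ordinal 3 0 isT.
Definition o1 : 'I_3 := @Ordinal 3 1 isT.
Definition o2 : 'I_3 := @Ordinal 3 2 isT.

Lemma ord6P (P : 'I_6 -> Prop) :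
  P j0 -> P j1 -> P j2 -> P j3 -> P j4 -> P j5 -> forall i, P i.
Proof.
move=> H0 H1 H2 H3 H4 H5 [[|[|[|[|[|[|m]]]]]] Hi] //.
- by rewrite (_ : Ordinal Hi = j0) //; apply: val_inj.
- by rewrite (_ : Ordinal Hi = j1) //; apply: val_inj.
- by rewrite (_ : Ordinal Hi = j2) //; apply: val_inj.
- by rewrite (_ : Ordinal Hi = j3) //; apply: val_inj.
- by rewrite (_ : Ordinal Hi = j4) //; apply: val_inj.
- by rewrite (_ : Ordinal Hi = j5) //; apply: val_inj.
Qed.

Lemma sum6 (B : nmodType) (F : 'I_6 -> B) :
  \sum_i F i = F j0 + F j1 + F j2 + F j3 + F j4 + F j5.
Proof.
rewrite !big_ord_recl big_ord0 addr0 !addrA.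
by do ![congr (_ + _)]; congr F; apply: val_inj.
Qed.

Lemma sum3 (B : nmodType) (F : 'I_3 -> B) : \sum_i F i = F o0 + F o1 + F o2.
Proof.
rewrite !big_ord_recl big_ord0 addr0 !addrA.
by do ![congr (_ + _)]; congr F; apply: val_inj.
Qed.

Lemma ixE : (ix o0 = j0) * (ix o1 = j2) * (ix o2 = j4).
Proof. by do ![split]; apply: val_inj; rewrite /= inordK. Qed.

Lemma iyE : (iy o0 = j1) * (iy o1 = j3) * (iy o2 = j5).
Proof. by do ![split]; apply: val_inj; rewrite /= inordK. Qed.

Lemma ordSE : (ordS o0 = o1) * (ordS o1 = o2) * (ordS o2 = o0).
Proof. by do ![split]; apply: val_inj. Qed.

Section Geometry.
Variable R : realType.
Local Notation E := 'rV[R]_6.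
Implicit Types (p q u v : E).

Lemma areaE p : area p = 2^-1 *
  (p 0 j1 * p 0 j2 - p 0 j0 * p 0 j3 + (p 0 j3 * p 0 j4 - p 0 j2 * p 0 j5)
   + (p 0 j5 * p 0 j0 - p 0 j4 * p 0 j1)).
Proof. by rewrite /area sum3 !ordSE !ixE !iyE. Qed.

Definition vec6 (a b c d e f : R) : E := \row_i nth 0 [:: a; b; c; d; e; f] i.

Lemma vec6E (a b c d e f : R) i :
  vec6 a b c d e f 0 i = nth 0 [:: a; b; c; d; e; f] i.
Proof. by rewrite mxE. Qed.

Lemma ZfieldE p :
  [/\ Zfield o0 p = vec6 (p 0 j2 - p 0 j4) (p 0 j3 - p 0 j5) 0 0 0 0,
      Zfield o1 p = vec6 0 0 (p 0 j4 - p 0 j0) (p 0 j5 - p 0 j1) 0 0 &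
      Zfield o2 p = vec6 0 0 0 0 (p 0 j0 - p 0 j2) (p 0 j1 - p 0 j3)].
Proof.
split; apply/rowP; apply: ord6P;
  rewrite /Zfield !ordSE !ixE !iyE vec6E !mxE /= ?(mulr0, mulr1, addr0, add0r) //.
Qed.

Definition linear_form (f : E -> R) :=
  forall a u v, f (a *: u + v) = a * f u + f v.

Lemma linear_formE f : linear_form f ->
  f = fun q => \sum_i q 0 i * f (delta_mx 0 i).
Proof.
move=> lf; apply/funext => q; rewrite {1}(row_sum_delta q).
have f0 : f 0 = 0.
  by have := lf (-1) 0 0; rewrite scaler0 addr0 mulN1r addNr.
have fD u v : f (u + v) = f u + f v.
  by have := lf 1 u v; rewrite scale1r mul1r.
rewrite (big_morph f fD f0); apply: eq_bigr => i _.
by have := lf (q 0 i) (delta_mx 0 i) 0; rewrite !addr0 f0 addr0.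
Qed.

Lemma linear_form_smooth U f : open U -> linear_form f -> smooth_on U f.
Proof.
move=> oU /linear_formE ->; apply: smooth_sum => // i; apply: smoothM => //.
  exact: smooth_coord.
exact: smooth_cst.
Qed.

Lemma linear_form_derive f p v : linear_form f -> 'D_v f p = f v.
Proof.
move=> lf; rewrite {1}(linear_formE lf).
have -> : (fun q : E => \sum_i q 0 i * f (delta_mx 0 i)) =
    \sum_(i < 6) (f (delta_mx 0 i) *: (fun q : E => q 0 i)).
  apply/funext => q; rewrite fct_sumE; apply: eq_bigr => i _.
  by rewrite /= mulrC.
have dc i : derivable (fun q : E => q 0 i) p v.
  by apply: diff_derivable; exact: differentiable_coord.
rewrite derive_sum; last by move=> i; exact: derivableZ.
rewrite [RHS](congr1 (fun g => g v) (linear_formE lf)); apply: eq_bigr => i _.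
by rewrite deriveZ // derive_coord [LHS]mulrC.
Qed.

(* [Efield j] moves the vertex p_i with velocity \sum_l nmat j i l p_l; the
   zero row sums and traces make these fields translation invariant and tangent
   to the level sets of the area.  [Efield i4] is Z_1 - Z_2 and [Efield i5] is
   Z_1 + Z_2 - 2 Z_3. *)
Definition nmat (j i l : nat) : R := nth 0 (nth [::] (nth [::] [::
 [:: [:: - 6; 21 / 5; 9 / 5]; [:: - (21 / 5); 6; - (9 / 5)];
     [:: - (12 / 5); 12 / 5; 0]];
 [:: [:: - 6; - (3 / 5); 33 / 5]; [:: - (3 / 5); - 6; 33 / 5]; [:: - 6; - 6; 12]];
 [:: [:: 0; - 2; 2]; [:: 2; 0; - 2]; [:: - 2; 2; 0]];
 [:: [:: 0; 1; - 1]; [:: 1; 0; - 1]; [:: 0; 0; 0]];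
 [:: [:: 0; 1; - 1]; [:: - 1; 0; 1]; [:: - 2; 2; 0]]] j) i) l.

Definition Efield (j : 'I_5) (q : E) : E := \row_(k < 6)
  if odd k then nmat j k./2 0 * q 0 j1 + nmat j k./2 1 * q 0 j3 + nmat j k./2 2 * q 0 j5
  else nmat j k./2 0 * q 0 j0 + nmat j k./2 1 * q 0 j2 + nmat j k./2 2 * q 0 j4.

(** The k-th form below sends a motion with velocities v_c of the vertices to the sum over c of kap
    k c det(p_3 - p_1, v_c) - lam k c det(p_2 - p_1, v_c). *)
Definition kap (k i : nat) : R := nth 0 (nth [::]
  [:: [:: 1 / 12; 1 / 12; 0]; [:: 1 / 36; - (1 / 36); 0];
      [:: - (1 / 12); - (1 / 12); 1 / 6]; [:: 7 / 20; - (7 / 20); 0];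
      [:: - (1 / 60); - (1 / 60); 1 / 3]] k) i.
Definition lam (k i : nat) : R := nth 0 (nth [::]
  [:: [:: 1 / 12; 0; 0]; [:: 1 / 36; 0; 1 / 18];
      [:: 1 / 12; - (1 / 6); 1 / 12]; [:: - (3 / 20); - (1 / 2); 1 / 5];
      [:: - (11 / 60); 1 / 6; 1 / 6]] k) i.

(* Twice the area times the dual coframe of [Efield], extended to all of R^6 by
   0 on the radial field about the centroid. *)
Definition rform (k : 'I_5) (q : E) : E := \row_(c < 6)
  if odd c then kap k c./2 * (q 0 j4 - q 0 j0) - lam k c./2 * (q 0 j2 - q 0 j0)
  else lam k c./2 * (q 0 j3 - q 0 j1) - kap k c./2 * (q 0 j5 - q 0 j1).

Definition darea (q : E) : E := vec6
  ((q 0 j5 - q 0 j3) / 2) ((q 0 j2 - q 0 j4) / 2)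
  ((q 0 j1 - q 0 j5) / 2) ((q 0 j4 - q 0 j0) / 2)
  ((q 0 j3 - q 0 j1) / 2) ((q 0 j0 - q 0 j2) / 2).

Definition radial (q : E) : E := vec6
  ((2 * q 0 j0 - q 0 j2 - q 0 j4) / 3) ((2 * q 0 j1 - q 0 j3 - q 0 j5) / 3)
  ((2 * q 0 j2 - q 0 j0 - q 0 j4) / 3) ((2 * q 0 j3 - q 0 j1 - q 0 j5) / 3)
  ((2 * q 0 j4 - q 0 j0 - q 0 j2) / 3) ((2 * q 0 j5 - q 0 j1 - q 0 j3) / 3).

Lemma Efield_linear j k : linear_form (fun q => Efield j q 0 k).
Proof. by move=> a u v; rewrite !mxE; case: ifP => _; ring. Qed.

Lemma rform_linear j k : linear_form (fun q => rform j q 0 k).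
Proof. by move=> a u v; rewrite !mxE; case: ifP => _; ring. Qed.

Lemma darea_linear k : linear_form (fun q => darea q 0 k).
Proof. by move=> a u v; rewrite !vec6E; move: k; apply: ord6P; rewrite /= !mxE; ring. Qed.

Lemma derive_area v p : 'D_v (@area R) p = pairing (darea p) v.
Proof.
have dc i q : derivable (fun q : E => q 0 i) q v.
  by apply: diff_derivable; exact: differentiable_coord.
have dM a b : 'D_v (fun q : E => q 0 a * q 0 b) p = p 0 a * v 0 b + p 0 b * v 0 a.
  by rewrite (deriveM (dc a p) (dc b p)) !derive_coord.
have dMd a b : derivable (fun q : E => q 0 a * q 0 b) p v.
  exact: derivableM (dc a p) (dc b p).
have H a b : is_derive p v (fun q : E => q 0 a * q 0 b)
    (p 0 a * v 0 b + p 0 b * v 0 a) by apply: DeriveDef.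
have K := is_deriveZ 2^-1 (is_deriveD (is_deriveD
  (is_deriveB (H j1 j2) (H j0 j3)) (is_deriveB (H j3 j4) (H j2 j5)))
  (is_deriveB (H j5 j0) (H j4 j1))).
have -> : @area R = 2^-1 \*:
  ((fun q : E => q 0 j1 * q 0 j2) - (fun q : E => q 0 j0 * q 0 j3)
  + ((fun q : E => q 0 j3 * q 0 j4) - (fun q : E => q 0 j2 * q 0 j5))
  + ((fun q : E => q 0 j5 * q 0 j0) - (fun q : E => q 0 j4 * q 0 j1))).
  by apply/funext => q; rewrite areaE.
transitivity (2^-1 *: (p 0 j1 * v 0 j2 + p 0 j2 * v 0 j1
  - (p 0 j0 * v 0 j3 + p 0 j3 * v 0 j0) +
  (p 0 j3 * v 0 j4 + p 0 j4 * v 0 j3 - (p 0 j2 * v 0 j5 + p 0 j5 * v 0 j2)) +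
  (p 0 j5 * v 0 j0 + p 0 j0 * v 0 j5 - (p 0 j4 * v 0 j1 + p 0 j1 * v 0 j4)))).
  exact: (@derive_val _ _ _ _ _ _ _ K).
rewrite /pairing sum6 !vec6E /=.
by rewrite [LHS]/GRing.scale /=; field.
Qed.

Lemma rform_Efield j k q :
  pairing (rform k q) (Efield j q) = (k == j)%:R * (2 * area q).
Proof.
rewrite /pairing sum6 !mxE areaE; move: j k; do 2 apply: ord5P;
  cbn [odd half negb uphalf nat_of_ord j0 j1 j2 j3 j4 j5 i1 i2 i3 i4 i5 kap lam nmat nth];
  rewrite -!val_eqE /=; lra.
Qed.

Lemma darea_Efield j q : pairing (darea q) (Efield j q) = 0.
Proof.
rewrite /pairing sum6 !vec6E !mxE; move: j; apply: ord5P;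
  cbn [odd half negb uphalf nat_of_ord j0 j1 j2 j3 j4 j5 i1 i2 i3 i4 i5 nmat nth]; lra.
Qed.

(** The radial field completes the frame to a basis. The area is translation invariant and
    homogeneous of degree 2, so its derivative along [radial] is twice the area, which matches the
    factor on the left. *)
Lemma frame_decomposition q v : (2 * area q) *: v =
  \sum_k pairing (rform k q) v *: Efield k q + pairing (darea q) v *: radial q.
Proof.
apply/rowP => c; rewrite sum5 ![in RHS]mxE [in LHS]mxE /pairing !sum6 !vec6E !mxE areaE.
by move: c; apply: ord6P;
  cbn [odd half negb uphalf nat_of_ord j0 j1 j2 j3 j4 j5 i1 i2 i3 i4 i5 kap lam nmat nth]; lra.
Qed.

Lemma Efield_commutator i j q k :
  Efield j (Efield i q) 0 k - Efield i (Efield j q) 0 k =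
  (\sum_m str R i j m *: Efield m q) 0 k.
Proof.
rewrite sum5 !mxE; move: k; apply: ord6P; move: i j; do 2 apply: ord5P;
  cbn [odd half negb uphalf nat_of_ord j0 j1 j2 j3 j4 j5 i1 i2 i3 i4 i5 nmat str nth]; lra.
Qed.

End Geometry.

(** * Tangential calculus on the level sets of the area *)

Section Calculus.
Variable R : realType.
Local Notation E := 'rV[R]_6.
Implicit Types (p q u v : E) (al X Y : E -> E) (U : set E).

Lemma pairingDr (al u v : E) : pairing al (u + v) = pairing al u + pairing al v.
Proof.
by rewrite /pairing -big_split; apply: eq_bigr => i _; rewrite /= mxE mulrDr.
Qed.

Lemma pairingZr (al u : E) (a : R) : pairing al (a *: u) = a * pairing al u.
Proof.
by rewrite /pairing mulr_sumr; apply: eq_bigr => i _; rewrite mxE mulrCA.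
Qed.

Lemma pairingBr (al u v : E) : pairing al (u - v) = pairing al u - pairing al v.
Proof. by rewrite pairingDr -[- v]scaleN1r pairingZr mulN1r. Qed.

Lemma pairingDl (al be u : E) : pairing (al + be) u = pairing al u + pairing be u.
Proof.
by rewrite /pairing -big_split; apply: eq_bigr => i _; rewrite /= mxE mulrDl.
Qed.

Lemma pairingZl (al u : E) (a : R) : pairing (a *: al) u = a * pairing al u.
Proof.
by rewrite /pairing mulr_sumr; apply: eq_bigr => i _; rewrite mxE mulrA.
Qed.

Lemma pairing_sumr (I : Type) (r : seq I) (al : E) (F : I -> E) :
  pairing al (\sum_(i <- r) F i) = \sum_(i <- r) pairing al (F i).
Proof.
apply: (big_morph (pairing al)) => [u v|]; first exact: pairingDr.
by have := pairingZr al 0 0; rewrite scale0r mul0r.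
Qed.

Lemma smooth_pairing U al X : open U -> smooth_field U al -> smooth_field U X ->
  smooth_on U (fun q => pairing (al q) (X q)).
Proof. by move=> oU sa sX; apply: smooth_sum => // i; exact: smoothM. Qed.

Lemma field_derivable U X p v : smooth_field U X -> U p -> derivable X p v.
Proof.
move=> sX Up; apply/derivable_mxP => i j; rewrite (ord1 i); apply: diff_derivable.
exact: smooth_differentiable (sX j) Up.
Qed.

Lemma derive_field U X p v k : smooth_field U X -> U p ->
  ('D_v X p) 0 k = 'D_v (fun q => X q 0 k) p.
Proof.
by move=> sX Up; rewrite derive_mx ?mxE //; exact: field_derivable sX Up.
Qed.

Lemma lie_bracketE U X Y p k : smooth_field U X -> smooth_field U Y -> U p ->
  lie_bracket X Y p 0 k =
  'D_(X p) (fun q => Y q 0 k) p - 'D_(Y p) (fun q => X q 0 k) p.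
Proof.
move=> sX sY Up; rewrite -(derive_field (X p) k sY Up) -(derive_field (Y p) k sX Up).
by rewrite /lie_bracket mxE [X in _ + X]mxE.
Qed.

Lemma smooth_lie_bracket U X Y : open U -> smooth_field U X -> smooth_field U Y ->
  smooth_field U (lie_bracket X Y).
Proof.
move=> oU sX sY k; apply: (smooth_eq oU (f := fun p =>
  'D_(X p) (fun q => Y q 0 k) p - 'D_(Y p) (fun q => X q 0 k) p)).
  by move=> q Uq; rewrite (lie_bracketE k sX sY).
by apply: smoothB => //; exact: smooth_derive.
Qed.

Lemma derive_pairing U al X p v : open U -> smooth_field U al -> smooth_field U X ->
  U p -> 'D_v (fun q => pairing (al q) (X q)) p =
  pairing ('D_v al p) (X p) + pairing (al p) ('D_v X p).
Proof.
move=> oU sa sX Up.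
have -> : (fun q => pairing (al q) (X q)) =
    \sum_(i < 6) ((fun q => al q 0 i) * (fun q => X q 0 i)).
  by apply/funext => q; rewrite fct_sumE.
have da i : derivable (fun q => al q 0 i) p v.
  by apply: diff_derivable; exact: smooth_differentiable (sa i) Up.
have dX i : derivable (fun q => X q 0 i) p v.
  by apply: diff_derivable; exact: smooth_differentiable (sX i) Up.
rewrite derive_sum; last by move=> i; exact: derivableM.
rewrite /pairing -big_split; apply: eq_bigr => i _ /=.
rewrite deriveM // (derive_field _ _ sa) // (derive_field _ _ sX) //.
by rewrite addrC; congr (_ + _); rewrite [LHS]mulrC.
Qed.

Lemma smooth_cst_field U (v : E) : open U -> smooth_field U (fun=> v).
Proof. by move=> oU i; exact: smooth_cst. Qed.

Lemma ext_dE U al p u v : open U -> smooth_field U al -> U p ->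
  ext_d al p u v = pairing ('D_u al p) v - pairing ('D_v al p) u.
Proof.
move=> oU sa Up; rewrite /ext_d.
rewrite !(derive_pairing _ oU sa (smooth_cst_field _ oU) Up).
have -> : 'D_u (fun=> v) p = 0 by exact: derive_cst.
have -> : 'D_v (fun=> u) p = 0 by exact: derive_cst.
have p0 (w : E) : pairing w 0 = 0.
  by have := pairingZr w 0 0; rewrite scale0r mul0r.
by rewrite !p0 !addr0.
Qed.

Lemma ext_d_formula U al X Y p : open U -> smooth_field U al ->
  smooth_field U X -> smooth_field U Y -> U p ->
  ext_d al p (X p) (Y p) =
  'D_(X p) (fun q => pairing (al q) (Y q)) p
  - 'D_(Y p) (fun q => pairing (al q) (X q)) p
  - pairing (al p) (lie_bracket X Y p).
Proof.
move=> oU sa sX sY Up; rewrite (ext_dE _ _ oU sa Up) !(derive_pairing _ oU sa) //.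
by rewrite /lie_bracket pairingBr; ring.
Qed.

Lemma deriveDv (f : E -> R) p u v : differentiable f p ->
  'D_(u + v) f p = 'D_u f p + 'D_v f p.
Proof. by move=> df; rewrite !deriveE // linearD. Qed.

Lemma deriveZv (f : E -> R) p (a : R) v : differentiable f p ->
  'D_(a *: v) f p = a * 'D_v f p.
Proof. by move=> df; rewrite !deriveE // linearZ. Qed.

Lemma derive_sumv (f : E -> R) p (n : nat) (a : 'I_n -> R) (F : 'I_n -> E) :
  differentiable f p ->
  'D_(\sum_i a i *: F i) f p = \sum_i a i * 'D_(F i) f p.
Proof.
move=> df; rewrite deriveE // linear_sum; apply: eq_bigr => i _.
by rewrite linearZ deriveE.
Qed.

Lemma tangentP q v : tangent (@area R) q v <-> pairing (darea q) v = 0.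
Proof. by rewrite /tangent /= derive_area. Qed.

(** A directional derivative only sees the line through [p], and here that line stays in the level
    set. *)
Lemma derive_line_eq (f g : E -> R) U p w : open U -> U p ->
  differentiable f p -> differentiable g p ->
  (forall q, U q -> area q = area p -> f q = g q) ->
  (forall t : R, area (t *: w + p) = area p) -> 'D_w f p = 'D_w g p.
Proof.
move=> oU Up df dg fg lw.
have D (h : E -> R) : differentiable h p ->
    'D_w h p = 'D_1 (fun t : R => h (t *: w + p)) 0.
  move=> dh; have dh' : differentiable h (0 *: w + p) by rewrite scale0r add0r.
  by rewrite (@derive_val _ _ _ _ _ _ _ (is_derive_line dh')) scale0r add0r.
rewrite !D //; apply: near_eq_derive; near=> t; apply: fg; last exact: lw.
near: t.
have c : {for (0 : R), continuous (fun t : R => t *: w + p)}.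
  apply: differentiable_continuous; apply: differentiableD => //.
have : nbhs (0 *: w + p) U by rewrite scale0r add0r; exact: open_nbhs_nbhs.
by move/c.
Unshelve. all: by end_near. Qed.

(* Translations, and moving a vertex parallel to the opposite side, are motions
   along lines contained in the level sets of the area; their directions span
   the tangent space. *)
Lemma line_decomposition p v :
  let d (a b : R * R) := a.1 * b.2 - a.2 * b.1 in
  let a := (p 0 j2 - p 0 j0, p 0 j3 - p 0 j1) in
  let b := (p 0 j4 - p 0 j0, p 0 j5 - p 0 j1) in
  let v1 := (v 0 j0, v 0 j1) in let v2 := (v 0 j2, v 0 j3) in
  let v3 := (v 0 j4, v 0 j5) in
  (2 * area p) *: v =
  - (d v2 b * a.1 + d a v3 * b.1) *: vec6 1 0 1 0 1 0
  + - (d v2 b * a.2 + d a v3 * b.2) *: vec6 0 1 0 1 0 1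
  + (d v2 b - d v1 b) *: vec6 (p 0 j2 - p 0 j4) (p 0 j3 - p 0 j5) 0 0 0 0
  + (d a v3 - d a v2) *: vec6 0 0 (p 0 j4 - p 0 j0) (p 0 j5 - p 0 j1) 0 0
  + (d v3 b - d v2 b) *: vec6 0 0 0 0 (p 0 j0 - p 0 j2) (p 0 j1 - p 0 j3)
  - (2 * pairing (darea p) v) *: vec6 b.1 b.2 0 0 0 0.
Proof.
move=> d a b v1 v2 v3; rewrite /d /a /b /v1 /v2 /v3 /=.
apply/rowP => c; rewrite ![in RHS]mxE [in LHS]mxE /pairing sum6 !vec6E areaE.
by move: c; apply: ord6P; cbn [nat_of_ord nth j0 j1 j2 j3 j4 j5]; lra.
Qed.

(** Derivatives along M are thereby independent of the extension of a function, without any chart of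
    M. *)
Lemma tangential_derive (f g : E -> R) U p v : area p != 0 -> open U -> U p ->
  differentiable f p -> differentiable g p ->
  (forall q, U q -> area q = area p -> f q = g q) ->
  tangent (@area R) p v -> 'D_v f p = 'D_v g p.
Proof.
move=> p0 oU Up df dg fg /tangentP tv.
have L w : (forall t : R, area (t *: w + p) = area p) -> 'D_w f p = 'D_w g p.
  exact: derive_line_eq fg.
have d2 : 2 * area p != 0 by rewrite mulf_neq0 // pnatr_eq0.
suff : 'D_((2 * area p) *: v) f p = 'D_((2 * area p) *: v) g p.
  by rewrite !deriveZv // => /(mulfI d2).
rewrite line_decomposition tv mulr0 scale0r subr0.
rewrite !deriveDv // !deriveZv //.
by do ![congr (_ + _)]; congr (_ * _); apply: L => t;
  rewrite !areaE !mxE; cbn [nat_of_ord nth j0 j1 j2 j3 j4 j5]; field.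
Qed.

Lemma Efield_smooth U j : open U -> smooth_field U (Efield j : E -> E).
Proof. by move=> oU k; apply: linear_form_smooth => //; exact: Efield_linear. Qed.

Lemma lie_bracket_Efield i j p :
  lie_bracket (Efield i) (Efield j) p = \sum_m str R i j m *: Efield m p.
Proof.
apply/rowP => k; rewrite -Efield_commutator.
rewrite (@lie_bracketE setT) //; try by apply: Efield_smooth; exact: openT.
by rewrite !(linear_form_derive _ _ (Efield_linear _ _)).
Qed.

Lemma Efield_tangent j q : tangent (@area R) q (Efield j q).
Proof. by apply/tangentP; exact: darea_Efield. Qed.

Section Level.
Variable A : R.
Hypothesis hA : A != 0.

(** Dividing by the constant [2 * A] instead of [2 * area q] keeps the forms linear; duality with
    [Efield] then holds on the level set. *)
Definition th0 (k : 'I_5) (q : E) : E := (2 * A)^-1 *: rform k q.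

Let A2 : 2 * A != 0.
Proof. by rewrite mulf_neq0 // pnatr_eq0. Qed.

Lemma th0_linear j k : linear_form (fun q => th0 j q 0 k).
Proof.
have H q : th0 j q 0 k = (2 * A)^-1 * rform j q 0 k by rewrite mxE.
by move=> a u v; rewrite !H (rform_linear j k); ring.
Qed.

Lemma th0_smooth U j : open U -> smooth_field U (th0 j).
Proof. by move=> oU k; apply: linear_form_smooth => //; exact: th0_linear. Qed.

Lemma darea_smooth U : open U -> smooth_field U (@darea R).
Proof. by move=> oU k; apply: linear_form_smooth => //; exact: darea_linear. Qed.

Lemma th0_Efield k j q : area q = A ->
  pairing (th0 k q) (Efield j q) = (k == j)%:R.
Proof.
move=> qA; rewrite /th0 pairingZl rform_Efield qA mulrCA.
by rewrite mulVf // mulr1.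
Qed.

Lemma tangent_dec q v : area q = A -> tangent (@area R) q v ->
  v = \sum_k pairing (th0 k q) v *: Efield k q.
Proof.
move=> qA /tangentP tv; have := frame_decomposition q v.
rewrite tv scale0r addr0 qA => /(congr1 ( *:%R (2 * A)^-1)).
rewrite scalerA mulVf // scale1r => {1}->; rewrite scaler_sumr.
by apply: eq_bigr => k _; rewrite scalerA /th0 pairingZl.
Qed.

Lemma derive_tangent (f : E -> R) q v : differentiable f q -> area q = A ->
  tangent (@area R) q v ->
  'D_v f q = \sum_k pairing (th0 k q) v * 'D_(Efield k q) f q.
Proof.
by move=> df qA tv; rewrite {1}(tangent_dec qA tv) derive_sumv.
Qed.

Lemma level_derive (f g : E -> R) U q v : open U -> U q -> area q = A ->
  smooth_on U f -> smooth_on U g ->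
  (forall r, U r -> area r = A -> f r = g r) ->
  tangent (@area R) q v -> 'D_v f q = 'D_v g q.
Proof.
move=> oU Uq qA sf sg fg tv; apply: (tangential_derive _ oU Uq) tv.
- by rewrite qA.
- exact: smooth_differentiable sf Uq.
- exact: smooth_differentiable sg Uq.
- by rewrite qA.
Qed.

(** The Maurer-Cartan equations of the invariant coframe. *)
Lemma ext_d_th0 k q i j : area q = A ->
  ext_d (th0 k) q (Efield i q) (Efield j q) = - str R i j k.
Proof.
move=> qA.
have oT := @openT E.
rewrite (ext_d_formula oT (th0_smooth _ oT) (Efield_smooth _ oT) (Efield_smooth _ oT)) //.
(* The pairing is constant along the level set only, so its derivative vanishes because [Efield] is
   tangent. *)
have D0 a b : 'D_(Efield a q) (fun r => pairing (th0 k r) (Efield b r)) q = 0.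
  rewrite (@level_derive _ (fun=> (k == b)%:R) setT) //.
  - exact: derive_cst.
  - by apply: smooth_pairing => //; [exact: th0_smooth|exact: Efield_smooth].
  - exact: smooth_cst.
  - by move=> r _ rA; rewrite th0_Efield.
  - exact: Efield_tangent.
rewrite !D0 subrr sub0r lie_bracket_Efield pairing_sumr; congr (- _).
rewrite -[RHS](sum_deltal k (str R i j)); apply: eq_bigr => m _.
by rewrite pairingZr th0_Efield // eq_sym mulrC.
Qed.

Lemma ext_d_bilinear U al q (a b : 'I_5 -> R) : open U -> smooth_field U al -> U q ->
  ext_d al q (\sum_i a i *: Efield i q) (\sum_j b j *: Efield j q) =
  \sum_i \sum_j a i * b j * ext_d al q (Efield i q) (Efield j q).
Proof.
move=> oU sa Uq.
have H (u : E) (c : 'I_5 -> R) :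
    pairing ('D_(\sum_i c i *: Efield i q) al q) u =
    \sum_i c i * pairing ('D_(Efield i q) al q) u.
  rewrite /pairing; under [RHS]eq_bigr => i _ do rewrite mulr_sumr.
  rewrite exchange_big /=; apply: eq_bigr => k _.
  rewrite (derive_field _ _ sa) // derive_sumv; last first.
    exact: smooth_differentiable (sa k) Uq.
  rewrite mulr_suml; apply: eq_bigr => i _.
  by rewrite (derive_field _ _ sa) // mulrA.
rewrite (ext_dE _ _ oU sa Uq) (H _ a) (H _ b).
under eq_bigr => i _ do rewrite pairing_sumr mulr_sumr.
under [X in _ - X]eq_bigr => i _ do rewrite pairing_sumr mulr_sumr.
rewrite [X in _ - X]exchange_big /= -sumrB; apply: eq_bigr => i _.
rewrite -sumrB; apply: eq_bigr => j _.
rewrite (ext_dE (Efield i q) (Efield j q) oU sa Uq) (pairingZr _ (Efield j q)).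
by rewrite (pairingZr _ (Efield i q)) mulrBr !mulrA [b j * a i]mulrC.
Qed.

(** The differential of the area is closed and annihilates X and Y along the level set, so the
    formula for the exterior derivative makes it annihilate the bracket. The same formula for
    [th0 k], with Maurer-Cartan, gives the components. *)
Lemma tangent_bracket U X Y q : open U -> U q -> area q = A ->
  smooth_field U X -> smooth_field U Y ->
  (forall r, U r -> area r = A -> tangent (@area R) r (X r)) ->
  (forall r, U r -> area r = A -> tangent (@area R) r (Y r)) ->
  tangent (@area R) q (lie_bracket X Y q) /\
  forall k, pairing (th0 k q) (lie_bracket X Y q) =
    'D_(X q) (fun r => pairing (th0 k r) (Y r)) q
    - 'D_(Y q) (fun r => pairing (th0 k r) (X r)) q
    + \sum_i \sum_j pairing (th0 i q) (X q) * pairing (th0 j q) (Y q) * str R i j k.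
Proof.
move=> oU Uq qA sX sY tX tY.
have tXq := tX q Uq qA; have tYq := tY q Uq qA.
split.
  apply/tangentP; have sd := darea_smooth oU.
  have := ext_d_formula oU sd sX sY Uq.
  have Z W v : smooth_field U W -> tangent (@area R) q v ->
      (forall r, U r -> area r = A -> tangent (@area R) r (W r)) ->
      'D_v (fun r => pairing (darea r) (W r)) q = 0.
    move=> sW tv tW; rewrite (@level_derive _ (fun=> 0) U) //.
    - exact: derive_cst.
    - exact: smooth_pairing.
    - exact: smooth_cst.
    - by move=> r Ur rA; apply/tangentP; exact: tW.
  rewrite !Z // (ext_dE _ _ oU sd Uq) subrr sub0r.
  have S u v : pairing ('D_u (@darea R) q) v = pairing (darea u) v.
    apply: eq_bigr => k _; rewrite (derive_field _ _ sd) //.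
    by rewrite (linear_form_derive _ _ (darea_linear _)).
  rewrite !S => /esym/eqP; rewrite eqr_oppLR => /eqP ->.
  by rewrite /pairing !sum6 !vec6E; cbn [nat_of_ord nth j0 j1 j2 j3 j4 j5]; lra.
move=> k; have st := th0_smooth k oU.
have := ext_d_formula oU st sX sY Uq.
have -> : ext_d (th0 k) q (X q) (Y q) = ext_d (th0 k) q
    (\sum_i pairing (th0 i q) (X q) *: Efield i q)
    (\sum_j pairing (th0 j q) (Y q) *: Efield j q).
  by rewrite -(tangent_dec qA tXq) -(tangent_dec qA tYq).
rewrite (ext_d_bilinear _ _ oU st Uq).
under eq_bigr => i _ do under eq_bigr => j _ do rewrite ext_d_th0 // mulrN.
under eq_bigr => i _ do rewrite sumrN.
rewrite sumrN => H; move: H.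
set S := \sum_i _; move: (pairing _ (lie_bracket X Y q)) => z H.
by apply/eqP; rewrite -subr_eq0 -(subrr (- S)) {2}H; apply/eqP; ring.
Qed.

End Level.
End Calculus.

(** * The growth vector (2,3,5) *)

Section Flag.
Variables (R : realType) (A : R).
Hypothesis hA : A != 0.
Local Notation E := 'rV[R]_6.
Local Notation M := (level (@area R) A).
Local Notation th0 := (th0 A).
Implicit Types (p q u v : E) (X Y : E -> E) (U : set E).

Lemma Zfield_comb q (u : 'I_3 -> R) : \sum_i u i = 0 ->
  \sum_i u i *: Zfield i q =
  ((u o0 - u o1) / 2) *: Efield i4 q + ((u o0 + u o1) / 2) *: Efield i5 q.
Proof.
rewrite !sum3 => u0; have -> : u o2 = - (u o0 + u o1).
  by apply/eqP; rewrite -addr_eq0 addrC u0.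
have [-> -> ->] := ZfieldE q; apply/rowP => c; rewrite !mxE.
by move: c; apply: ord6P;
  cbn [odd half negb uphalf nat_of_ord j0 j1 j2 j3 j4 j5 i4 i5 nmat nth]; lra.
Qed.

Lemma DdistP q v :
  Ddist q v <-> exists s z, v = s *: Efield i4 q + z *: Efield i5 q.
Proof.
split=> [[u [u0 ->]]|[s [z ->]]]; first by do 2 eexists; exact: Zfield_comb.
pose w (i : 'I_3) := nth 0 [:: s + z; z - s; - (2 * z)] i.
have w0 : \sum_i w i = 0 by rewrite sum3 /w /=; ring.
exists w; split=> //; rewrite (Zfield_comb _ w0) /w /=.
by congr (_ *: _ + _ *: _); field.
Qed.

(** One filtration for the whole growth vector: at points of M, the indices 3, 2 and 0 give D, its
    first derived distribution and the tangent space. *)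
Definition flag (m : nat) (q : E) : set E := [set v |
  tangent (@area R) q v /\ forall k : 'I_5, (k < m)%N -> pairing (th0 k q) v = 0].

Lemma flag0 q : flag 0 q = tangent (@area R) q.
Proof. by apply/seteqP; split=> [v []//|v tv]; split. Qed.

Lemma flagD m q u v : flag m q u -> flag m q v -> flag m q (u + v).
Proof.
move=> [/tangentP tu hu] [/tangentP tv hv]; split.
  by apply/tangentP; rewrite pairingDr tu tv addr0.
by move=> k km; rewrite pairingDr hu // hv // addr0.
Qed.

Lemma flagZ m q (a : R) v : flag m q v -> flag m q (a *: v).
Proof.
move=> [/tangentP tv hv]; split.
  by apply/tangentP; rewrite pairingZr tv mulr0.
by move=> k km; rewrite pairingZr hv // mulr0.
Qed.

Lemma flag_0 m q : flag m q 0.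
Proof.
have p0 (w : E) : pairing w 0 = 0.
  by have := pairingZr w 0 0; rewrite scale0r mul0r.
by split=> [|k _]; [apply/tangentP|].
Qed.

Lemma flag_sum m q (I : Type) (r : seq I) (F : I -> E) :
  (forall i, flag m q (F i)) -> flag m q (\sum_(i <- r) F i).
Proof.
move=> HF; apply: (big_ind (flag m q)) => // [|u v]; first exact: flag_0.
exact: flagD.
Qed.

Lemma flag_Efield m q (k : 'I_5) : M q -> (m <= k)%N -> flag m q (Efield k q).
Proof.
move=> qA mk; split=> [|l lm]; first exact: Efield_tangent.
rewrite (th0_Efield hA) //; case: eqP => // lk.
by move: lm; rewrite lk ltnNge mk.
Qed.

Lemma flag_le m m' q v : (m' <= m)%N -> flag m q v -> flag m' q v.
Proof. by move=> mm [tv hv]; split=> // k km; apply: hv; exact: leq_trans mm. Qed.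

Lemma flag_rank m q : (m <= 5)%N -> M q -> has_rank (flag m q) (5 - m).
Proof.
move=> m5 qA; pose f (i : 'I_(5 - m)) : 'I_5 := inord (m + i).
have fE i : f i = (m + i)%N :> nat.
  by rewrite inordK //; have := ltn_ord i; rewrite ltn_subRL.
pose Bm : 'M[R]_(5 - m, 6) := \matrix_i Efield (f i) q.
exists Bm; split.
  apply/row_freeP; exists (\matrix_(a, i) th0 (f i) q 0 a).
  apply/matrixP => i j; rewrite !mxE.
  transitivity (pairing (th0 (f j) q) (Efield (f i) q)).
    by rewrite /pairing; apply: eq_bigr => a _; rewrite [in RHS]mulrC !(mxE _ _ a) /= mxE.
  rewrite (th0_Efield hA) //; congr (_%:R); congr nat_of_bool.
  rewrite -!val_eqE /= !fE eqn_add2l eq_sym //.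
apply/seteqP; split=> v /=.
  move=> [tv hv]; rewrite (tangent_dec hA qA tv); apply: summx_sub => k _.
  have [km|mk] := ltnP k m; first by rewrite hv // scale0r sub0mx.
  apply: scalemx_sub.
  have ik : (k - m < 5 - m)%N by rewrite ltn_sub2r // (leq_ltn_trans mk).
  have -> : Efield k q = row (Ordinal ik) Bm.
    rewrite rowK; congr Efield; apply: val_inj.
    by rewrite /= fE /= subnKC.
  exact: row_sub.
move=> /submxP [w ->]; rewrite mulmx_sum_row; apply: flag_sum => i.
by rewrite rowK; apply: flagZ; apply: flag_Efield => //; rewrite fE leq_addr.
Qed.

Lemma Ddist_flag q : M q -> Ddist q = flag 3 q.
Proof.
move=> qA; apply/seteqP; split=> v.
  move=> /DdistP [s [z ->]]; apply: flagD; apply: flagZ; exact: flag_Efield.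
move=> [tv hv]; apply/DdistP; exists (pairing (th0 i4 q) v), (pairing (th0 i5 q) v).
have := tangent_dec hA qA tv.
by rewrite sum5 (hv i1 isT) (hv i2 isT) (hv i3 isT) !scale0r !add0r.
Qed.

(** The derivative terms of [tangent_bracket] vanish, as [th0 k] is zero on both fields along M;
    only structure constants of the fields spanning the flag remain. *)
Lemma flag_bracket m U X Y q (k : 'I_5) : open U -> U q -> M q ->
  smooth_field U X -> smooth_field U Y ->
  (forall r, U r -> M r -> flag m r (X r)) ->
  (forall r, U r -> M r -> flag m r (Y r)) ->
  tangent (@area R) q (lie_bracket X Y q) /\
  ((k < m)%N ->
   (forall i j : 'I_5, (m <= i)%N -> (m <= j)%N -> str R i j k = 0) ->
   pairing (th0 k q) (lie_bracket X Y q) = 0).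
Proof.
move=> oU Uq qA sX sY fX fY.
have [|| tb hb] := tangent_bracket hA oU Uq qA sX sY.
- by move=> r Ur rA; have [] := fX r Ur rA.
- by move=> r Ur rA; have [] := fY r Ur rA.
split=> // km s0; rewrite hb.
have Z W v : smooth_field U W -> (forall r, U r -> M r -> flag m r (W r)) ->
    tangent (@area R) q v ->
    'D_v (fun r => pairing (th0 k r) (W r)) q = 0.
  move=> sW fW tv; rewrite (@level_derive _ A hA _ (fun=> 0) U) //.
  - exact: derive_cst.
  - by apply: smooth_pairing => //; exact: th0_smooth.
  - exact: smooth_cst.
  - by move=> r Ur rA; have [_ ->] := fW r Ur rA.
have [tX hX] := fX q Uq qA; have [tY hY] := fY q Uq qA.
rewrite !Z // subrr add0r big1 // => i _; rewrite big1 // => j _.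
have [im|mi] := ltnP i m; first by rewrite hX // !mul0r.
have [jm|mj] := ltnP j m; first by rewrite hY // mulr0 mul0r.
by rewrite s0 // mulr0.
Qed.

Lemma EfieldZ j (a : R) u : Efield j (a *: u) = a *: Efield j u.
Proof.
apply/rowP => k; have := @Efield_linear R j k a u 0; rewrite addr0 => ->.
have E0 : Efield j 0 0 k = 0 :> R.
  by rewrite !mxE !mulr0 !addr0; case: ifP.
by rewrite E0 addr0 [RHS]mxE.
Qed.

Lemma lie_bracket_scaled i j (a : R) p :
  lie_bracket (fun q => a *: Efield i q) (Efield j) p =
  a *: \sum_m str R i j m *: Efield m p.
Proof.
have oT := @openT E.
have L k : linear_form (fun q : E => (a *: Efield i q) 0 k).
  have H q : (a *: Efield i q) 0 k = a * Efield i q 0 k by rewrite mxE.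
  by move=> b u v; rewrite !H (Efield_linear i k); ring.
apply/rowP => k; rewrite (@lie_bracketE _ setT) //; last 2 first.
- by move=> l; apply: linear_form_smooth => //; exact: L.
- exact: Efield_smooth.
rewrite (linear_form_derive _ _ (L k)) (linear_form_derive _ _ (Efield_linear j k)).
by rewrite [RHS]mxE -Efield_commutator EfieldZ !mxE mulrBr.
Qed.

Lemma smooth_scaled i (a : R) : smooth_field setT (fun q : E => a *: Efield i q).
Proof.
have oT := @openT E.
move=> k; apply: (smooth_eq oT (f := fun q => a * Efield i q 0 k)).
  by move=> q _; rewrite [RHS]mxE.
by apply: smoothM => //; [exact: smooth_cst|exact: Efield_smooth].
Qed.

Lemma section_scaled D m (i : 'I_5) (a : R) : (m <= i)%N ->
  (forall q, M q -> D q = flag m q) ->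
  is_section M D setT (fun q : E => a *: Efield i q).
Proof.
move=> mi HD; split; first exact: smooth_scaled.
by move=> q _ qA; rewrite HD //; apply: flagZ; exact: flag_Efield.
Qed.

Lemma section_Efield D m (i : 'I_5) : (m <= i)%N ->
  (forall q, M q -> D q = flag m q) -> is_section M D setT (Efield i : E -> E).
Proof.
move=> mi HD; split; first by apply: Efield_smooth; exact: openT.
by move=> q _ qA; rewrite HD //; exact: flag_Efield.
Qed.

Lemma derived_flag3 p : M p -> derived M (@Ddist R) p = flag 2 p.
Proof.
move=> pA; apply/seteqP; split=> v.
  move=> [U [n [X [Y [w [[oU Up] HXY Dw ->]]]]]].
  apply: flagD; first by apply: (@flag_le 3) => //; rewrite -Ddist_flag.
  apply: flag_sum => i; have [[sX fX] [sY fY]] := HXY i.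
  have fX' r : U r -> M r -> flag 3 r (X i r).
    by move=> Ur rA; rewrite -Ddist_flag //; exact: fX.
  have fY' r : U r -> M r -> flag 3 r (Y i r).
    by move=> Ur rA; rewrite -Ddist_flag //; exact: fY.
  split; first by have [] := flag_bracket i1 oU Up pA sX sY fX' fY'.
  move=> k k2; have [_ ->] // := flag_bracket k oU Up pA sX sY fX' fY'.
    exact: leq_trans k2 _.
  by move: k k2; apply: ord5P => // _; do 2 apply: ord5P => //.
(* The sign comes from [E_4, E_5] = - E_3. *)
move=> [tv hv]; exists setT, 1%N, (fun=> (fun q => - pairing (th0 i3 p) v *: Efield i4 q)),
  (fun=> Efield i5), (pairing (th0 i4 p) v *: Efield i4 p + pairing (th0 i5 p) v *: Efield i5 p).
split.
- by split=> //; exact: openT.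
- move=> _; split; first by apply: (section_scaled (m := 3)) => // q; exact: Ddist_flag.
  by apply: (section_Efield (m := 3)) => // q; exact: Ddist_flag.
- by apply/DdistP; do 2 eexists.
rewrite big_ord_recl big_ord0 addr0 lie_bracket_scaled.
have := tangent_dec hA pA tv; rewrite !sum5 (hv i1 isT) (hv i2 isT) => {1}->.
cbn [str nth nat_of_ord i1 i2 i3 i4 i5].
by apply/rowP => c; rewrite ![in LHS]mxE ![in RHS](mxE _ _ 0 c); lra.
Qed.

Lemma derived_flag2 p : M p -> derived M (derived M (@Ddist R)) p = flag 0 p.
Proof.
move=> pA; apply/seteqP; split=> v.
  move=> [U [n [X [Y [w [[oU Up] HXY Dw ->]]]]]].
  apply: flagD; first by move: Dw; rewrite (derived_flag3 pA); exact: flag_le.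
  apply: flag_sum => i; have [[sX fX] [sY fY]] := HXY i.
  have fX' r : U r -> M r -> flag 2 r (X i r).
    by move=> Ur rA; have := fX r Ur rA; rewrite (derived_flag3 rA).
  have fY' r : U r -> M r -> flag 2 r (Y i r).
    by move=> Ur rA; have := fY r Ur rA; rewrite (derived_flag3 rA).
  by split=> //; have [] := flag_bracket i1 oU Up pA sX sY fX' fY'.
move=> [tv _].
pose w k := pairing (th0 k p) v.
(* [E_3, E_4] = - E_1 + 11/5 E_5 and [E_3, E_5] = - E_2 - 33/5 E_4; the last witness compensates the
   components along E_4 and E_5. *)
exists setT, 2%N,
  (fun i : 'I_2 => (fun q => (if i == ord0 then - w i1 else - w i2) *: Efield i3 q)),
  (fun i : 'I_2 => if i == ord0 then Efield i4 else Efield i5),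
  (w i3 *: Efield i3 p + (w i4 - 33 / 5 * w i2) *: Efield i4 p
   + (w i5 + 11 / 5 * w i1) *: Efield i5 p).
split.
- by split=> //; exact: openT.
- move=> i; split.
    by apply: (section_scaled (m := 2)) => // q; exact: derived_flag3.
  by case: ifP => _; apply: (section_Efield (m := 2)) => // q; exact: derived_flag3.
- rewrite (derived_flag3 pA); apply: flagD; first apply: flagD;
    by apply: flagZ; exact: flag_Efield.
rewrite big_ord_recl big_ord1 eqxx (_ : (lift ord0 ord0 == ord0) = false) //.
rewrite (lie_bracket_scaled i3 i4) (lie_bracket_scaled i3 i5).
have := tangent_dec hA pA tv; rewrite !sum5 => {1}->.
rewrite -/(w i1) -/(w i2) -/(w i3) -/(w i4) -/(w i5).
cbn [str nth nat_of_ord i1 i2 i3 i4 i5].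
by apply/rowP => c; rewrite ![in LHS](mxE _ _ 0 c) ![in RHS](mxE _ _ 0 c); lra.
Qed.

Lemma area_235 : is_235_distribution (@area R) A (@Ddist R).
Proof.
move=> p pA; split.
- split; first by rewrite -flag0; exact: (@flag_rank 0).
  by rewrite Ddist_flag // => v [].
- move=> v /DdistP [s [z Ev]]; have oT := @openT E.
  exists setT, (fun q => s *: Efield i4 q + z *: Efield i5 q); split=> //.
  split; last by move=> q _ qA; apply/DdistP; do 2 eexists.
  move=> k; apply: (smooth_eq oT (f := fun q => (s *: Efield i4 q) 0 k + (z *: Efield i5 q) 0 k)).
    by move=> q _; rewrite [RHS]mxE.
  by apply: smoothD => //; exact: smooth_scaled.
- by rewrite Ddist_flag //; exact: (@flag_rank 3).
- by rewrite (derived_flag3 pA); exact: (@flag_rank 2).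
- by rewrite (derived_flag2 pA); exact: (@flag_rank 0).
Qed.

End Flag.

(** * The invariant coframe satisfies Cartan's equations *)

Section Reference.
Variables (R : realType) (A : R).
Hypothesis hA : A != 0.
Local Notation E := 'rV[R]_6.
Local Notation M := (level (@area R) A).
Local Notation th0 := (th0 A).

Definition th0_comb (a b c d e : R) (q : E) : E :=
  a *: th0 i1 q + b *: th0 i2 q + c *: th0 i3 q + d *: th0 i4 q + e *: th0 i5 q.

Lemma th0_comb_smooth a b c d e : smooth_field setT (th0_comb a b c d e).
Proof.
have oT := @openT E.
have S (x : R) k i : smooth_on setT (fun q => x * th0 k q 0 i).
  by apply: smoothM => //; [exact: smooth_cst|exact: th0_smooth].
move=> i; apply: (smooth_eq oT (f := fun q => a * th0 i1 q 0 i + b * th0 i2 q 0 i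
  + c * th0 i3 q 0 i + d * th0 i4 q 0 i + e * th0 i5 q 0 i)).
  have H (x : R) k q : (x *: th0 k q) 0 i = x * th0 k q 0 i by rewrite mxE.
  have HD (u v : E) : (u + v) 0 i = u 0 i + v 0 i by rewrite mxE.
  by move=> q _; rewrite /th0_comb !HD !H.
by do 4 (apply: smoothD => //).
Qed.

Lemma pairing_th0_comb a b c d e q v : pairing (th0_comb a b c d e q) v =
  a * pairing (th0 i1 q) v + b * pairing (th0 i2 q) v + c * pairing (th0 i3 q) v
  + d * pairing (th0 i4 q) v + e * pairing (th0 i5 q) v.
Proof. by rewrite /th0_comb !pairingDl !pairingZl. Qed.

Lemma reference_coframe :
  adapted_coframe (@area R) A (@Ddist R) setT th0 (@Efield R).
Proof.
have oT := @openT E.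
split; first by move=> i; split; [exact: th0_smooth|exact: Efield_smooth].
(* On E_4 and E_5 the first four forms take the values forced in the proof of [nilpotent_grade2],
   with x = y = 0. *)
exists (th0_comb 0 (27 / 5) 0 (- 1) 0), (th0_comb (27 / 5) 0 (3 / 5) 0 3),
  (th0_comb (9 / 5) 0 (- (1 / 5)) 0 1), (th0_comb 0 (- (27 / 5)) 0 1 0),
  (th0_comb 0 (243 / 50) 0 (9 / 5) 0), (th0_comb (- (243 / 50)) 0 0 0 (27 / 5)),
  (th0_comb 0 0 (81 / 5) 0 0).
split; first by split; split; exact: th0_comb_smooth.
move=> q _ qA; split.
- by move=> i; exact: Efield_tangent.
- by move=> i j; exact: th0_Efield.
- rewrite (Ddist_flag hA qA); apply/seteqP; split=> v [tv hv]; split=> //.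
    by split; exact: hv.
  by have [h1 h2 h3] := hv; apply: ord5P.
move=> u v tu tv.
have X k : ext_d (th0 k) q u v = - \sum_i \sum_j
    pairing (th0 i q) u * pairing (th0 j q) v * str R i j k.
  transitivity (ext_d (th0 k) q (\sum_i pairing (th0 i q) u *: Efield i q)
    (\sum_j pairing (th0 j q) v *: Efield j q)).
    by rewrite -(tangent_dec hA qA tu) -(tangent_dec hA qA tv).
  rewrite (ext_d_bilinear _ _ oT (th0_smooth _ _ oT)) // -sumrN.
  apply: eq_bigr => i _; rewrite -sumrN; apply: eq_bigr => j _.
  by rewrite (ext_d_th0 hA) // mulrN.
set P1 := th0_comb 0 (27 / 5) 0 (- 1) 0; set P4 := th0_comb 0 (- (27 / 5)) 0 1 0.
have D1 w : pairing (2 *: P1 q + P4 q) w = 2 * pairing (P1 q) w + pairing (P4 q) w.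
  by rewrite (pairingDl _ (P4 q)) (pairingZl (P1 q)).
have D2 w : pairing (P1 q + 2 *: P4 q) w = pairing (P1 q) w + 2 * pairing (P4 q) w.
  by rewrite (pairingDl (P1 q)) (pairingZl (P4 q)).
have D3 w : pairing (P1 q + P4 q) w = pairing (P1 q) w + pairing (P4 q) w.
  by rewrite (pairingDl (P1 q)).
rewrite /structure_equations /wedge !X !(D1, D2, D3) !pairing_th0_comb.
pose pu i := pairing (th0 i q) u; pose pv i := pairing (th0 i q) v.
rewrite -/(pu i1) -/(pu i2) -/(pu i3) -/(pu i4) -/(pu i5).
rewrite -/(pv i1) -/(pv i2) -/(pv i3) -/(pv i4) -/(pv i5).
have S k : \sum_i \sum_j pairing (th0 i q) u * pairing (th0 j q) v * str R i j k =
    \sum_i \sum_j pu i * pv j * str R i j k by [].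
rewrite !S; clearbody pu pv; clear; rewrite !sum5.
split; cbn [str nth nat_of_ord i1 i2 i3 i4 i5].
- by field.
- by field.
- by field.
- by field.
- by field.
Qed.

End Reference.

(** * Functions on a level set *)

Record open_set (R : realType) := OpenSet {
  oset : set 'rV[R]_6; oset_open : open oset }.
Arguments oset_open {R} o : rename.

Section LevelRing.
Variables (R : realType) (A : R) (U : open_set R).
Local Notation E := 'rV[R]_6.
Local Notation W := (oset U).

Definition pts := {q : E | W q /\ area q = A}.

Definition extends_smoothly : {pred (pts -> R)} := fun f =>
  `[< exists F : E -> R, smooth_on W F /\ forall x : pts, f x = F (sval x) >].

Lemma extends_smoothly_subring : subring_closed extends_smoothly.
Proof.
have oU := oset_open U; split.
- apply/asboolP; exists (fun=> 1); split=> //; exact: smooth_cst.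
- move=> f g /asboolP [F [sF fF]] /asboolP [G [sG gG]]; apply/asboolP.
  exists (fun q => F q - G q); split; first exact: smoothB.
  by move=> x; rewrite -fF -gG.
- move=> f g /asboolP [F [sF fF]] /asboolP [G [sG gG]]; apply/asboolP.
  exists (fun q => F q * G q); split; first exact: smoothM.
  by move=> x; rewrite -fF -gG.
Qed.

HB.instance Definition _ :=
  GRing.isSubringClosed.Build (pts -> R) extends_smoothly extends_smoothly_subring.

(** Elements are functions on the points of M in U, so equality of elements is equality on M. U may
    miss M, whence a commutative ring in which 1 = 0 is allowed. *)
Record level_fun := LevelFun {
  level_fun_val : pts -> R; _ : level_fun_val \in extends_smoothly }.

HB.instance Definition _ := [isSub for level_fun_val].
HB.instance Definition _ := [Choice of level_fun by <:].
HB.instance Definition _ :=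
  GRing.SubChoice_isSubComPzRing.Build _ _ level_fun (subringClosedP _).

Lemma restr_subproof (F : E -> R) : smooth_on W F ->
  (fun x : pts => F (sval x)) \in extends_smoothly.
Proof. by move=> sF; apply/asboolP; exists F. Qed.

Definition restr (F : E -> R) (sF : smooth_on W F) : level_fun :=
  LevelFun (restr_subproof sF).

Definition evl (x : pts) (b : level_fun) : R := val b x.

Lemma evl_inj (b c : level_fun) : (forall x, evl x b = evl x c) -> b = c.
Proof. by move=> bc; apply: val_inj; apply/funext. Qed.

Lemma lift_ex (b : level_fun) :
  exists F : E -> R, smooth_on W F /\ forall x : pts, evl x b = F (sval x).
Proof. by case: b => f fP; have /asboolP := fP. Qed.

(** An arbitrary choice of extension; [evl_derl] shows that derivatives along [Efield] do not depend
    on it. *)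
Definition lft b := sval (cid (lift_ex b)).

Lemma lft_smooth b : smooth_on W (lft b).
Proof. by rewrite /lft; case: cid => F []. Qed.

Lemma evl_lft x b : evl x b = lft b (sval x).
Proof. by rewrite /lft; case: cid => F []. Qed.

Lemma evl_restr x F (sF : smooth_on W F) : evl x (restr sF) = F (sval x).
Proof. by []. Qed.

Lemma evl_is_zmod_morphism x : zmod_morphism (evl x).
Proof. by move=> b c; rewrite /evl rmorphB. Qed.

Lemma evl_is_monoid_morphism x : monoid_morphism (evl x).
Proof. by split=> [|b c]; rewrite /evl ?rmorph1 ?rmorphM. Qed.

HB.instance Definition _ x :=
  GRing.isZmodMorphism.Build level_fun R (evl x) (evl_is_zmod_morphism x).
HB.instance Definition _ x :=
  GRing.isMonoidMorphism.Build level_fun R (evl x) (evl_is_monoid_morphism x).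

Definition cstl (r : R) : level_fun := restr (smooth_cst r (oset_open U)).

Lemma evl_cstl x r : evl x (cstl r) = r. Proof. by []. Qed.

Lemma cstl_is_zmod_morphism : zmod_morphism cstl.
Proof. by move=> a b; apply: evl_inj => x; rewrite rmorphB !evl_cstl. Qed.

Lemma cstl_is_monoid_morphism : monoid_morphism cstl.
Proof.
by split=> [|a b]; apply: evl_inj => x; rewrite ?rmorph1 ?rmorphM !evl_cstl.
Qed.

HB.instance Definition _ :=
  GRing.isZmodMorphism.Build R level_fun cstl cstl_is_zmod_morphism.
HB.instance Definition _ :=
  GRing.isMonoidMorphism.Build R level_fun cstl cstl_is_monoid_morphism.

Definition derl (j : 'I_5) (b : level_fun) : level_fun :=
  restr (smooth_derive (oset_open U) (lft_smooth b)
    (Efield_smooth j (oset_open U))).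

Hypothesis hA : A != 0.

Lemma evl_derl x j b (F : E -> R) : smooth_on W F ->
  (forall y : pts, evl y b = F (sval y)) ->
  evl x (derl j b) = 'D_(Efield j (sval x)) F (sval x).
Proof.
move=> sF bF; rewrite evl_restr; have [Ux xA] := svalP x.
apply: (level_derive hA (oset_open U)) => //.
- exact: lft_smooth.
- by move=> r Ur rA; rewrite -(evl_lft (exist _ r (conj Ur rA))) bF.
- exact: Efield_tangent.
Qed.

(** By Schwarz the 1-form dF is closed; the formula for its exterior derivative on two fields is
    then the commutator identity. *)
Lemma commutator_Efield (F : E -> R) i j q : smooth_on W F -> W q ->
  'D_(Efield i q) (fun r => 'D_(Efield j r) F r) q
  - 'D_(Efield j q) (fun r => 'D_(Efield i r) F r) q =
  \sum_k str R i j k * 'D_(Efield k q) F q.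
Proof.
move=> sF Uq; have oU := oset_open U.
have dF r : W r -> differentiable F r by exact: smooth_differentiable.
pose grad r : E := \row_a 'D_(delta_mx 0 a) F r.
have gE r v : W r -> 'D_v F r = pairing (grad r) v.
  move=> Ur; rewrite derive_partials; last exact: dF.
  by apply: eq_bigr => a _; rewrite mxE mulrC.
have sg : smooth_field W grad.
  move=> a; apply: (smooth_eq oU (f := fun r => 'D_(delta_mx 0 a) F r)).
    by move=> r _; rewrite mxE.
  exact: smooth_partial.
have N (f g : E -> R) v : (forall r, W r -> f r = g r) -> 'D_v f q = 'D_v g q.
  move=> fg; apply: near_eq_derive; near=> r; apply: fg; near: r.
  exact: open_nbhs_nbhs.
rewrite (N _ (fun r => pairing (grad r) (Efield j r))); last by move=> r; exact: gE.
rewrite (N (fun r => 'D_(Efield i r) F r) (fun r => pairing (grad r) (Efield i r)));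
  last by move=> r; exact: gE.
have := ext_d_formula oU sg (Efield_smooth i oU) (Efield_smooth j oU) Uq.
have -> : ext_d grad q (Efield i q) (Efield j q) = 0.
  rewrite /ext_d; apply/eqP; rewrite subr_eq0; apply/eqP.
  rewrite -(N (fun r => 'D_(Efield j q) F r)
    (fun r => pairing (grad r) (Efield j q))); last by move=> r; exact: gE.
  rewrite -(N (fun r => 'D_(Efield i q) F r)
    (fun r => pairing (grad r) (Efield i q))); last by move=> r; exact: gE.
  have sD v : smooth_on W (fun r => 'D_v F r).
    exact: smooth_derive (smooth_cst_field v oU).
  by apply: (schwarz oU Uq dF); exact: smooth_differentiable (sD _) Uq.
rewrite lie_bracket_Efield pairing_sumr => /esym/eqP; rewrite subr_eq0 => /eqP ->.
by apply: eq_bigr => k _; rewrite pairingZr gE.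
Unshelve. all: by end_near. Qed.

Lemma derl_derivations : derivations derl (fun i j k => cstl (str R i j k)).
Proof.
have oU := oset_open U; split=> [i b c|i b c|i j b|i j k].
- have sb := lft_smooth b; have sc := lft_smooth c.
  apply: evl_inj => x; have [Ux xA] := svalP x.
  rewrite rmorphD /= (@evl_derl x i _ _ (smoothD oU sb sc)); last first.
    by move=> y; rewrite rmorphD /= !evl_lft.
  rewrite !evl_restr [LHS]deriveD //; apply: diff_derivable.
    exact: smooth_differentiable sb Ux.
  exact: smooth_differentiable sc Ux.
- have sb := lft_smooth b; have sc := lft_smooth c.
  apply: evl_inj => x; have [Ux xA] := svalP x.
  rewrite rmorphD !rmorphM /= (@evl_derl x i _ _ (smoothM oU sb sc)); last first.
    by move=> y; rewrite rmorphM /= !evl_lft.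
  rewrite !evl_restr [LHS]deriveM.
  + by rewrite !evl_lft addrC; congr (_ + _); rewrite [LHS]mulrC.
  + by apply: diff_derivable; exact: smooth_differentiable sb Ux.
  + by apply: diff_derivable; exact: smooth_differentiable sc Ux.
- apply: evl_inj => x; have [Ux xA] := svalP x.
  have D m l : evl x (derl m (derl l b)) = 'D_(Efield m (sval x))
      (fun r => 'D_(Efield l r) (lft b) r) (sval x).
    apply: evl_derl => //.
    exact: smooth_derive (lft_smooth b) (Efield_smooth l oU).
  rewrite rmorphB /= !D.
  rewrite commutator_Efield //; last exact: lft_smooth.
  by rewrite rmorph_sum; apply: eq_bigr => k _; rewrite rmorphM.
- by rewrite str_skew rmorphN.
Qed.

Lemma derl_cstl i r : derl i (cstl r) = 0.
Proof.
apply: evl_inj => x; rewrite rmorph0 (@evl_derl x i _ _ (smooth_cst r (oset_open U))) //.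
exact: derive_cst.
Qed.

End LevelRing.

(** * Independence of the coframe *)

Section Weyl.
Variable R : realType.
Variables (th e : 'I_5 -> 'rV[R]_6 -> 'rV[R]_6) (q : 'rV[R]_6).

(* The plane spanned by [s e_4 + z e_5] and [s e_1 + z e_2] is totally null. *)
Lemma weyl_null_plane (s z : R) :
  let a : 'rV[R]_5 := s *: delta_mx 0 i4 + z *: delta_mx 0 i5 in
  let b : 'rV[R]_5 := s *: delta_mx 0 i1 + z *: delta_mx 0 i2 in
  weyl_form th e q a b b a =
  \sum_i \sum_j \sum_k \sum_l riemann th e i j k l q * a 0 i * b 0 j * b 0 k * a 0 l.
Proof.
move=> a b.
have aE : [/\ a 0 i1 = 0, a 0 i2 = 0, a 0 i3 = 0, a 0 i4 = s & a 0 i5 = z].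
  by rewrite !mxE /=; split; ring.
have bE : [/\ b 0 i1 = s, b 0 i2 = z, b 0 i3 = 0, b 0 i4 = 0 & b 0 i5 = 0].
  by rewrite !mxE /=; split; ring.
have [a1 a2 a3 a4 a5] := aE; have [b1 b2 b3 b4 b5] := bE.
have H (F : 'I_5 -> 'I_5 -> 'I_5 -> 'I_5 -> R) :
    \sum_i \sum_j \sum_k \sum_l F i j k l * a 0 i * b 0 j * b 0 k * a 0 l =
    \sum_(i <- [:: (i4, s); (i5, z)]) \sum_(j <- [:: (i1, s); (i2, z)])
    \sum_(k <- [:: (i1, s); (i2, z)]) \sum_(l <- [:: (i4, s); (i5, z)])
      F i.1 j.1 k.1 l.1 * i.2 * j.2 * k.2 * l.2.
  pose f i j k l := F i j k l * a 0 i * b 0 j * b 0 k * a 0 l.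
  pose K i j k := F i j k i4 * s + F i j k i5 * z.
  pose L i j := K i j i1 * s + K i j i2 * z.
  have Hl i j k : \sum_l f i j k l = K i j k * a 0 i * b 0 j * b 0 k.
    by rewrite sum5 /f a1 a2 a3 a4 a5 /K; ring.
  have Hk i j : \sum_k \sum_l f i j k l = L i j * a 0 i * b 0 j.
    by rewrite sum5 !Hl b1 b2 b3 b4 b5 /L; ring.
  have Hj i : \sum_j \sum_k \sum_l f i j k l = (L i i1 * s + L i i2 * z) * a 0 i.
    by rewrite sum5 !Hk b1 b2 b3 b4 b5; ring.
  rewrite -/(f _ _ _ _) sum5 !Hj a1 a2 a3 a4 a5 /L /K.
  by rewrite !(big_cons, big_nil) /=; ring.
rewrite /weyl_form (H (fun i j k l => weyl th e i j k l q)).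
rewrite (H (fun i j k l => riemann th e i j k l q)).
rewrite !(big_cons, big_nil) /=.
(* The Gram entries g_15 = 1 and g_24 = - 1 survive in single terms; they cancel in the sum because
   a and b are orthogonal. *)
rewrite /weyl !gramE; cbn [nth nat_of_ord i1 i2 i3 i4 i5].
move: (riemann th e) (ricci th e) (scalar_curvature th e q) => Rm Rc Sc.
ring.
Qed.

End Weyl.

(** * Transfer of an arbitrary adapted coframe to the ring of functions *)

Section Independence.
Variables (R : realType) (A : R).
Hypothesis hA : A != 0.
Local Notation E := 'rV[R]_6.
Local Notation M := (level (@area R) A).
Local Notation th0 := (th0 A).
Variables (U : set E) (th e : 'I_5 -> E -> E).
Hypotheses (oU : open U) (HC : adapted_coframe (@area R) A (@Ddist R) U th e).

Let W := OpenSet oU.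
Local Notation B := (level_fun A W).
Local Notation pt := (pts A W).
Local Notation kR := (@cstl R A W).
Local Notation D := (@derl R A W).

Let sth i : smooth_field U (th i). Proof. by have [H _] := HC; have [] := H i. Qed.
Let se i : smooth_field U (e i). Proof. by have [H _] := HC; have [] := H i. Qed.

Lemma cof_tangent q i : U q -> M q -> tangent (@area R) q (e i q).
Proof.
by move=> Uq qA; have [_ [? [? [? [? [? [? [? [_ /(_ q Uq qA) []]]]]]]]]] := HC.
Qed.

Lemma cof_dual q i j : U q -> M q -> pairing (th i q) (e j q) = (i == j)%:R.
Proof.
by move=> Uq qA; have [_ [? [? [? [? [? [? [? [_ /(_ q Uq qA) []]]]]]]]]] := HC.
Qed.

Lemma cof_D q v : U q -> M q -> Ddist q v ->
  [/\ pairing (th i1 q) v = 0, pairing (th i2 q) v = 0 & pairing (th i3 q) v = 0].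
Proof.
move=> Uq qA; have [_ [? [? [? [? [? [? [? [_ /(_ q Uq qA) [_ _ HD _]]]]]]]]]] := HC.
by rewrite HD => -[].
Qed.

Lemma cof_pairing (al v q : E) : M q -> tangent (@area R) q v ->
  pairing al v = \sum_m pairing (th0 m q) v * pairing al (Efield m q).
Proof.
move=> qA tv; rewrite {1}(tangent_dec hA qA tv) pairing_sumr.
by apply: eq_bigr => m _; rewrite pairingZr.
Qed.

Definition Pl : 'M[B]_5 := \matrix_(i, j)
  restr A (smooth_pairing oU (th0_smooth A j oU) (se i) : smooth_on (oset W) _).
Definition Tl : 'M[B]_5 := \matrix_(m, k)
  restr A (smooth_pairing oU (sth k) (Efield_smooth m oU) : smooth_on (oset W) _).

Lemma evl_Pl (x : pt) i j : evl x (Pl i j) = pairing (th0 j (sval x)) (e i (sval x)).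
Proof. by rewrite mxE. Qed.

Lemma evl_Tl (x : pt) m k : evl x (Tl m k) = pairing (th k (sval x)) (Efield m (sval x)).
Proof. by rewrite mxE. Qed.

Lemma PlTl : Pl *m Tl = 1%:M.
Proof.
apply/matrixP => i k; apply: evl_inj => x; have [Ux xA] := svalP x.
rewrite [in LHS]mxE rmorph_sum [in RHS]mxE rmorph_nat eq_sym -(cof_dual _ _ Ux xA).
rewrite (cof_pairing _ xA (cof_tangent _ Ux xA)); apply: eq_bigr => m _.
by rewrite rmorphM /= evl_Pl evl_Tl.
Qed.

Lemma evl_act (x : pt) i (b : B) (F : E -> R) : smooth_on U F ->
  (forall y : pt, evl y b = F (sval y)) ->
  evl x (dact D (mframe Pl i) b) = 'D_(e i (sval x)) F (sval x).
Proof.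
move=> sF bF; have [Ux xA] := svalP x.
rewrite (derive_tangent hA _ xA (cof_tangent _ Ux xA)); last first.
  exact: smooth_differentiable sF Ux.
rewrite /dact rmorph_sum; apply: eq_bigr => j _.
by rewrite rmorphM /= (evl_derl hA x j sF bF) [mframe Pl i 0 j]mxE evl_Pl.
Qed.

Local Notation strB := (fun i j k => kR (str R i j k)).
Local Notation fC := (fcoef (dbrk D strB) (mframe Pl) (mcof Tl)).

Lemma evl_fcoef (x : pt) i j k : evl x (fC i j k) = bracket_coef th e i j k (sval x).
Proof.
have [Ux xA] := svalP x.
have [|| tb hb] := tangent_bracket hA oU Ux xA (se i) (se j).
- by move=> r; exact: cof_tangent.
- by move=> r; exact: cof_tangent.
rewrite /bracket_coef (cof_pairing _ xA tb) /fcoef /mcof mxE rmorph_sum.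
apply: eq_bigr => m _; rewrite rmorphM /= evl_Tl hb; congr (_ * _).
rewrite [dbrk _ _ _ _ 0 m]mxE rmorphD rmorphB; congr (_ - _ + _).
- apply: evl_act; first exact: smooth_pairing (th0_smooth _ _ oU) (se j).
  by move=> y; rewrite [mframe Pl j 0 m]mxE evl_Pl.
- apply: evl_act; first exact: smooth_pairing (th0_smooth _ _ oU) (se i).
  by move=> y; rewrite [mframe Pl i 0 m]mxE evl_Pl.
- rewrite rmorph_sum; apply: eq_bigr => a _; rewrite rmorph_sum.
  apply: eq_bigr => b _; rewrite !rmorphM /=.
  by rewrite [mframe Pl i 0 a]mxE [mframe Pl j 0 b]mxE !evl_Pl.
Qed.

Local Notation gm := (map_mx kR (gram R)).
Local Notation gmi := (map_mx kR (gram_inv R)).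
Local Notation fG := (fchris (dbrk D strB) (mframe Pl) (mcof Tl) gm gmi (kR 2^-1)).

Lemma evl_fchris (x : pt) i j k : evl x (fG i j k) = levi_civita th e i j k (sval x).
Proof.
have L a b c : evl x (flow (dbrk D strB) (mframe Pl) (mcof Tl) gm a b c) =
    bracket_low th e a b c (sval x).
  rewrite /flow rmorph_sum; apply: eq_bigr => m _.
  by rewrite rmorphM /= evl_fcoef [gm m c]mxE.
rewrite /fchris /levi_civita rmorphM; congr (_ * _).
rewrite rmorph_sum invmx_gram; apply: eq_bigr => l _.
by rewrite rmorphM !rmorphB /= !L [gmi l k]mxE.
Qed.

(** Provides the smooth extension through which [evl_act] differentiates the connection
    coefficients. *)
Lemma levi_civita_smooth i j k : smooth_on U (levi_civita th e i j k).
Proof.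
have sc a b c : smooth_on U (bracket_coef th e a b c).
  by apply: smooth_pairing => //; exact: smooth_lie_bracket.
have sl a b c : smooth_on U (bracket_low th e a b c).
  by apply: smooth_sum => // m; apply: smoothM => //; exact: smooth_cst.
apply: smoothM => //; first exact: smooth_cst.
apply: smooth_sum => // l; apply: smoothM => //; last exact: smooth_cst.
by do 2 apply: smoothB => //.
Qed.

Lemma evl_friem (x : pt) i j k l :
  evl x (friem (dact D) (dbrk D strB) (mframe Pl) (mcof Tl) gm gmi (kR 2^-1) i j k l) =
  riemann th e i j k l (sval x).
Proof.
have RM (a b c d f g : B) : evl x (a * b - c * d - f * g) =
    evl x a * evl x b - evl x c * evl x d - evl x f * evl x g.
  by rewrite !rmorphB !rmorphM.
have C a b c d : evl x (fcurv (dact D) (dbrk D strB) (mframe Pl) (mcof Tl)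
    gm gmi (kR 2^-1) a b c d) = curvature th e a b c d (sval x).
  rewrite /fcurv /curvature rmorphD rmorphB /=; congr (_ - _ + _).
  - by apply: evl_act; [exact: levi_civita_smooth|move=> y; exact: evl_fchris].
  - by apply: evl_act; [exact: levi_civita_smooth|move=> y; exact: evl_fchris].
  - rewrite rmorph_sum; apply: eq_bigr => m _.
    rewrite /= (RM (fG b c m)) (evl_fchris x b c m) (evl_fchris x a m d).
    by rewrite (evl_fchris x a c m) (evl_fchris x b m d) (evl_fchris x m c d) evl_fcoef.
rewrite /friem rmorph_sum; apply: eq_bigr => m _.
by rewrite rmorphM /= C [gm m l]mxE.
Qed.

Lemma evl_ext (x : pt) (al : 'I_5 -> B) (be : E -> E) i j : smooth_field U be ->
  (forall (y : pt) m, evl y (al m) = pairing (be (sval y)) (Efield m (sval y))) ->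
  evl x (ext D strB al i j) = ext_d be (sval x) (Efield i (sval x)) (Efield j (sval x)).
Proof.
move=> sb Hal; have [Ux xA] := svalP x.
rewrite (ext_d_formula oU sb (Efield_smooth i oU) (Efield_smooth j oU) Ux).
have dl m l : evl x (D m (al l)) = 'D_(Efield m (sval x))
    (fun r => pairing (be r) (Efield l r)) (sval x).
  apply: (evl_derl hA) => [|y]; last exact: Hal.
  exact: smooth_pairing (Efield_smooth _ oU).
rewrite /ext !rmorphB /= !dl; congr (_ - _ - _).
rewrite rmorph_sum lie_bracket_Efield pairing_sumr; apply: eq_bigr => m _.
by rewrite rmorphM /= Hal pairingZr.
Qed.

Lemma coframe_quartic (p v : E) : U p -> M p -> Ddist p v ->
  quartic_of_coframe th e p v = - (189 / 25) *
  (pairing (th0 i4 p) v ^+ 2 + 3 * pairing (th0 i5 p) v ^+ 2) ^+ 2.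
Proof.
move=> Up pA Dv.
pose x : pt := exist _ p (conj Up pA).
have [_ [ O1 [ O2 [ O3 [ O4 [ O5 [ O6 [ O7 [[[s1 s2 s3 s4] [s5 s6 s7]] HO]]]]]]]]] := HC.
pose Ol (O : E -> E) (sO : smooth_field U O) m : B :=
  restr A (smooth_pairing oU sO (Efield_smooth m oU) : smooth_on (oset W) _).
have HD := derl_derivations W hA.
have DE k (y : pt) : k = i4 \/ k = i5 -> [/\ evl y (Tl k i1) = 0, evl y (Tl k i2) = 0 &
    evl y (Tl k i3) = 0].
  move=> k45; have [Uy yA] := svalP y; rewrite !evl_Tl; apply: cof_D => //.
  by rewrite (Ddist_flag hA yA); case: k45 => ->; exact: flag_Efield.
have T0 k l : k = i4 \/ k = i5 -> l = i1 \/ l = i2 \/ l = i3 -> Tl k l = 0.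
  move=> k45 l123; apply: evl_inj => y; rewrite rmorph0.
  by have [h1 h2 h3] := DE k y k45; case: l123 => [->|[->|->]].
have HS : cartan_equations D strB (kR (4 / 3)) (Tl^~ i1) (Tl^~ i2) (Tl^~ i3)
    (Tl^~ i4) (Tl^~ i5) (Ol O1 s1) (Ol O2 s2) (Ol O3 s3) (Ol O4 s4) (Ol O5 s5)
    (Ol O6 s6) (Ol O7 s7).
  move=> i j.
  have X k (y : pt) : evl y (ext D strB (Tl^~ k) i j) =
      ext_d (th k) (sval y) (Efield i (sval y)) (Efield j (sval y)).
    by apply: evl_ext => // z m; rewrite evl_Tl.
  have EO (O : E -> E) (sO : smooth_field U O) m (y : pt) :
      evl y (Ol O sO m) = pairing (O (sval y)) (Efield m (sval y)) by [].
  have SE (y : pt) := let: conj Uy yA := svalP y in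
    let: And4 _ _ _ H := HO (sval y) Uy yA in
    H _ _ (Efield_tangent i (sval y)) (Efield_tangent j (sval y)).
  have WE (y : pt) (f g : E) (al be : 'I_5 -> B) :
      (forall m, evl y (al m) = pairing f (Efield m (sval y))) ->
      (forall m, evl y (be m) = pairing g (Efield m (sval y))) ->
      wedge f g (Efield i (sval y)) (Efield j (sval y)) = evl y (wdg al be i j).
    move=> Hf Hg; rewrite /wdg rmorphB (rmorphM _ (al i)) (rmorphM _ (al j)) /=.
    by rewrite !Hf !Hg.
  have R3 (y : pt) (a b c : B) : evl y (a + b + c) = evl y a + evl y b + evl y c.
    by rewrite !rmorphD.
  have R4 (y : pt) (a b c d : B) :
      evl y (a + b + c + d) = evl y a + evl y b + evl y c + evl y d.
    by rewrite !rmorphD.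
  have RM (y : pt) r (b : B) : evl y (kR r * b) = r * evl y b.
    by rewrite rmorphM.
  have RN (y : pt) (b : B) : evl y (- b) = - evl y b by rewrite rmorphN.
  have R2 (y : pt) (a b : B) : evl y (2 * a + b) = 2 * evl y a + evl y b.
    by rewrite rmorphD rmorphM rmorph_nat.
  have R2' (y : pt) (a b : B) : evl y (a + 2 * b) = evl y a + 2 * evl y b.
    by rewrite rmorphD rmorphM rmorph_nat.
  have RD (y : pt) (a b : B) : evl y (a + b) = evl y a + evl y b.
    by rewrite rmorphD.
  split; apply: evl_inj => y; rewrite X; have [E1 E2 E3 E4 E5] := SE y.
  - rewrite E1 R3; congr (_ + _ + _); apply: WE => m; rewrite ?evl_Tl ?EO //.
    by rewrite R2 pairingDl pairingZl.
  - rewrite E2 R3; congr (_ + _ + _); apply: WE => m; rewrite ?evl_Tl ?EO //.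
    by rewrite R2' pairingDl pairingZl.
  - rewrite E3 R4; congr (_ + _ + _ + _); apply: WE => m; rewrite ?evl_Tl ?EO //.
    by rewrite RD pairingDl.
  - rewrite E4 R4 RM; congr (_ + _ * _ + _ + _); apply: WE => m;
      by rewrite ?evl_Tl ?EO.
  - rewrite E5 R4 RN RM; congr (_ - _ * _ + _ + _); apply: WE => m;
      by rewrite ?evl_Tl ?EO.
have T4 : i4 = i4 \/ i4 = i5 :> 'I_5 by left.
have T5 : i5 = i4 \/ i5 = i5 :> 'I_5 by right.
have K1 : i1 = i1 \/ i1 = i2 \/ i1 = i3 :> 'I_5 by left.
have K2 : i2 = i1 \/ i2 = i2 \/ i2 = i3 :> 'I_5 by right; left.
have K3 : i3 = i1 \/ i3 = i2 \/ i3 = i3 :> 'I_5 by right; right.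
have QV := quartic_value HD (derl_cstl W hA) (ev := fun x => evl x) (fun x r => evl_cstl x r)
  (@evl_inj R A W) PlTl
  (T0 _ _ T4 K1) (T0 _ _ T4 K2) (T0 _ _ T4 K3) (T0 _ _ T5 K1) (T0 _ _ T5 K2) (T0 _ _ T5 K3) HS
  x (pairing (th i4 p) v) (pairing (th i5 p) v).
rewrite /quartic_of_coframe weyl_null_plane.
move: QV => /=.
under eq_bigr => i _ do under eq_bigr => j _ do under eq_bigr => k _ do
  under eq_bigr => l _ do rewrite evl_friem.
move=> ->; rewrite !evl_Pl /=.
have [h1 h2 h3] := cof_D Up pA Dv.
have tv : tangent (@area R) p v by move: Dv; rewrite (Ddist_flag hA pA) => -[].
(* Change of frame for a vector of D, which has no components along e_1, e_2, e_3. *)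
have F k : pairing (th0 k p) v = pairing (th i4 p) v * pairing (th0 k p) (e i4 p)
    + pairing (th i5 p) v * pairing (th0 k p) (e i5 p).
  have TP : Tl *m Pl = 1%:M by exact: mulmx1C PlTl.
  transitivity (\sum_l pairing (th l p) v * pairing (th0 k p) (e l p)); last first.
    by rewrite sum5 h1 h2 h3 !mul0r !add0r.
  transitivity (\sum_m pairing (th0 m p) v * evl x ((Tl *m Pl) m k)).
    rewrite TP -[LHS](sum_deltal k (fun m => pairing (th0 m p) v)).
    by apply: eq_bigr => m _; rewrite [1%:M m k]mxE rmorph_nat mulrC.
  under [RHS]eq_bigr => l _ do rewrite (cof_pairing (th l p) pA tv) mulr_suml.
  rewrite exchange_big /=; apply: eq_bigr => m _.
  rewrite mxE rmorph_sum mulr_sumr; apply: eq_bigr => l _.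
  by rewrite rmorphM /= evl_Tl evl_Pl mulrA.
by rewrite (F i4) (F i5).
Qed.

End Independence.

Theorem proposition5p2 (R : realType) (A : R) (hA : A != 0) :
  is_235_distribution (@area R) A (@Ddist R) /\
  exists Q : 'rV[R]_6 -> 'rV[R]_6 -> R,
    is_cartan_quartic (@area R) A (@Ddist R) Q /\
    exists c : R, forall p, area p = A ->
      forall u : 'I_3 -> R, \sum_(i < 3) u i = 0 ->
        Q p (\sum_(i < 3) u i *: Zfield i p) = c * (\sum_(i < 3) u i ^+ 2) ^+ 2.
Proof.
split; first exact: area_235.
exists (fun p v => - (189 / 25) *
  (pairing (th0 A i4 p) v ^+ 2 + 3 * pairing (th0 A i5 p) v ^+ 2) ^+ 2).
split.
  move=> p pA; split.
    exists setT, (th0 A), (@Efield R); split=> //; first exact: openT.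
    exact: reference_coframe.
  by move=> U th e oU Up HC v Dv; rewrite (coframe_quartic hA oU HC).
(* For s = (u_1 - u_2) / 2, z = (u_1 + u_2) / 2 and u_1 + u_2 + u_3 = 0, the form s^2 + 3 z^2 is
   half of u_1^2 + u_2^2 + u_3^2; squaring divides 189/25 by 4. *)
exists (- (189 / 100)) => p pA u u0; rewrite Zfield_comb //.
rewrite !pairingDr !pairingZr !(th0_Efield hA) // sum3.
have -> : u o2 = - (u o0 + u o1).
  by apply/eqP; rewrite -addr_eq0 addrC; move: u0; rewrite sum3 => ->.
by rewrite /=; field.
Qed.
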